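(* Let $F:U\to\mathbb P^{1,s',t'}$ be a local orthogonal map, where $U\subset\mathbb P^{1,s}$ is a connected open set containing a null point. If $s'\le 2s-2$, then $F$ is either null or quasi-standard. If in addition $t'=0$, then $F$ is either constant or standard.
   Context: Let $r,s,t\ge 0$ be integers with $n=r+s+t>0$. $\mathbb C^{r,s,t}$ denotes $\mathbb C^n$ equipped with the (possibly degenerate, indefinite) Hermitian form $\langle z,w\rangle_{r,s,t}=\sum_{j=1}^{r}z_j\bar w_j-\sum_{j=r+1}^{r+s}z_j\bar w_j$, and $\mathbb P^{r,s,t}$ is its projectivization; $\mathbb P^{r,s}=\mathbb P^{r,s,0}$. A point $[z]$ is null if $\langle z,z\rangle_{r,s,t}=0$; $[z]\perp[w]$ if $\langle z,w\rangle_{r,s,t}=0$. A complex linear subspace $H$ (or $\mathbb PH$) is a null space if the form vanishes identically on $H$. A holomorphic map $F:U\to\mathbb P^{r',s',t'}$ on a connected open set $U$ containing a null point is a local orthogonal map if $F(p)\perp F(q)$ for all $p,q\in U$ with $p\perp q$. $F$ is standard if it is induced by a linear isometry $\mathbb C^{r,s,t}\to\mathbb C^{r',s',t'}$ (a linear map $L$ with $\langle Lu,Lv\rangle_{r',s',t'}=\langle u,v\rangle_{r,s,t}$); null if $F(U)$ is contained in a null space. $F$ is quasi-standard if either $F$ is standard, or there is a decomposition $\mathbb C^{r',s',t'}=A\oplus B$ into nonzero subspaces with $\langle a,b\rangle_{r',s',t'}=0$ for all $a\in A,b\in B$ such that $\pi_A\circ F$ is standard and $\pi_B\circ F$ is null,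 where $\pi_A:\mathbb P^{r',s',t'}\dashrightarrow\mathbb PA$, $\pi_B:\mathbb P^{r',s',t'}\dashrightarrow\mathbb PB$ are induced by the linear projections, and $\mathbb PA,\mathbb PB$ carry the restricted forms. *)

(* Defs.v *)
From HB Require Import structures.
From mathcomp Require Import all_boot all_order all_algebra.
From mathcomp Require Import complex.
From mathcomp Require Import all_classical all_reals all_analysis.
Set Implicit Arguments. Unset Strict Implicit. Unset Printing Implicit Defensive.
Import Order.TTheory GRing.Theory Num.Theory.
Import numFieldNormedType.Exports.
Local Open Scope ring_scope.
Local Open Scope classical_set_scope.

HB.instance Definition _ (R : realType) := NormedModule.copy R[i] (R[i])^o.

Section Defs.
Variable R : realType.
Local Notation C := R[i].

(* Hermitian form <z,w>_{r,s,t} on C^n with n = r+s+t: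
   sum_{j<r} z_j conj(w_j) - sum_{r<=j<r+s} z_j conj(w_j). *)
Definition hsign (r s : nat) (j : nat) : C :=
  if (j < r)%N then 1 else if (j < r + s)%N then -1 else 0.

Definition hform (r s : nat) {n : nat} (z w : 'rV[C]_n) : C :=
  \sum_(j < n) hsign r s j * z 0 j * (w 0 j)^*.

Definition proj_eq {n : nat} (u v : 'rV[C]_n) : Prop :=
  u != 0 /\ exists l : C, l != 0 /\ v = l *: u.

(* A subset U of P(C^n) is represented by its cone  Uhat = {z <> 0 : [z] in U}. *)
Definition is_cone {n : nat} (U : set 'rV[C]_n) : Prop :=
  ~ U 0 /\ forall z (l : C), U z -> l != 0 -> U (l *: z).

(* f : 'rV_n -> 'rV_m represents a holomorphic map  F : U -> P(C^m),
   F([z]) = [f z], where U is given by its cone Uhat: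
   f z is a nonzero vector depending (projectively) only on [z], and near
   every point F admits a holomorphic nonvanishing lift. *)
Definition proj_holo_map {n m : nat} (Uhat : set 'rV[C]_n)
  (f : 'rV[C]_n -> 'rV[C]_m) : Prop :=
  (forall z, Uhat z -> f z != 0) /\
  (forall z (l : C), Uhat z -> l != 0 -> proj_eq (f z) (f (l *: z))) /\
  (forall z, Uhat z -> exists V : set 'rV[C]_n,
      [/\ open V, V z, V `<=` Uhat &
       exists g : 'rV[C]_n -> 'rV[C]_m,
         forall w, V w -> [/\ differentiable g w, g w != 0 & proj_eq (g w) (f w)]]).

Definition local_orthogonal (r s r' s' : nat) {n m : nat}
  (Uhat : set 'rV[C]_n) (f : 'rV[C]_n -> 'rV[C]_m) : Prop :=
  forall p q, Uhat p -> Uhat q -> hform r s p q = 0 -> hform r' s' (f p) (f q) = 0.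

Definition lin_isometry (r s r' s' : nat) {n m : nat} (L : 'M[C]_(n, m)) : Prop :=
  forall u v : 'rV[C]_n, hform r' s' (u *m L) (v *m L) = hform r s u v.

Definition standard_map (r s r' s' : nat) {n m : nat}
  (Uhat : set 'rV[C]_n) (f : 'rV[C]_n -> 'rV[C]_m) : Prop :=
  exists L : 'M[C]_(n, m), lin_isometry r s r' s' L /\
    forall z, Uhat z -> proj_eq (z *m L) (f z).

Definition null_space (r' s' : nat) {m k : nat} (H : 'M[C]_(k, m)) : Prop :=
  forall u v : 'rV[C]_m, (u <= H)%MS -> (v <= H)%MS -> hform r' s' u v = 0.

Definition null_map (r' s' : nat) {n m : nat}
  (Uhat : set 'rV[C]_n) (f : 'rV[C]_n -> 'rV[C]_m) : Prop :=
  exists H : 'M[C]_m, null_space r' s' H /\ forall z, Uhat z -> (f z <= H)%MS.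

Definition constant_map {n m : nat}
  (Uhat : set 'rV[C]_n) (f : 'rV[C]_n -> 'rV[C]_m) : Prop :=
  forall p q, Uhat p -> Uhat q -> proj_eq (f p) (f q).

(* quasi-standard: standard, or C^m = A (+) B (A, B nonzero, orthogonal),
   with pi_A o F standard (into PA with the restricted form) and pi_B o F
   null; pi_A, pi_B are the linear projections of the decomposition. *)
Definition quasi_standard (r s r' s' : nat) {n m : nat}
  (Uhat : set 'rV[C]_n) (f : 'rV[C]_n -> 'rV[C]_m) : Prop :=
  standard_map r s r' s' Uhat f \/
  exists A B : 'M[C]_m,
    [/\ [/\ (A :&: B == (0 : 'M[C]_m))%MS, row_full (A + B)%MS, A != 0 & B != 0],
        (forall a b : 'rV[C]_m, (a <= A)%MS -> (b <= B)%MS -> hform r' s' a b = 0),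
        (exists L : 'M[C]_(n, m),
           [/\ (L <= A)%MS, lin_isometry r s r' s' L,
               (exists z, Uhat z /\ f z *m proj_mx A B != 0) &
               forall z, Uhat z -> f z *m proj_mx A B != 0 ->
                 proj_eq (z *m L) (f z *m proj_mx A B)]) &
        (exists H : 'M[C]_m, [/\ (H <= B)%MS, null_space r' s' H &
           forall z, Uhat z -> (f z *m proj_mx B A <= H)%MS])].

End Defs.

(* Main.v *)
(* Near a null point [n], let [g] be a local holomorphic lift of [F], taken modulo
   the radical of the target. If [<g z, g n> = 0] for all [z] near every null
   [n], then [<g z, g w>] vanishes identically, because a holomorphic function
   vanishing on the null cone vanishes; as null spaces of [C^{1,s'}] have dimension
   at most one, [F] is then null.

   Otherwise fix [n] with [<g z, g n>] not identically zero. On the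
   orthogonal complement of a null vector [w] the map [g] takes values in the
   orthogonal complement of [g w], and modulo [w] and [g w] both forms are definite.
   There [s' + 2 <= 2 s] forces lines through [w] into lines through [g w]: if [G]
   spreads some line over two dimensions, passing to the complement of a vector
   drops the source dimension by one and the target dimension by two, and
   induction exhausts the target. Unique continuation from the null cone extends this
   collinearity to the pairs [b], [d] of orthogonal negative vectors. Hence the
   normalized lift [ghat z = (<z, n> / <g z, g n>) g z] satisfies
   [ghat (b + c d) - ghat b] parallel to [g d] for all such [d] orthogonal to [n].
   Comparing nearby directions [d] shows that [ghat] is affine along these lines,
   so it agrees with a linear map near some point. This map preserves
   orthogonality, so it is a multiple of an isometry, and the multiple is
   positive because [1 < s]. Unique continuation carries both alternatives to [U]. *)
Require Import Defs.
From HB Require Import structures.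
From mathcomp Require Import all_boot all_order all_algebra.
From mathcomp Require Import complex.
From mathcomp Require Import all_classical all_reals all_analysis.
From mathcomp Require Import ring lra zify.
Import Order.TTheory GRing.Theory Num.Theory.
Import numFieldNormedType.Exports.
Local Open Scope ring_scope.
Local Open Scope classical_set_scope.
Set Implicit Arguments. Unset Strict Implicit. Unset Printing Implicit Defensive.

(** * Holomorphic functions of one variable *)

(** Linear dependence of images is stated through 2x2 and 3x3 minors: they are holomorphic in the
    points and only rescale with the choice of lift, so unique continuation applies to collinearity.
    The null cone is a real hypersurface; it is cut by complex lines on which the form is
    [a - b * normc x ^+ 2], so that it appears there as a circle, and a holomorphic function
    vanishing on the circle is glued to zero across it. Holomorphic means once complex
    differentiable. The identity theorem is therefore drawn from Goursat's subdivision and the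
    maximum principle, applied to a primitive, for which second derivatives are at hand. The bound
    on [s'] comes from a count: a null vector and its image have orthogonal complements with
    definite quotients of dimensions [s - 1] and at most [s' - 1], and the inequality
    [target + 1 <= 2 * source] between these dimensions survives each step that lowers the source by
    one and the target by two. *)

Section RealPoincare.
Variable R : realType.
Implicit Types (x y u v e d p q : R).

(** An additive function of rectangles. For [E = A - B] with [a] the [x]-derivative of [A] and [b]
    the [y]-derivative of [B], it is up to sign the integral of [a dx + b dy] around the
    boundary. *)
Definition ddiff (E : R -> R -> R) x y u v :=
  E (x + u) (y + v) - E (x + u) y - E x (y + v) + E x y.

(** Goursat's choice: a corner of a quarter rectangle carrying at least a fourth of the mixed
    difference. The last quarter is the default; additivity shows that it qualifies when the other
    three fail. *)
Definition bisect (E : R -> R -> R) (z : R * R) u v : R * R :=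
  let big (c : R * R) := `|ddiff E z.1 z.2 u v| <= 4 * `|ddiff E c.1 c.2 (u / 2) (v / 2)| in
  if big z then z else
  if big (z.1 + u / 2, z.2) then (z.1 + u / 2, z.2) else
  if big (z.1, z.2 + v / 2) then (z.1, z.2 + v / 2) else (z.1 + u / 2, z.2 + v / 2).

Lemma ddiff_bisect E z u v : let c := bisect E z u v in
  `|ddiff E z.1 z.2 u v| <= 4 * `|ddiff E c.1 c.2 (u / 2) (v / 2)|.
Proof.
case: z => x y /=; rewrite /bisect /=.
case: ifPn => // /negbTE/negP n1; case: ifPn => // /negbTE/negP n2.
case: ifPn => //= /negbTE/negP n3.
move: n1 n2 n3 => /negP; rewrite -ltNge => n1 /negP; rewrite -ltNge => n2 /negP; rewrite -ltNge => n3.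
have : ddiff E x y u v = ddiff E x y (u / 2) (v / 2) + ddiff E (x + u / 2) y (u / 2) (v / 2)
  + ddiff E x (y + v / 2) (u / 2) (v / 2) + ddiff E (x + u / 2) (y + v / 2) (u / 2) (v / 2).
  rewrite /ddiff -!addrA -!splitr.
  by rewrite !addrA; ring.
move=> DE; move: n1 n2 n3; rewrite DE.
set a := ddiff E x y _ _; set b := ddiff _ _ _ _ _; set c := ddiff _ _ _ _ _.
set d := ddiff _ _ _ _ _.
have := ler_normD (a + b + c) d; have := ler_normD (a + b) c; have := ler_normD a b.
by move=> *; lra.
Qed.

Lemma bisect_sub E z u v : 0 <= u -> 0 <= v -> let c := bisect E z u v in
  [/\ z.1 <= c.1, c.1 + u / 2 <= z.1 + u, z.2 <= c.2 & c.2 + v / 2 <= z.2 + v].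
Proof.
move=> u0 v0 /=; rewrite /bisect; case: ifP => _; last case: ifP => _; last case: ifP => _;
by split => /=; lra.
Qed.

(** Goursat's argument. The chosen quarters shrink to a point [(p, q)]; at level [k] the factor
    [4 ^+ k] lost by subdividing is exactly recovered from the quadratic smallness at [(p, q)], so
    the total is below any [e]. *)
Lemma small_ddiff0 (E : R -> R -> R) x0 y0 u0 v0 : 0 <= u0 -> 0 <= v0 ->
  (forall p q, x0 <= p <= x0 + u0 -> y0 <= q <= y0 + v0 -> forall e, 0 < e ->
    exists2 d, 0 < d & forall x y u v, 0 <= u -> u < d -> 0 <= v -> v < d ->
      x0 <= x -> x <= p -> p <= x + u -> x + u <= x0 + u0 ->
      y0 <= y -> y <= q -> q <= y + v -> y + v <= y0 + v0 ->
      `|ddiff E x y u v| <= e * (u + v) ^+ 2) ->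
  ddiff E x0 y0 u0 v0 = 0.
Proof.
move=> u00 v00 small.
pose U k := u0 / 2 ^+ k; pose V k := v0 / 2 ^+ k.
pose z := fix z k := if k is k'.+1 then bisect E (z k') (U k') (V k') else (x0, y0).
have U0 k : 0 <= U k by rewrite divr_ge0 // exprn_ge0.
have V0 k : 0 <= V k by rewrite divr_ge0 // exprn_ge0.
have US k : U k.+1 = U k / 2 by rewrite /U exprSr invfM mulrA.
have VS k : V k.+1 = V k / 2 by rewrite /V exprSr invfM mulrA.
have sub k : [/\ (z k).1 <= (z k.+1).1, (z k.+1).1 + U k.+1 <= (z k).1 + U k,
    (z k).2 <= (z k.+1).2 & (z k.+1).2 + V k.+1 <= (z k).2 + V k].
  by rewrite US VS; exact: bisect_sub.
have big k : `|ddiff E x0 y0 u0 v0| <= 4 ^+ k * `|ddiff E (z k).1 (z k).2 (U k) (V k)|.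
  elim: k => [|k IH]; first by rewrite expr0 mul1r /U /V expr0 !divr1.
  apply: le_trans IH _; rewrite exprSr -mulrA ler_pM2l ?exprn_gt0 //.
  by rewrite US VS; exact: ddiff_bisect.
have mono1 : {homo (fun k => (z k).1) : m n / (m <= n)%N >-> m <= n}.
  by apply: homo_leq => [?||i]; [exact: lexx|exact: le_trans|case: (sub i)].
have mono2 : {homo (fun k => (z k).2) : m n / (m <= n)%N >-> m <= n}.
  by apply: homo_leq => [?||i]; [exact: lexx|exact: le_trans|case: (sub i)].
have anti1 : {homo (fun k => (z k).1 + U k) : m n / (m <= n)%N >-> n <= m}.
  by apply: (@homo_leq _ _ (fun x y => y <= x)) => [?|y x t yx ty|i]; [exact: lexx|exact: le_trans ty yx|case: (sub i)].
have anti2 : {homo (fun k => (z k).2 + V k) : m n / (m <= n)%N >-> n <= m}.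
  by apply: (@homo_leq _ _ (fun x y => y <= x)) => [?|y x t yx ty|i]; [exact: lexx|exact: le_trans ty yx|case: (sub i)].
have in1 m n : (z m).1 <= (z n).1 + U n.
  have := mono1 _ _ (leq_maxl m n); have := anti1 _ _ (leq_maxr m n).
  by have := U0 (maxn m n); lra.
have in2 m n : (z m).2 <= (z n).2 + V n.
  have := mono2 _ _ (leq_maxl m n); have := anti2 _ _ (leq_maxr m n).
  by have := V0 (maxn m n); lra.
pose p := sup (range (fun k => (z k).1)); pose q := sup (range (fun k => (z k).2)).
have hs1 : has_sup (range (fun k => (z k).1)).
  split; first by exists (z 0%N).1; exists 0%N.
  by exists ((z 0%N).1 + U 0%N) => _ [m _ <-].
have hs2 : has_sup (range (fun k => (z k).2)).
  split; first by exists (z 0%N).2; exists 0%N.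
  by exists ((z 0%N).2 + V 0%N) => _ [m _ <-].
have zp k : (z k).1 <= p by apply: ub_le_sup; [exact: hs1.2|exists k].
have zq k : (z k).2 <= q by apply: ub_le_sup; [exact: hs2.2|exists k].
have pz k : p <= (z k).1 + U k by apply: ge_sup; [exact: hs1.1|move=> _ [m _ <-]].
have qz k : q <= (z k).2 + V k by apply: ge_sup; [exact: hs2.1|move=> _ [m _ <-]].
have U00 : U 0%N = u0 by rewrite /U expr0 divr1.
have V00 : V 0%N = v0 by rewrite /V expr0 divr1.
apply/eqP; rewrite -normr_le0; apply/ler_addgt0Pl => e e0; rewrite addr0.
(* The [+ 1] keeps the denominator positive for a rectangle reduced to a point. *)
pose e' := e / ((u0 + v0) ^+ 2 + 1).
have D0 : 0 < (u0 + v0) ^+ 2 + 1 by rewrite ltr_wpDl // sqr_ge0.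
have e'0 : 0 < e' by rewrite divr_gt0.
have [||d d0 H] := small p q _ _ e' e'0.
- by have := zp 0%N; have := pz 0%N; rewrite U00 /= => -> ->.
- by have := zq 0%N; have := qz 0%N; rewrite V00 /= => -> ->.
have [k [Uk Vk]] : exists k, U k < d /\ V k < d.
  have [k Hk] : exists k, (u0 + v0) / d < 2 ^+ k.
    exists (Num.bound ((u0 + v0) / d)).
    apply: lt_le_trans (archi_boundP _) _; first by rewrite divr_ge0 // ?addr_ge0 // ltW.
    by rewrite -natrX ler_nat ltnW // ltn_expl.
  exists k; have k0 : 0 < (2 : R) ^+ k by rewrite exprn_gt0.
  rewrite ltr_pdivrMr // ltr_pdivrMr // mulrC.
  rewrite ltr_pdivrMr // in Hk; split; lra.
have /= := H (z k).1 (z k).2 (U k) (V k) (U0 k) Uk (V0 k) Vk.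
have m1 := mono1 _ _ (leq0n k); have m2 := mono2 _ _ (leq0n k).
have a1 := anti1 _ _ (leq0n k); have a2 := anti2 _ _ (leq0n k).
rewrite U00 in a1; rewrite V00 in a2.
move=> /(_ m1 (zp k) (pz k) a1 m2 (zq k) (qz k) a2) Hk.
apply: le_trans (big k) _.
have k0 : 0 < (4 : R) ^+ k by rewrite exprn_gt0.
apply: (@le_trans _ _ (4 ^+ k * (e' * (U k + V k) ^+ 2))); first by rewrite ler_pM2l.
have -> : 4 ^+ k * (e' * (U k + V k) ^+ 2) = e' * (u0 + v0) ^+ 2.
  have -> : (4 : R) ^+ k = (2 ^+ k) ^+ 2 by rewrite -exprM mulnC exprM; congr (_ ^+ k); ring.
  by rewrite /U /V; field; rewrite expf_neq0.
rewrite /e' -mulrA ler_piMr ?(ltW e0) //.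
by rewrite mulrC ler_pdivrMr // mul1r lerDl.
Qed.

End RealPoincare.

(** * Closed differential forms on a square are exact *)

Section RealPoincare2.
Variable R : realType.
Implicit Types (x y u v e d p q r : R).

Definition rdiff (a : R -> R -> R) ax ay p q :=
  forall e, 0 < e -> exists2 d, 0 < d & forall x y, `|x - p| < d -> `|y - q| < d ->
    `|a x y - a p q - ax * (x - p) - ay * (y - q)| <= e * (`|x - p| + `|y - q|).

Lemma rdiff_cvg a ax ay p q : rdiff a ax ay p q ->
  forall e, 0 < e -> exists2 d, 0 < d & forall x y, `|x - p| < d -> `|y - q| < d ->
    `|a x y - a p q| < e.
Proof.
move=> ha e e0; have [d d0 H] := ha 1 ltr01.
pose K := `|ax| + `|ay| + 2.
have K0 : 0 < K by rewrite /K; have := normr_ge0 ax; have := normr_ge0 ay; lra.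
exists (Num.min d (e / (2 * K))); first by rewrite lt_min d0 divr_gt0 // mulr_gt0.
move=> x y; rewrite !lt_min => /andP[xd xe] /andP[yd ye].
have := H x y xd yd; rewrite mul1r => h.
rewrite ltr_pdivlMr ?mulr_gt0 // in xe; rewrite ltr_pdivlMr ?mulr_gt0 // in ye.
have -> : a x y - a p q = (a x y - a p q - ax * (x - p) - ay * (y - q)) + ax * (x - p) + ay * (y - q).
  by ring.
apply: le_lt_trans (ler_normD _ _) _.
have := ler_normD (a x y - a p q - ax * (x - p) - ay * (y - q)) (ax * (x - p)).
rewrite !normrM => h2.
move: h h2 xe ye; move: (`|_ + _|) (`|_ - _ - _ - _|) => c1 c2.
rewrite /K; have := normr_ge0 ax; have := normr_ge0 ay; have := normr_ge0 (x-p); have := normr_ge0 (y - q).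
move: `|x - p| `|y - q| `|ax| `|ay| => X Y A B; nra.
Qed.

Lemma mean_value (f df : R -> R) x u : 0 <= u ->
  (forall t, x <= t <= x + u -> is_derive t 1 f (df t)) ->
  exists2 c, x <= c <= x + u & f (x + u) - f x = df c * u.
Proof.
move=> u0 fD.
have xu : x <= x + u by rewrite lerDl.
have [||c] := @MVT_segment R f df x (x + u) xu.
- by move=> t; rewrite in_itv /= => /andP[/ltW ? /ltW ?]; apply: fD; apply/andP.
- apply: derivable_within_continuous => t; rewrite in_itv /= => tI.
  by have [] := fD t tI.
- rewrite in_itv /= => cI ->; exists c => //; congr (_ * _).
  by rewrite addrAC subrr add0r.
Qed.

(** The integral is based at the left end [- r], as the fundamental theorem wants it, and then
    shifted so that the antiderivative vanishes at 0. *)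
Definition prim r (f : R -> R) x : R :=
  parameterized_integral lebesgue_measure (- r) x f -
  parameterized_integral lebesgue_measure (- r) 0 f.

Lemma prim0 r f : prim r f 0 = 0. Proof. exact: subrr. Qed.

Lemma is_derive_prim r (f : R -> R) : (forall x, `|x| <= r -> {for x, continuous f}) ->
  forall x, `|x| < r -> is_derive x 1 (prim r f) (f x).
Proof.
move=> fc x xr.
have r0 : 0 < r by apply: le_lt_trans xr.
have intf : lebesgue_measure.-integrable `[- r, r] (EFin \o f).
  apply: continuous_compact_integrable; first exact: segment_compact.
  apply: continuous_in_subspaceT => t; rewrite inE /= in_itv /= => tI.
  by apply: fc; rewrite ler_norml.
move: xr; rewrite ltr_norml => /andP[x1 x2].
have [|D DE] := @continuous_FTC1_closed R f (- r) x r x2 intf x1.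
  by apply: fc; rewrite ler_norml !ltW.
rewrite -[f x]subr0 -DE derive1E; exact: is_deriveB.
Qed.

Lemma rdiff_continuous_l a ax ay p q : rdiff a ax ay p q -> {for p, continuous (a^~ q)}.
Proof.
move=> h; apply/cvgrPdist_lt => /= e e0.
have [d d0 H] := rdiff_cvg h e0.
exists d => // t /= td; rewrite distrC; by apply: H; rewrite ?subrr ?normr0 // distrC ?subrr ?normr0.
Qed.

Lemma rdiff_continuous_r a ax ay p q : rdiff a ax ay p q -> {for q, continuous (a p)}.
Proof.
move=> h; apply/cvgrPdist_lt => /= e e0.
have [d d0 H] := rdiff_cvg h e0.
exists d => // t /= td; rewrite distrC; by apply: H; rewrite ?subrr ?normr0 // distrC ?subrr ?normr0.
Qed.

Section Closed.
Variables (r : R) (a b : R -> R -> R).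
Hypothesis dab : forall p q, `|p| <= r -> `|q| <= r ->
  exists ax m b_y, rdiff a ax m p q /\ rdiff b m b_y p q.

Let A x y := prim r (a^~ y) x.
Let B x y := prim r (b x) y.

Let dA x y : `|x| < r -> `|y| <= r -> is_derive x 1 (A^~ y) (a x y).
Proof.
move=> xr yr; apply: is_derive_prim => // t tr.
by have [? [? [? [h _]]]] := dab tr yr; apply: rdiff_continuous_l h.
Qed.

Let dB x y : `|x| <= r -> `|y| < r -> is_derive y 1 (B x) (b x y).
Proof.
move=> xr yr; apply: is_derive_prim => // t tr.
by have [? [? [? [_ h]]]] := dab xr tr; apply: rdiff_continuous_r h.
Qed.

Let itvr x0 u0 t : - r < x0 -> x0 + u0 < r -> x0 <= t <= x0 + u0 -> `|t| < r.
Proof. by move=> ? ? /andP[? ?]; rewrite ltr_norml; apply/andP; split; lra. Qed.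

(** The mean value theorem, in [x] for [A] and in [y] for [B], compares two values of [a] (or [b])
    at a common abscissa (or ordinate). Both mixed differences are then [m * u * v] up to a
    quadratically small error, and the shared cross derivative [m] cancels. No continuity of the
    derivatives enters. *)
Let ddiffAB x0 y0 u0 v0 : 0 <= u0 -> 0 <= v0 -> - r < x0 -> x0 + u0 < r ->
  - r < y0 -> y0 + v0 < r -> ddiff (fun x y => A x y - B x y) x0 y0 u0 v0 = 0.
Proof.
move=> u00 v00 x0r xur y0r yur; apply: small_ddiff0 => // p q pI qI e e0.
have pr := itvr x0r xur pI; have qr := itvr y0r yur qI.
have [ax [m [b_y [ha hb]]]] := dab (ltW pr) (ltW qr).
have e4 : 0 < e / 4 by rewrite divr_gt0.
have [d1 d10 H1] := ha _ e4; have [d2 d20 H2] := hb _ e4.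
exists (Num.min d1 d2); first by rewrite lt_min d10.
move=> x y u v u0'; rewrite lt_min => /andP[u1 u2] v0'; rewrite lt_min => /andP[v1 v2].
move=> xx0 xp pxu xu0 yy0 yq qyv yv0.
have near_p t : x <= t <= x + u -> `|t - p| <= u /\ `|t| < r.
  by clear -x0r xur y0r yur xx0 xp pxu xu0 yy0 yq qyv yv0 => /andP[? ?]; rewrite ler_norml ltr_norml; split; apply/andP; split; lra.
have near_q t : y <= t <= y + v -> `|t - q| <= v /\ `|t| < r.
  by clear -x0r xur y0r yur xx0 xp pxu xu0 yy0 yq qyv yv0 => /andP[? ?]; rewrite ler_norml ltr_norml; split; apply/andP; split; lra.
have [yI1 yI2] : y <= y <= y + v /\ y <= y + v <= y + v by rewrite !lexx !lerDl v0'.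
have [xI1 xI2] : x <= x <= x + u /\ x <= x + u <= x + u by rewrite !lexx !lerDl u0'.
have estA : `|ddiff A x y u v - m * v * u| <= e / 4 * (2 * (u + v)) * u.
  have [|c cI cE] := @mean_value (fun t => A t (y + v) - A t y) (fun t => a t (y + v) - a t y) x u u0'.
    move=> t tI; have [_ tr] := near_p _ tI.
    by apply: is_deriveB; apply: dA => //; apply: ltW; apply: (near_q _ _).2.
  have -> : ddiff A x y u v - m * v * u = (a c (y + v) - a c y - m * v) * u.
    by rewrite mulrBl -cE /ddiff; ring.
  rewrite normrM (ger0_norm u0') ler_wpM2r //.
  have [cp cr] := near_p _ cI; have [yp1 _] := near_q _ yI1; have [yp2 _] := near_q _ yI2.
  have := H1 c (y + v); have := H1 c y.
  move=> /(_ (le_lt_trans cp u1) (le_lt_trans yp1 v1)) h1.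
  move=> /(_ (le_lt_trans cp u1) (le_lt_trans yp2 v1)) h2.
  have -> : a c (y + v) - a c y - m * v = (a c (y + v) - a p q - ax * (c - p) - m * (y + v - q))
    - (a c y - a p q - ax * (c - p) - m * (y - q)) by ring.
  apply: le_trans (ler_normB _ _) _; apply: le_trans (lerD h2 h1) _.
  by rewrite -mulrDr ler_pM2l //; clear -cp yp1 yp2; lra.
have estB : `|ddiff B x y u v - m * u * v| <= e / 4 * (2 * (u + v)) * v.
  have [|c cI cE] := @mean_value (fun t => B (x + u) t - B x t) (fun t => b (x + u) t - b x t) y v v0'.
    move=> t tI; have [_ tr] := near_q _ tI.
    by apply: is_deriveB; apply: dB => //; apply: ltW; apply: (near_p _ _).2.
  have -> : ddiff B x y u v - m * u * v = (b (x + u) c - b x c - m * u) * v.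
    by rewrite mulrBl -cE /ddiff; ring.
  rewrite normrM (ger0_norm v0') ler_wpM2r //.
  have [cp cr] := near_q _ cI; have [yp1 _] := near_p _ xI1; have [yp2 _] := near_p _ xI2.
  have := H2 (x + u) c; have := H2 x c.
  move=> /(_ (le_lt_trans yp1 u2) (le_lt_trans cp v2)) h1.
  move=> /(_ (le_lt_trans yp2 u2) (le_lt_trans cp v2)) h2.
  have -> : b (x + u) c - b x c - m * u = (b (x + u) c - b p q - m * (x + u - p) - b_y * (c - q))
    - (b x c - b p q - m * (x - p) - b_y * (c - q)) by ring.
  apply: le_trans (ler_normB _ _) _; apply: le_trans (lerD h2 h1) _.
  by rewrite -mulrDr ler_pM2l //; clear -cp yp1 yp2; lra.
have -> : ddiff (fun x y => A x y - B x y) x y u v =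
  (ddiff A x y u v - m * v * u) - (ddiff B x y u v - m * u * v) by rewrite /ddiff; ring.
apply: le_trans (ler_normB _ _) _; apply: le_trans (lerD estA estB) _.
have -> : e / 4 * (2 * (u + v)) * u + e / 4 * (2 * (u + v)) * v = e * (u + v) ^+ 2 / 2 by field.
by rewrite ler_pdivrMr // ler_peMr ?ler1n // mulr_ge0 ?sqr_ge0 // ltW.
Qed.

Let cornerAB x y : `|x| < r -> `|y| < r -> A x y - B x y = A x 0 - B 0 y.
Proof.
move=> xr yr; have [x1 x2] := (ltr_normlW xr, ltrNnormlW xr).
have [y1 y2] := (ltr_normlW yr, ltrNnormlW yr).
have A0 t : A 0 t = 0 by exact: prim0.
have B0 t : B t 0 = 0 by exact: prim0.
have := A0 0; have := A0 y; have := B0 0; have := B0 x.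
pose D := fun x y => A x y - B x y.
have [x0|x0] := leP 0 x; have [y0|y0] := leP 0 y.
- have : ddiff D 0 0 x y = 0 by apply: ddiffAB => //; lra.
  by rewrite /ddiff /D !add0r; lra.
- have : ddiff D 0 y x (- y) = 0 by apply: ddiffAB => //; lra.
  by rewrite /ddiff /D !add0r subrr; lra.
- have : ddiff D x 0 (- x) y = 0 by apply: ddiffAB => //; lra.
  by rewrite /ddiff /D !add0r subrr; lra.
- have : ddiff D x y (- x) (- y) = 0 by apply: ddiffAB => //; lra.
  by rewrite /ddiff /D !subrr; lra.
Qed.

(** The potential integrates along the two edges from the origin. As [A x 0 + B x y] it visibly has
    [y]-derivative [b]; by [cornerAB] it is also [A x y + B 0 y], which has [x]-derivative [a]. *)
Lemma closed_exact : exists F : R -> R -> R, forall x y, `|x| < r -> `|y| < r ->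
  is_derive x 1 (F^~ y) (a x y) /\ is_derive y 1 (F x) (b x y).
Proof.
exists (fun x y => A x 0 + B x y) => x y xr yr; split.
  rewrite -[a x y]addr0.
  have h : is_derive x 1 (fun t => A t y + B 0 y) (a x y + 0).
    by apply: is_deriveD; exact: dA xr (ltW yr).
  apply: near_eq_is_derive h.
  exists (r - `|x|); rewrite /= ?subr_gt0 // => t /= xt.
  have /cornerAB /(_ yr) : `|t| < r.
    by have := ler_normB x (x - t); rewrite opprB addrC subrK; lra.
  by lra.
rewrite -[b x y]add0r; apply: is_deriveD; last exact: dB (ltW xr) yr.
Qed.

End Closed.
End RealPoincare2.

(** * Complex derivatives and the Cauchy-Riemann equations *)

Section ComplexDerivative.
Variable R : realType.
Notation C := R[i].
Local Notation normc := (@ComplexField.Normc.normc R).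
Local Open Scope complex_scope.
Implicit Types (h f : C -> C) (z w c : C) (x y p q r : R).

Definition cdiff h z c := forall e : R, 0 < e -> exists2 d : R, 0 < d &
  forall w, normc (w - z) < d -> normc (h w - h z - c * (w - z)) <= e * normc (w - z).

Lemma norm_normc z : `|z| = (normc z)%:C. Proof. by case: z. Qed.

Lemma normc_ge0 z : 0 <= normc z. Proof. by case: z => x y; exact: sqrtr_ge0. Qed.

Lemma normc_gt0 z : (0 < normc z) = (z != 0).
Proof. by rewrite -ltcR -norm_normc normr_gt0. Qed.

Lemma ler_normcD z w : normc (z + w) <= normc z + normc w.
Proof. by rewrite -lecR rmorphD /= -!norm_normc ler_normD. Qed.

Lemma ler_normcB z w : normc (z - w) <= normc z + normc w.
Proof. by rewrite -lecR rmorphD /= -!norm_normc ler_normB. Qed.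

Lemma normcB z w : normc (z - w) = normc (w - z).
Proof. by apply: complexI; rewrite -!norm_normc distrC. Qed.

Lemma normc_mul z w : normc (z * w) = normc z * normc w.
Proof. by apply: complexI; rewrite rmorphM /= -!norm_normc normrM. Qed.

Lemma normc_Re z : `|complex.Re z| <= normc z.
Proof.
case: z => x y /=; rewrite -sqrtr_sqr; apply: ler_wsqrtr; by rewrite lerDl sqr_ge0.
Qed.

Lemma normc_Im z : `|complex.Im z| <= normc z.
Proof.
case: z => x y /=; rewrite -sqrtr_sqr; apply: ler_wsqrtr; by rewrite lerDr sqr_ge0.
Qed.

Lemma normc_ReIm z : normc z <= `|complex.Re z| + `|complex.Im z|.
Proof.
case: z => x y /=; rewrite -[leRHS]ger0_norm ?addr_ge0 // -sqrtr_sqr ler_wsqrtr //.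
rewrite sqrrD !real_normK ?num_real //.
by rewrite -addrA lerD2l lerDr mulrn_wge0 // mulr_ge0.
Qed.

Lemma posC_Re (e : C) : 0 < e -> 0 < complex.Re e /\ e = (complex.Re e)%:C.
Proof. by case: e => a b; rewrite ltcE /= => /andP[/eqP -> ->]. Qed.

Lemma cdiff_is_derive h z c : cdiff h z c <-> is_derive z 1 h c.
Proof.
split=> [hd|[hd <-]].
- have lim : t^-1 *: ((h \o shift z) (t *: (1 : C)) - h z) @[t --> 0^'] --> c.
    apply/cvgrPdist_le => e /posC_Re[e0 ->].
    have [d d0 H] := hd _ e0.
    exists d%:C; first by rewrite /= ltcR.
    move=> t /=; rewrite sub0r normrN norm_normc ltcR => td t0.
    rewrite distrC norm_normc lecR.
    have := H (t + z); rewrite addrK => /(_ td) Ht.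
    rewrite -(@ler_pM2r _ (normc t)) ?normc_gt0 //.
    apply: le_trans _ Ht; rewrite -normc_mul mulrBl /GRing.scale /= mulr1.
    by rewrite mulrAC mulVf // mul1r.
  apply: DeriveDef; first by apply/cvg_ex; exists c.
  exact: cvg_lim lim.
- have lim : t^-1 *: ((h \o shift z) (t *: (1 : C)) - h z) @[t --> 0^'] --> 'D_1 h z by [].
  move=> e e0; have eC : 0 < e%:C by rewrite ltcR.
  move/cvgrPdist_le : lim => /(_ _ eC)[d /= /posC_Re[d0 ->] H].
  exists (complex.Re d) => // w wd.
  have [->|wz] := eqVneq w z; first by rewrite !subrr mulr0 subr0 /= !expr0n /= addr0 sqrtr0 mulr0.
  have /H : `|0 - (w - z)| < (complex.Re d)%:C by rewrite sub0r normrN norm_normc ltcR.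
  rewrite subr_eq0 => /(_ wz); rewrite distrC norm_normc lecR /GRing.scale /= mulr1 subrK.
  have wz0 : w - z != 0 by rewrite subr_eq0.
  rewrite -(@ler_pM2r _ (normc (w - z))) ?normc_gt0 //; apply: le_trans.
  by rewrite -normc_mul mulrBl mulrAC mulVf // mul1r.
Qed.

Lemma cdiff_Re h x y c : cdiff h (x +i* y) c ->
  rdiff (fun x y => complex.Re (h (x +i* y))) (complex.Re c) (- complex.Im c) x y.
Proof.
move=> hd e e0; have e2 : 0 < e by [].
have [d d0 H] := hd _ e2; exists (d / 2); first by rewrite divr_gt0.
move=> p q pd qd.
have dE : p +i* q - (x +i* y) = (p - x) +i* (q - y) by [].
have nd : normc (p +i* q - (x +i* y)) <= `|p - x| + `|q - y| by rewrite dE; exact: normc_ReIm.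
have /H Hw : normc (p +i* q - (x +i* y)) < d by lra.
apply: le_trans (le_trans Hw _); last by rewrite ler_pM2l.
apply: le_trans (normc_Re _); rewrite dE.
move: (h _) (h _) c {H hd Hw} => [a1 a2] [b1 b2] [c1 c2] /=.
by rewrite le_eqVlt; apply/orP; left; apply/eqP; congr (`|_|); ring.
Qed.

Lemma cdiff_Im h x y c : cdiff h (x +i* y) c ->
  rdiff (fun x y => complex.Im (h (x +i* y))) (complex.Im c) (complex.Re c) x y.
Proof.
move=> hd e e0; have e2 : 0 < e by [].
have [d d0 H] := hd _ e2; exists (d / 2); first by rewrite divr_gt0.
move=> p q pd qd.
have dE : p +i* q - (x +i* y) = (p - x) +i* (q - y) by [].
have nd : normc (p +i* q - (x +i* y)) <= `|p - x| + `|q - y| by rewrite dE; exact: normc_ReIm.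
have /H Hw : normc (p +i* q - (x +i* y)) < d by lra.
apply: le_trans (le_trans Hw _); last by rewrite ler_pM2l.
apply: le_trans (normc_Im _); rewrite dE.
move: (h _) (h _) c {H hd Hw} => [a1 a2] [b1 b2] [c1 c2] /=.
by rewrite le_eqVlt; apply/orP; left; apply/eqP; congr (`|_|); ring.
Qed.

Lemma rdiff_cdiff (F1 F2 : R -> R -> R) x y a b : rdiff F1 a (- b) x y -> rdiff F2 b a x y ->
  cdiff (fun z => F1 (complex.Re z) (complex.Im z) +i* F2 (complex.Re z) (complex.Im z))
    (x +i* y) (a +i* b).
Proof.
move=> h1 h2 e e0; have e4 : 0 < e / 4 by rewrite divr_gt0.
have [d1 d10 H1] := h1 _ e4; have [d2 d20 H2] := h2 _ e4.
exists (Num.min d1 d2); first by rewrite lt_min d10.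
move=> [p q]; have -> : p +i* q - (x +i* y) = (p - x) +i* (q - y) by [].
have nR := normc_Re ((p - x) +i* (q - y)); have nI := normc_Im ((p - x) +i* (q - y)).
move: nR nI; move: (normc ((p - x) +i* (q - y))) => N nR nI wd.
apply: (le_trans (normc_ReIm _)); move: nR nI => /= nR nI.
have := le_lt_trans nR wd; rewrite lt_min => /andP[p1 p2].
have := le_lt_trans nI wd; rewrite lt_min => /andP[q1 q2].
have {}H1 := H1 _ _ p1 q1; have {}H2 := H2 _ _ p2 q2.
apply: (@le_trans _ _ (e / 4 * (`|p - x| + `|q - y|) + e / 4 * (`|p - x| + `|q - y|))).
  apply: lerD; [apply: le_trans H1|apply: le_trans H2]; rewrite le_eqVlt;
  by apply/orP; left; apply/eqP; congr (`|_|); ring.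
have -> : e * N = e / 4 * (N + N) + e / 4 * (N + N) by field.
by rewrite lerD // ler_pM2l // lerD.
Qed.

Lemma mean_value_abs (f df : R -> R) (u v : R) :
  (forall t : R, `|t - u| <= `|v - u| -> is_derive t 1 f (df t)) ->
  exists2 t : R, `|t - u| <= `|v - u| & f v - f u = df t * (v - u).
Proof.
move=> fD; have [uv|vu] := leP u v.
  have [||t /andP[t1 t2] tE] := @mean_value _ f df u (v - u); first by rewrite subr_ge0.
    move=> t /andP[t1 t2]; apply: fD; rewrite addrC subrK in t2.
    by rewrite !ger0_norm ?subr_ge0 // lerD2r.
  rewrite addrC subrK in t2 tE; exists t => //.
  by rewrite !ger0_norm ?subr_ge0 // lerD2r.
have [||t /andP[t1 t2] tE] := @mean_value _ f df v (u - v); first by rewrite subr_ge0 ltW.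
  move=> t /andP[t1 t2]; apply: fD; rewrite addrC subrK in t2.
  by rewrite distrC (distrC v) !ger0_norm ?subr_ge0 ?(ltW vu) // lerD2l lerN2.
rewrite addrC subrK in t2 tE; exists t; last by rewrite -opprB tE -mulrN opprB.
by rewrite distrC (distrC v) !ger0_norm ?subr_ge0 ?(ltW vu) // lerD2l lerN2.
Qed.

Lemma rdiff_partial (F a b : R -> R -> R) x y r ax ay bx b_y : 0 < r ->
  (forall p q, `|p - x| < r -> `|q - y| < r ->
    is_derive p 1 (F^~ q) (a p q) /\ is_derive q 1 (F p) (b p q)) ->
  rdiff a ax ay x y -> rdiff b bx b_y x y -> rdiff F (a x y) (b x y) x y.
Proof.
move=> r0 FD ha hb e e0.
have [d1 d10 H1] := rdiff_cvg ha e0; have [d2 d20 H2] := rdiff_cvg hb e0.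
exists (Num.min r (Num.min d1 d2)); first by rewrite !lt_min r0 d10.
move=> p q; rewrite !lt_min => /and3P[pr p1 p2] /and3P[qr q1 q2].
have [|t1 t1I E1] := @mean_value_abs (F^~ y) (a^~ y) x p.
  by move=> t tp; apply: (FD _ _ _ _).1; rewrite ?subrr ?normr0 //; exact: le_lt_trans tp pr.
have [|t2 t2I E2] := @mean_value_abs (F p) (b p) y q.
  by move=> t tq; apply: (FD _ _ _ _).2 => //; exact: le_lt_trans tq qr.
have -> : F p q - F x y - a x y * (p - x) - b x y * (q - y) =
    (a t1 y - a x y) * (p - x) + (b p t2 - b x y) * (q - y).
  by rewrite !mulrBl -E1 -E2; ring.
apply: le_trans (ler_normD _ _) _; rewrite !normrM mulrDr.
apply: lerD; apply: ler_wpM2r => //; apply: ltW.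
  by apply: H1; rewrite ?subrr ?normr0 //; exact: le_lt_trans t1I p1.
by apply: H2 => //; exact: le_lt_trans t2I q2.
Qed.

(** For [h = u + i v] the Cauchy-Riemann equations say that [u dx - v dy] and [v dx + u dy] are
    closed; their potentials are the real and imaginary parts of the primitive. *)
Lemma cdiff_primitive h (dh : C -> C) r : 0 < r ->
  (forall p q, `|p| <= r -> `|q| <= r -> cdiff h (p +i* q) (dh (p +i* q))) ->
  exists F : C -> C, forall p q, `|p| < r -> `|q| < r -> cdiff F (p +i* q) (h (p +i* q)).
Proof.
move=> r0 hd.
pose u p q := complex.Re (h (p +i* q)); pose v p q := complex.Im (h (p +i* q)).
have du p q (pr : `|p| <= r) (qr : `|q| <= r) := cdiff_Re (hd p q pr qr).
have dv p q (pr : `|p| <= r) (qr : `|q| <= r) := cdiff_Im (hd p q pr qr).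
have rdN (a : R -> R -> R) ax ay p q : rdiff a ax ay p q -> rdiff (fun x y => - a x y) (- ax) (- ay) p q.
  move=> ha e /ha[d d0 H]; exists d => // x y xp yq; apply: le_trans (H _ _ xp yq).
  by rewrite -normrN le_eqVlt; apply/orP; left; apply/eqP; congr (`|_|); ring.
have [|F1 H1] := @closed_exact R r u (fun x y => - v x y).
  move=> p q pr qr; do 3 eexists; split; first exact: du.
  exact: rdN (dv _ _ pr qr).
have [|F2 H2] := @closed_exact R r v u.
  move=> p q pr qr; do 3 eexists; split; [exact: dv|exact: du].
exists (fun z => F1 (complex.Re z) (complex.Im z) +i* F2 (complex.Re z) (complex.Im z)) => p q pr qr.
have -> : h (p +i* q) = u p q +i* v p q by rewrite /u /v; case: (h _).
pose s := Num.min (r - `|p|) (r - `|q|).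
have s0 : 0 < s by rewrite lt_min !subr_gt0 pr.
have near_ x y : `|x - p| < s -> `|y - q| < s -> `|x| < r /\ `|y| < r.
  rewrite !lt_min => /andP[xp _] /andP[_ yq].
  by have := ler_normD (x - p) p; have := ler_normD (y - q) q; rewrite !subrK => *; split; lra.
have [du' dv'] := (du _ _ (ltW pr) (ltW qr), dv _ _ (ltW pr) (ltW qr)).
apply: rdiff_cdiff.
  apply: (rdiff_partial s0 _ du' (rdN _ _ _ _ _ dv')) => x y xp yq.
  by have [xr yr] := near_ _ _ xp yq; exact: H1.
apply: (rdiff_partial s0 _ dv' du') => x y xp yq.
by have [xr yr] := near_ _ _ xp yq; exact: H2.
Qed.

End ComplexDerivative.

(** * The maximum principle *)

Section MaxPrinciple.
Variable R : realType.
Notation C := R[i].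
Local Notation normc := (@ComplexField.Normc.normc R).
Local Open Scope complex_scope.
Implicit Types (x y p q r s u v : R).

Lemma rdiff_is_derive_l (a : R -> R -> R) ax ay p q : rdiff a ax ay p q -> is_derive p 1 (a^~ q) ax.
Proof.
move=> ha.
have lim : t^-1 *: (((a^~ q) \o shift p) (t *: (1 : R)) - a p q) @[t --> 0^'] --> ax.
  apply/cvgrPdist_le => e e0; have [d d0 H] := ha _ e0.
  exists d => // t /=; rewrite sub0r normrN => td t0.
  have := H (t + p) q; rewrite !subrr normr0 mulr0 subr0 addr0 addrK => /(_ td d0) Ht.
  rewrite -(@ler_pM2r _ `|t|) ?normr_gt0 //; apply: le_trans _ Ht.
  rewrite -normrM -[leRHS]normrN /GRing.scale /= mulr1 mulrBl mulrAC mulVf // mul1r.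
  by rewrite le_eqVlt; apply/orP; left; apply/eqP; congr (`|_|); ring.
by apply: DeriveDef; [apply/cvg_ex; exists ax|exact: cvg_lim lim].
Qed.

Lemma rdiff_swap (a : R -> R -> R) ax ay p q : rdiff a ax ay p q -> rdiff (fun x y => a y x) ay ax q p.
Proof.
move=> ha e /ha[d d0 H]; exists d => // x y xq yp; have := H _ _ yp xq.
by rewrite addrC [`|y - p| + _]addrC; congr (`|_| <= _); ring.
Qed.

Lemma rdiff_is_derive_r (a : R -> R -> R) ax ay p q : rdiff a ax ay p q -> is_derive q 1 (a p) ay.
Proof. by move=> /rdiff_swap/rdiff_is_derive_l. Qed.

Lemma second_derivative_max (f df : R -> R) p l d : 0 < d ->
  (forall x, `|x - p| < d -> is_derive x 1 f (df x)) -> is_derive p 1 df l ->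
  (forall x, `|x - p| < d -> f x <= f p) -> l <= 0.
Proof.
move=> d0 fD dfD fmax.
have inI x : x \in `](p - d), (p + d)[%R -> `|x - p| < d.
  by rewrite in_itv /= ltr_norml => /andP[? ?]; apply/andP; split; lra.
have pI : p \in `](p - d), (p + d)[%R by rewrite in_itv /=; apply/andP; split; lra.
have df0 : df p = 0.
  have ab : p - d <= p + d by lra.
  have h1 := fD p; rewrite subrr normr0 in h1.
  have h2 : is_derive p 1 f 0.
    apply: (@derive1_at_max _ f (p - d) (p + d) p ab _ pI) => t tI.
      by have [] := fD t (inI _ tI).
    exact: fmax (inI _ tI).
  by have [_ <-] := h1 d0; have [_ <-] := h2.
rewrite leNgt; apply/negP => l0.
have lim : t^-1 *: ((df \o shift p) (t *: (1 : R)) - df p) @[t --> 0^'] --> l.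
  by have [? <-] := dfD.
have l2 : 0 < l / 2 by rewrite divr_gt0.
move/cvgrPdist_lt : lim => /(_ _ l2)[d' /= d'0 H].
pose u := Num.min d d' / 2.
have u0 : 0 < u by rewrite divr_gt0 // lt_min d0.
have ud : u < d by rewrite /u; have := ge_min d d d'; rewrite lexx /= => ?; lra.
have ud' : u < d' by rewrite /u; have := ge_min d' d d'; rewrite lexx orbT /= => ?; lra.
have pu : p < p + u by rewrite ltrDl.
have fI t : p <= t <= p + u -> is_derive t 1 f (df t).
  by move=> /andP[? ?]; apply: fD; rewrite ger0_norm ?subr_ge0 //; lra.
have [||c] := @MVT _ f df p (p + u) pu.
- by move=> t; rewrite in_itv /= => /andP[/ltW ? /ltW ?]; apply: fI; apply/andP.
- by apply: derivable_within_continuous => t; rewrite in_itv /= => tI; have [] := fI t tI.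
rewrite in_itv /= => /andP[c1 c2] cE.
have fu := fmax (p + u); rewrite addrAC subrr add0r gtr0_norm // in fu.
have := fu ud; rewrite -subr_le0 cE addrAC subrr add0r pmulr_lle0 // => dfc.
have /H : `|0 - (c - p)| < d' by rewrite sub0r normrN gtr0_norm ?subr_gt0 //; lra.
rewrite subr_eq0 gt_eqF // => /(_ isT); rewrite /= /GRing.scale /= mulr1 subrK df0 subr0 => h4.
have h5 : 0 < (c - p)^-1 * df c by have := ler_norm (l - (c - p)^-1 * df c); lra.
by move: h5; rewrite pmulr_rgt0 ?invr_gt0 ?subr_gt0 //; lra.
Qed.

Lemma is_derive_Zsqr (e x : R) : is_derive x 1 (fun t => e * t ^+ 2) (2 * e * x).
Proof.
have h : is_derive x 1 (e \*: (@id R ^+ 2)) (e *: ((2%:R * id x ^+ 2.-1) *: 1)).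
  by apply: is_deriveZ.
by apply: is_derive_eq h _; rewrite /GRing.scale /= expr1; ring.
Qed.

Lemma is_derive_Zid (e x : R) : is_derive x 1 (fun t => e * t) e.
Proof.
have h : is_derive x 1 (e \*: @id R) (e *: 1) by apply: is_deriveZ.
by apply: is_derive_eq h _; rewrite /GRing.scale /= mulr1.
Qed.

(** Adding [e * x ^+ 2] to a harmonic function makes its Laplacian equal to [2 * e > 0], which is
    incompatible with the second derivative test at an interior maximum. *)
Lemma harmonic_max (G a b a1 a2 b1 b2 : R -> R -> R) r s M : 0 < s -> s < r ->
  (forall p q, `|p| < r -> `|q| < r ->
    [/\ rdiff G (a p q) (b p q) p q, rdiff a (a1 p q) (a2 p q) p q,
        rdiff b (b1 p q) (b2 p q) p q & a1 p q + b2 p q = 0]) ->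
  (forall p q, `|p| <= s -> `|q| <= s -> (`|p| == s) || (`|q| == s) -> G p q <= M) ->
  forall p q, `|p| <= s -> `|q| <= s -> G p q <= M.
Proof.
move=> s0 sr HG Hb p0 q0 p0s q0s; rewrite leNgt; apply/negP => MG.
(* On the square the perturbation is at most [e * s ^+ 2], half of the assumed excess over [M], so
   the maximum of [phi] still cannot lie on the boundary. *)
pose e := (G p0 q0 - M) / (2 * s ^+ 2).
have s20 : 0 < s ^+ 2 by rewrite exprn_gt0.
have e0 : 0 < e by rewrite divr_gt0 ?subr_gt0 ?mulr_gt0.
have es : e * s ^+ 2 < G p0 q0 - M.
  have -> : e * s ^+ 2 = (G p0 q0 - M) / 2 by rewrite /e; field; rewrite gt_eqF.
  by lra.
pose phi (z : R * R) := G z.1 z.2 + e * z.1 ^+ 2.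
pose K : set (R * R) := `[- s, s] `*` `[- s, s].
have inK p q : K (p, q) <-> `|p| <= s /\ `|q| <= s.
  by rewrite /K /= !in_itv /= -!ler_norml; split=> -[].
have K0 : K !=set0 by exists (p0, q0); apply/inK.
have cK : compact K by apply: compact_setX; exact: segment_compact.
have phic : {within K, continuous phi}.
  apply: continuous_in_subspaceT => -[p q]; rewrite inE => /inK[ps qs].
  have [hG _ _ _] := HG p q (le_lt_trans ps sr) (le_lt_trans qs sr).
  apply: (@cvgD _ _ _ _ _ (fun z : R * R => G z.1 z.2) (fun z : R * R => e * z.1 ^+ 2)).
    apply/cvgrPdist_lt => d d0; have [c c0 H] := rdiff_cvg hG d0.
    exists (ball p c, ball q c); first by split; apply: nbhsx_ballx.
    move=> [x y] [/= xp yq]; rewrite distrC.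
    by apply: H; rewrite distrC.
  apply: cvgM; first exact: cvg_cst.
  by apply: cvgM; exact: cvg_fst.
have [[p q]] := compact_EVT_max K0 cK phic.
rewrite inE => /inK[ps qs] pmax.
have phimax x y : `|x| <= s -> `|y| <= s -> G x y + e * x ^+ 2 <= G p q + e * p ^+ 2.
  by move=> xs ys; apply: (pmax (x, y)); rewrite inE; apply/inK.
have p2s : p ^+ 2 <= s ^+ 2 by rewrite -[p ^+ 2]real_normK ?num_real // lerXn2r // nnegrE // ltW.
have p02 : 0 <= e * p0 ^+ 2 by rewrite mulr_ge0 ?sqr_ge0 // ltW.
have ep2 : e * p ^+ 2 <= e * s ^+ 2 by rewrite ler_pM2l.
have h0 := phimax _ _ p0s q0s.
have [/(Hb _ _ ps qs)|] := boolP ((`|p| == s) || (`|q| == s)); first by lra.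
rewrite negb_or => /andP[pns qns].
have ps' : `|p| < s by rewrite lt_neqAle pns.
have qs' : `|q| < s by rewrite lt_neqAle qns.
pose d := Num.min (s - `|p|) (s - `|q|).
have d0 : 0 < d by rewrite lt_min !subr_gt0 ps'.
have nearx x : `|x - p| < d -> `|x| < s.
  by rewrite lt_min => /andP[h _]; have := ler_normD (x - p) p; rewrite subrK; lra.
have neary y : `|y - q| < d -> `|y| < s.
  by rewrite lt_min => /andP[_ h]; have := ler_normD (y - q) q; rewrite subrK; lra.
have [hG ha hb hab] := HG p q (lt_trans ps' sr) (lt_trans qs' sr).
have A : a1 p q + 2 * e <= 0.
  apply: (@second_derivative_max (fun x => G x q + e * x ^+ 2)
    (fun x => a x q + (2 * e) * x) p _ d d0).
  - move=> x xp; have [hGx _ _ _] := HG x q (lt_trans (nearx _ xp) sr) (lt_trans qs' sr).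
    apply: is_deriveD; first exact: rdiff_is_derive_l hGx.
    exact: is_derive_Zsqr.
  - apply: is_deriveD; first exact: rdiff_is_derive_l ha.
    exact: is_derive_Zid.
  - by move=> x xp; apply: phimax => //; exact: ltW (nearx _ xp).
have B : b2 p q <= 0.
  apply: (@second_derivative_max (G p) (b p) q _ d d0).
  - move=> y yq; have [hGy _ _ _] := HG p y (lt_trans ps' sr) (lt_trans (neary _ yq) sr).
    exact: rdiff_is_derive_r hGy.
  - exact: rdiff_is_derive_r hb.
  - by move=> y yq; have := phimax p y ps (ltW (neary _ yq)); rewrite lerD2r.
by lra.
Qed.

Lemma max_modulus (H H1 H2 : C -> C) r s M : 0 < s -> s < r -> 0 <= M ->
  (forall p q, `|p| < r -> `|q| < r ->
    cdiff H (p +i* q) (H1 (p +i* q)) /\ cdiff H1 (p +i* q) (H2 (p +i* q))) ->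
  (forall p q, `|p| <= s -> `|q| <= s -> (`|p| == s) || (`|q| == s) -> normc (H (p +i* q)) <= M) ->
  forall p q, `|p| <= s -> `|q| <= s -> normc (H (p +i* q)) <= M.
Proof.
move=> s0 sr M0 HD Hb p0 q0 ps qs; rewrite leNgt; apply/negP => MH.
pose w := H (p0 +i* q0).
(* The unit number that rotates [w] to the positive real axis; the maximum principle is applied to
   the real part of [c * H]. *)
pose c := w^*%C / (normc w)%:C.
have w0 : 0 < normc w by exact: le_lt_trans MH.
have cw : c * w = (normc w)%:C.
  rewrite /c mulrAC [_ * w]mulrC -sqr_normc norm_normc expr2 -mulrA divff ?mulr1 //.
  by rewrite eq_complex /= eqxx andbT gt_eqF.
have c1 : normc c = 1.
  apply: complexI; rewrite -norm_normc /c normrM normrV ?unitfE; last first.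
    by rewrite eq_complex /= eqxx andbT gt_eqF.
  rewrite normcJ !norm_normc /= expr0n /= addr0 sqrtr_sqr gtr0_norm // divff //.
  by rewrite eq_complex /= eqxx andbT gt_eqF.
have cD f z df : cdiff f z df -> cdiff (fun z => c * f z) z (c * df).
  move=> h e /h[d d0 Hd]; exists d => // v vz; have := Hd _ vz.
  have -> : c * f v - c * f z - c * df * (v - z) = c * (f v - f z - df * (v - z)) by ring.
  by rewrite normc_mul c1 mul1r.
have rdN (a : R -> R -> R) ax ay p q : rdiff a ax ay p q -> rdiff (fun x y => - a x y) (- ax) (- ay) p q.
  move=> ha e /ha[d d0 Hd]; exists d => // x y xp yq; apply: le_trans (Hd _ _ xp yq).
  by rewrite -normrN le_eqVlt; apply/orP; left; apply/eqP; congr (`|_|); ring.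
suff: complex.Re (c * w) <= M by rewrite cw /= leNgt MH.
apply: (@harmonic_max (fun p q => complex.Re (c * H (p +i* q)))
  (fun p q => complex.Re (c * H1 (p +i* q))) (fun p q => - complex.Im (c * H1 (p +i* q)))
  (fun p q => complex.Re (c * H2 (p +i* q))) (fun p q => - complex.Im (c * H2 (p +i* q)))
  (fun p q => - complex.Im (c * H2 (p +i* q))) (fun p q => - complex.Re (c * H2 (p +i* q)))
  r s M s0 sr _ _ p0 q0 ps qs) => p q.
- move=> pr qr; have [/cD h1 /cD h2] := HD p q pr qr.
  split; [exact: cdiff_Re h1|exact: cdiff_Re h2| |by rewrite subrr].
  by apply: rdN; exact: cdiff_Im h2.
- move=> p1 q1 pq; apply: (le_trans (ler_norm _)); apply: (le_trans (normc_Re _)).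
  by rewrite normc_mul c1 mul1r; exact: Hb.
Qed.
End MaxPrinciple.

(** * The identity theorem on a disc *)

Section UniqueContinuation.
Variable R : realType.
Notation C := R[i].
Local Notation normc := (@ComplexField.Normc.normc R).
Local Open Scope complex_scope.
Implicit Types (x y p q r s u v d : R) (f g h : C -> C) (z w c : C).

Lemma normc_0 : normc 0 = 0. Proof. by rewrite /= !expr0n /= addr0 sqrtr0. Qed.

Lemma normc_real x : normc x%:C = `|x|. Proof. by rewrite /= expr0n /= addr0 sqrtr_sqr. Qed.

Lemma cdiffB f g z c w : cdiff f z c -> cdiff g z w -> cdiff (fun z => f z - g z) z (c - w).
Proof. by move=> /cdiff_is_derive hf /cdiff_is_derive hg; apply/cdiff_is_derive; exact: is_deriveB. Qed.

Lemma cdiff_div f z c : z != 0 -> cdiff f z c -> cdiff (fun w => f w / w) z (c / z - f z / z / z).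
Proof.
move=> z0 /(proj1 (cdiff_is_derive f z c)) hf.
apply: (proj2 (cdiff_is_derive (fun w => f w / w) z _)).
have hi : is_derive z 1 (fun w : C => w^-1) (- z^-2).
  apply: DeriveDef; first exact: derivableV.
  by rewrite (@deriveV _ _ id) // derive_id /GRing.scale /= mulr1.
apply: is_derive_eq (is_deriveM hf hi) _; rewrite /GRing.scale /=.
by field.
Qed.

Lemma cdiff_near0 f z r : 0 < r -> (forall w, normc (w - z) < r -> f w = 0) -> cdiff f z 0.
Proof.
move=> r0 f0 e e0; exists r => // w wz.
by rewrite !f0 // ?subrr ?normc_0 // mul0r !subr0 normc_0 mulr_ge0 ?normc_ge0 // ltW.
Qed.

Lemma cdiff_unique f z c w : cdiff f z c -> cdiff f z w -> c = w.
Proof. by move=> /cdiff_is_derive[_ <-] /cdiff_is_derive[_ <-]. Qed.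

(** [H1] and [H2] are the first two derivatives of [H] on a square, and all three vanish near 0. Two
    derivatives are what [max_modulus] consumes; the class is stable under division by the
    variable. *)
Definition twice_cdiff r d (H H1 H2 : C -> C) :=
  (forall p q, `|p| < r -> `|q| < r ->
    cdiff H (p +i* q) (H1 (p +i* q)) /\ cdiff H1 (p +i* q) (H2 (p +i* q))) /\
  (forall z, normc z < d -> [/\ H z = 0, H1 z = 0 & H2 z = 0]).

(** Away from 0 this is the quotient rule. Around 0 every function involved is identically zero, the
    value of the quotient at 0 itself being 0 by convention. *)
Lemma twice_cdiff_div r d H H1 H2 : 0 < d -> twice_cdiff r d H H1 H2 ->
  exists H1' H2', twice_cdiff r d (fun z => H z / z) H1' H2'.
Proof.
move=> d0 [HD H0].
pose H1' z := H1 z / z - H z / z / z.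
exists H1', (fun z => H2 z / z - H1 z / z / z - ((H1 z / z - H z / z / z) / z - H z / z / z / z)).
split=> [p q pr qr|z /H0[e0 e1 e2]]; last by rewrite /H1' e0 e1 e2 !(mul0r, subrr).
have [hH hH1] := HD p q pr qr; move: (p +i* q) hH hH1 => z hH hH1.
have [->|z0] := eqVneq z 0.
  have [e0 e1 e2] : [/\ H 0 = 0, H1 0 = 0 & H2 0 = 0] by apply: H0; rewrite normc_0.
  rewrite /H1' e0 e1 e2 !(mul0r, subrr).
  split; apply: (cdiff_near0 d0) => w; rewrite subr0 => /H0[f0 f1 _];
    by rewrite f0 ?f1 !(mul0r, subrr).
split; first exact: cdiff_div.
by apply: cdiffB; [exact: cdiff_div|apply: (@cdiff_div (fun w => H w / w)) => //; exact: cdiff_div].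
Qed.

Lemma twice_cdiff_pow r d H H1 H2 k : 0 < d -> twice_cdiff r d H H1 H2 ->
  exists H' H1' H2', twice_cdiff r d H' H1' H2' /\ forall z, H' z = H z / z ^+ k.
Proof.
move=> d0 HH; elim: k => [|k [H' [H1' [H2' [HH' E]]]]].
  by exists H, H1, H2; split=> // z; rewrite expr0 divr1.
have [H1'' [H2'' HH'']] := twice_cdiff_div d0 HH'.
by do 3 eexists; split; [exact: HH''|move=> z /=; rewrite E exprSr invfM mulrA].
Qed.

Lemma normc_le_square p q r : `|p| <= r -> `|q| <= r -> normc (p +i* q) <= Num.sqrt 2 * r.
Proof.
move=> pr qr /=; have r0 : 0 <= r by exact: le_trans pr.
rewrite -{1}(ger0_norm r0) -sqrtr_sqr -sqrtrM //; apply: ler_wsqrtr.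
have sq t : `|t| <= r -> t ^+ 2 <= r ^+ 2 by move=> tr; rewrite -[t ^+ 2]real_normK ?num_real // lerXn2r.
by have := sq _ pr; have := sq _ qr; lra.
Qed.

Lemma ler_normc_ReIm x y p q : `|x| <= `|p| -> `|y| <= `|q| -> normc (x +i* y) <= normc (p +i* q).
Proof.
have sq t u : `|t| <= `|u| -> t ^+ 2 <= u ^+ 2.
  by move=> tu; rewrite -(real_normK (num_real t)) -(real_normK (num_real u)) lerXn2r // nnegrE.
by move=> /sq xp /sq yq /=; apply: ler_wsqrtr; rewrite lerD.
Qed.

Lemma bounded_on_square (H H1 : C -> C) s r : 0 < s -> s < r ->
  (forall p q, `|p| < r -> `|q| < r -> cdiff H (p +i* q) (H1 (p +i* q))) ->
  exists2 M, 0 <= M & forall p q, `|p| <= s -> `|q| <= s -> normc (H (p +i* q)) <= M.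
Proof.
move=> s0 sr HD.
pose K : set (R * R) := `[- s, s] `*` `[- s, s].
have inK p q : K (p, q) <-> `|p| <= s /\ `|q| <= s.
  by rewrite /K /= !in_itv /= -!ler_norml; split=> -[].
have K0 : K !=set0 by exists (0, 0); apply/inK; rewrite normr0 ltW.
have cK : compact K by apply: compact_setX; exact: segment_compact.
have [|[p q] _ pmax] := @compact_EVT_max _ _ (fun z : R * R => normc (H (z.1 +i* z.2))) K K0 cK.
  apply: continuous_in_subspaceT => -[p q]; rewrite inE => /inK[ps qs].
  have hH := HD p q (le_lt_trans ps sr) (le_lt_trans qs sr).
  apply/cvgrPdist_lt => d d0; have d2 : 0 < d / 2 by rewrite divr_gt0.
  have [c1 c10 h1] := rdiff_cvg (cdiff_Re hH) d2.
  have [c2 c20 h2] := rdiff_cvg (cdiff_Im hH) d2.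
  exists (ball p (Num.min c1 c2), ball q (Num.min c1 c2)).
    by split; apply: nbhsx_ballx; rewrite lt_min c10.
  move=> [x y] [/= xp yq].
  have {}xp : `|x - p| < Num.min c1 c2 by rewrite distrC.
  have {}yq : `|y - q| < Num.min c1 c2 by rewrite distrC.
  move: xp yq; rewrite !lt_min => /andP[xp1 xp2] /andP[yq1 yq2].
  have {}h1 := h1 _ _ xp1 yq1; have {}h2 := h2 _ _ xp2 yq2.
  have tri : `|normc (H (p +i* q)) - normc (H (x +i* y))| <= normc (H (x +i* y) - H (p +i* q)).
    have := ler_normcD (H (x +i* y) - H (p +i* q)) (H (p +i* q)); rewrite subrK => t1.
    have := ler_normcD (H (p +i* q) - H (x +i* y)) (H (x +i* y)); rewrite subrK normcB => t2.
    by rewrite ler_norml; apply/andP; split; lra.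
  apply: (le_lt_trans tri); apply: (le_lt_trans (normc_ReIm _)).
  by move: h1 h2; case: (H (x +i* y)) => ? ?; case: (H (p +i* q)) => ? ? /=; lra.
exists (normc (H (p +i* q))); first exact: normc_ge0.
by move=> x y xs ys; apply: (pmax (x, y)); rewrite inE; apply/inK.
Qed.

(** A Schwarz estimate of every order: on the boundary of the square of half-side 2 one has
    [2 <= normc z], so the maximum principle for [H z / z ^+ k] gives
    [normc (H z) <= M * (normc z / 2) ^+ k], which tends to 0. *)
Lemma twice_cdiff_zero d H H1 H2 r : 0 < d -> 2 < r -> twice_cdiff r d H H1 H2 ->
  forall z, normc z < 2 -> H z = 0.
Proof.
move=> d0 r2 HH z z2.
have [M M0 HM] : exists2 M, 0 <= M & forall p q, `|p| <= 2 -> `|q| <= 2 -> normc (H (p +i* q)) <= M.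
  by apply: (@bounded_on_square H H1 2 r) => // p q pr qr; have [] := HH.1 p q pr qr.
have bound k : normc (H z) <= M * (normc z / 2) ^+ k.
  have [H' [H1' [H2' [[HD' _] E]]]] := twice_cdiff_pow k d0 HH.
  have k0 : 0 < (2 : R) ^+ k by rewrite exprn_gt0.
  have Mk : 0 <= M / 2 ^+ k by rewrite divr_ge0 // ltW.
  have norm_pow (w : C) : normc (w ^+ k) = normc w ^+ k.
    by elim: k {HD' E k0 Mk} => [|k IH]; rewrite ?expr0 ?normc_real ?normr1 // !exprS normc_mul IH.
  have := @max_modulus R H' H1' H2' r 2 _ _ r2 Mk HD'.
  have [z00|z00] := eqVneq z 0.
    have [-> _ _] : [/\ H z = 0, H1 z = 0 & H2 z = 0] by apply: HH.2; rewrite z00 normc_0.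
    by rewrite normc_0 mulr_ge0 // exprn_ge0 // divr_ge0 // normc_ge0.
  have zk : normc z ^+ k != 0 by rewrite expf_neq0 // gt_eqF // normc_gt0.
  have HE w : normc (H w) = normc (H' w) * normc w ^+ k \/ w = 0.
    have [->|w0] := eqVneq w 0; [by right|left].
    by rewrite E -norm_pow -normc_mul divfK // expf_neq0.
  have [->|] := HE z; last by move/eqP; rewrite (negbTE z00).
  have -> : M * (normc z / 2) ^+ k = M / 2 ^+ k * normc z ^+ k by rewrite exprMn exprVn; ring.
  case: z z2 z00 zk => x y z2 z00 zk mm.
  rewrite ler_pM2r; last by rewrite lt_neqAle eq_sym zk exprn_ge0 // normc_ge0.
  apply: mm => //.
  - move=> p q p2 q2 pq.
    have n2 : 2 <= normc (p +i* q).
      by case/orP: pq => /eqP <-; [exact: (normc_Re (p +i* q))|exact: (normc_Im (p +i* q))].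
    have n0 : 0 < normc (p +i* q) ^+ k by rewrite exprn_gt0 //; lra.
    have [h|h] := HE (p +i* q); last by move: n2; rewrite h normc_0; lra.
    rewrite -(ler_pM2r n0) -h; apply: (le_trans (HM _ _ p2 q2)).
    by rewrite mulrAC ler_pdivlMr // ler_wpM2l // lerXn2r // nnegrE; lra.
  - by apply: (le_trans (normc_Re (x +i* y))); exact: ltW.
  - by apply: (le_trans (normc_Im (x +i* y))); exact: ltW.
apply/eqP; rewrite -[_ == _]negbK -normc_gt0; apply/negP => Hz.
have M1 : 0 < M by have := bound 0%N; rewrite expr0 mulr1; exact: lt_le_trans.
have z1 : `|normc z / 2| < 1 by rewrite ger0_norm ?divr_ge0 ?normc_ge0 // ltr_pdivrMr // mul1r.
have e0 : 0 < normc (H z) / M by rewrite divr_gt0.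
have /cvgrPdist_lt /(_ _ e0)[k _ /(_ k (leqnn k))] := cvg_expr z1.
rewrite sub0r normrN ger0_norm ?exprn_ge0 ?divr_ge0 ?normc_ge0 //.
by rewrite ltr_pdivlMr // mulrC ltNge bound.
Qed.

(** Only one derivative of [h] is known, so the argument is run on a primitive of [h], which has
    two. The primitive is constant near 0, hence on the disc of radius 2, and [h] is its
    derivative. *)
Lemma disc_zero h d : 0 < d -> (forall z, normc z < 3 -> exists c, cdiff h z c) ->
  (forall z, normc z < d -> h z = 0) -> forall z, normc z < 2 -> h z = 0.
Proof.
move=> d0 hD h0.
have [dh dhE] : {dh : C -> C & forall z, normc z < 3 -> cdiff h z (dh z)}.
  apply: (@choice _ _ (fun z c => normc z < 3 -> cdiff h z c)) => z.
  by have [z3|_] := boolP (normc z < 3); [have [c] := hD z z3; exists c|exists 0].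
(* A square of half-side [r > 2] inside the disc of radius 3: [Num.sqrt 2 * r < 3]. *)
pose r : R := 21 / 10.
have r3 p q : `|p| <= r -> `|q| <= r -> normc (p +i* q) < 3.
  move=> pr qr; apply: (le_lt_trans (normc_le_square pr qr)).
  have s2 : Num.sqrt 2 < 71 / 50 :> R.
    rewrite -ltr_sqr ?nnegrE ?sqrtr_ge0 ?divr_ge0 // sqr_sqrtr //; lra.
  by rewrite /r; lra.
have [|F0 FD] := @cdiff_primitive R h dh r _ (fun p q pr qr => dhE _ (r3 p q pr qr)).
  by rewrite /r; lra.
have dh0 z : normc z < d -> normc z < 3 -> dh z = 0.
  move=> zd z3; apply: cdiff_unique (dhE _ z3) _.
  apply: (@cdiff_near0 _ _ (d - normc z)); first by rewrite subr_gt0.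
  by move=> w wz; apply: h0; have := ler_normcD (w - z) z; rewrite subrK; lra.
pose d' := Num.min d 2.
have d'0 : 0 < d' by rewrite lt_min d0 /=.
have F00 z : normc z < d' -> F0 z = F0 0.
  case: z => p q zd'.
  have d'2 : d' <= 2 by rewrite ge_min lexx orbT.
  have FD0 x y : `|x| <= `|p| -> `|y| <= `|q| -> cdiff F0 (x +i* y) 0.
    move=> xp yq; have xy := le_lt_trans (ler_normc_ReIm xp yq) zd'.
    have -> : 0 = h (x +i* y) by rewrite h0 //; move: xy; rewrite lt_min => /andP[].
    have xR := le_lt_trans (normc_Re (x +i* y)) xy; have yR := le_lt_trans (normc_Im (x +i* y)) xy.
    by apply: FD; rewrite /r /=; [move: xR => /=; lra|move: yR => /=; lra].
  have [|t1 _ E1] := @mean_value_abs R (fun t => complex.Re (F0 (t +i* 0))) (fun=> 0) 0 p.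
    by move=> t; rewrite !subr0 => tp; have := rdiff_is_derive_l (cdiff_Re (FD0 t 0 tp _)); apply; rewrite normr0.
  have [|t2 _ E2] := @mean_value_abs R (fun t => complex.Im (F0 (t +i* 0))) (fun=> 0) 0 p.
    by move=> t; rewrite !subr0 => tp; have := rdiff_is_derive_l (cdiff_Im (FD0 t 0 tp _)); apply; rewrite normr0.
  have [|t3 _ E3] := @mean_value_abs R (fun t => complex.Re (F0 (p +i* t))) (fun=> 0) 0 q.
    by move=> t; rewrite !subr0 => tp; have := rdiff_is_derive_r (cdiff_Re (FD0 p t _ tp)); rewrite /= oppr0; apply.
  have [|t4 _ E4] := @mean_value_abs R (fun t => complex.Im (F0 (p +i* t))) (fun=> 0) 0 q.
    by move=> t; rewrite !subr0 => tp; have := rdiff_is_derive_r (cdiff_Im (FD0 p t _ tp)); apply.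
  move: E1 E2 E3 E4; rewrite !mul0r; have -> : F0 0 = F0 (Complex 0 0) by [].
  move: (F0 (p +i* 0)) (F0 (p +i* q)) (F0 (0 +i* 0)) => [? ?] [? ?] [? ?] /=.
  by do 4 move/subr0_eq->.
have HH : twice_cdiff r d' (fun z => F0 z - F0 0) h dh.
  split=> [p q pr qr|z zd'].
    split; last by apply: dhE; apply: r3; exact: ltW.
    rewrite -[h _]subr0; apply: cdiffB; first exact: FD.
    by apply/cdiff_is_derive; exact: is_derive_cst.
  have := zd'; rewrite lt_min => /andP[zd z2].
  by rewrite F00 // subrr h0 // dh0 //; lra.
have F2 z : normc z < 2 -> F0 z - F0 0 = 0.
  by apply: (twice_cdiff_zero d'0 _ HH); rewrite /r; lra.
move=> z z2.
have h1 : cdiff (fun z => F0 z - F0 0) z 0.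
  apply: (@cdiff_near0 _ _ (2 - normc z)); first by rewrite subr_gt0.
  by move=> w wz; apply: F2; have := ler_normcD (w - z) z; rewrite subrK; lra.
apply: cdiff_unique _ h1; case: z z2 => p q z2; apply: (HH.1 _ _ _ _).1.
  by have := le_lt_trans (normc_Re (p +i* q)) z2; rewrite /r /=; lra.
by have := le_lt_trans (normc_Im (p +i* q)) z2; rewrite /r /=; lra.
Qed.

End UniqueContinuation.

(** * Unique continuation *)

Section Continuation.
Variable R : realType.
Notation C := R[i].
Local Notation normc := (@ComplexField.Normc.normc R).
Local Open Scope complex_scope.
Implicit Types (r s d e : R) (h : C -> C) (x y z w c : C).

(** Norms over [C] take values in [C]; this is the same number as an element of [R], where order and
    arithmetic tactics apply. *)
Definition nrm (V : normedModType C) (v : V) : R := complex.Re `|v|.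

Lemma norm_nrm (V : normedModType C) (v : V) : `|v| = (nrm v)%:C.
Proof. by rewrite /nrm RRe_real // ger0_real. Qed.

Lemma nrm_normc x : nrm x = normc x. Proof. by rewrite /nrm norm_normc. Qed.

Lemma nrm_ge0 (V : normedModType C) (v : V) : 0 <= nrm v.
Proof. by rewrite -lecR -norm_nrm; exact: normr_ge0. Qed.

Lemma nrmD (V : normedModType C) (u v : V) : nrm (u + v) <= nrm u + nrm v.
Proof. by rewrite -lecR rmorphD /= -!norm_nrm ler_normD. Qed.

Lemma nrmN (V : normedModType C) (v : V) : nrm (- v) = nrm v.
Proof. by apply: complexI; rewrite -!norm_nrm normrN. Qed.

Lemma nrmB (V : normedModType C) (u v : V) : nrm (u - v) <= nrm u + nrm v.
Proof. by rewrite -[nrm v]nrmN nrmD. Qed.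

Lemma nrmZ (V : normedModType C) x (v : V) : nrm (x *: v) = normc x * nrm v.
Proof. by apply: complexI; rewrite rmorphM /= -!norm_nrm normrZ norm_normc. Qed.

Lemma nrm0 (V : normedModType C) : nrm (0 : V) = 0.
Proof. by rewrite /nrm normr0. Qed.

Lemma nrm_eq0 (V : normedModType C) (v : V) : (nrm v == 0) = (v == 0).
Proof. by rewrite -(inj_eq (@complexI R)) -norm_nrm normr_eq0. Qed.

Lemma nearP (V : normedModType C) (v : V) (P : V -> Prop) :
  (\forall a \near v, P a) <-> exists2 d, 0 < d & forall a, nrm (a - v) < d -> P a.
Proof.
split=> [/nbhs_ballP[d /= /posC_Re[d0 dE] H]|[d d0 H]].
  exists (complex.Re d) => // w wv; apply: H; rewrite -ball_normE /=.
  by rewrite distrC norm_nrm dE ltcR.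
apply/nbhs_ballP; exists d%:C; first by rewrite /= ltcR.
by move=> a; rewrite -ball_normE /= distrC norm_nrm ltcR => /H.
Qed.

Lemma cdiff_differentiable h z c : cdiff h z c -> differentiable h z.
Proof. by move=> /cdiff_is_derive[? _]; apply/derivable1_diffP. Qed.

Lemma differentiable_cdiff h z : differentiable h z -> exists c, cdiff h z c.
Proof.
move/derivable1_diffP => hd; exists ('D_1 h z).
by apply/cdiff_is_derive; exact: derivableP.
Qed.

Lemma disc_unique h : (forall x, normc x < 3 -> differentiable h x) ->
  (\forall x \near (0 : C), h x = 0) -> h 1 = 0.
Proof.
move=> hd /nearP[d d0 h0].
apply: (@disc_zero R h d d0).
- by move=> z z3; apply: differentiable_cdiff; exact: hd.
- by move=> z zd; apply: h0; rewrite subr0 nrm_normc.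
- by rewrite (normc_real 1) normr1; lra.
Qed.

Lemma differentiable_line (V W : normedModType C) (g : V -> W) (a b : V) x :
  differentiable g (a + x *: b) -> differentiable (fun x => g (a + x *: b)) x.
Proof.
by move=> gd; apply: (@differentiable_comp _ _ _ _ (fun x : C => a + x *: b) g).
Qed.

(** Cayley's parametrization [(1 +i* t) / (1 -i* t)] of the unit circle; its distance to 1 is at
    most [2 * t], with [t = d / 3]. *)
Lemma unit_near1 d : 0 < d -> exists2 u : C, normc u = 1 & 0 < normc (u - 1) < d.
Proof.
move=> d0; pose t := d / 3.
have t0 : 0 < t by rewrite divr_gt0.
pose D : C := 1 -i* t; have D0 : D != 0.
  by rewrite eq_complex /= oner_eq0.
have nD : 1 <= normc D by have := normc_Re D; rewrite /= normr1.
have nDV : normc D * normc D^-1 = 1 by rewrite -normc_mul divff // (normc_real 1) normr1.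
have nDV1 : 0 < normc D^-1 <= 1.
  have h : 0 < normc D^-1 by rewrite normc_gt0 invr_eq0.
  by rewrite h /= -[leRHS]nDV ler_peMl // ltW.
exists ((1 +i* t) / D).
  have nE : normc (1 +i* t) = normc D by rewrite /= sqrrN.
  by rewrite normc_mul nE.
have -> : (1 +i* t) / D - 1 = (0 +i* (2 * t)) / D.
  rewrite -[X in _ - X](divff D0) -mulrBl; congr (_ / _).
  by apply/eqP; rewrite eq_complex /= subrr eqxx /=; apply/eqP; ring.
have nt : normc (0 +i* (2 * t)) = 2 * t.
  by rewrite /= expr0n /= add0r sqrtr_sqr gtr0_norm //; lra.
case/andP: nDV1 => n0 n1.
rewrite normc_mul nt /t; move: (normc _) n0 n1 => a n0 n1; apply/andP; split.
  by rewrite !mulr_gt0.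
by apply: (@le_lt_trans _ _ (2 * (d / 3) * 1)); [rewrite ler_pM2l // mulr_gt0|lra].
Qed.

(* Vanishing on an arc of a circle forces the derivative to vanish there, so
   that extending [h] by zero across the arc preserves differentiability. *)
Lemma circle_unique h x0 y r : normc x0 < r -> r < normc y ->
  (forall x, normc (x - x0) < 3 * normc (y - x0) -> differentiable h x) ->
  (forall x, normc (x - x0) < 3 * normc (y - x0) -> normc x = r -> h x = 0) -> h y = 0.
Proof.
move=> x0r ry hd h0.
have r0 : 0 < r by exact: le_lt_trans (normc_ge0 _) x0r.
pose k x := if normc x <= r then 0 else h x.
have tri z w : `|normc z - normc w| <= normc (z - w).
  have := ler_normcD (z - w) w; rewrite subrK => t1.
  have := ler_normcD (w - z) z; rewrite subrK normcB => t2.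
  by rewrite ler_norml; apply/andP; split; lra.
have kd x : normc (x - x0) < 3 * normc (y - x0) -> exists c, cdiff k x c.
  move=> xd; have [c hc] := differentiable_cdiff (hd _ xd).
  have [xr|rx|xr] := ltgtP (normc x) r.
  - exists 0; apply: (@cdiff_near0 _ _ _ (r - normc x)); first by rewrite subr_gt0.
    move=> w wx; rewrite /k ifT //; have := tri w x; have := ler_norm (normc w - normc x); lra.
  - exists c => e e0; have [d d0 H] := hc _ e0.
    exists (Num.min d (normc x - r)); first by rewrite lt_min d0 subr_gt0.
    move=> w; rewrite lt_min => /andP[wd wr].
    have nle z : r < normc z -> k z = h z by move=> rz; rewrite /k leNgt rz.
    rewrite !nle //; first exact: H.
    by have := tri w x; rewrite ler_norml; lra.
  have hx := h0 _ xd xr.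
  have c0 : c = 0.
    apply/eqP; rewrite -[_ == _]negbK -normc_gt0; apply/negP => c0.
    have e0 : 0 < normc c / 2 by rewrite divr_gt0.
    have [d d0 H] := hc _ e0.
    pose d' := Num.min d (3 * normc (y - x0) - normc (x - x0)).
    have d'0 : 0 < d' by rewrite lt_min d0 subr_gt0.
    have d'r : 0 < d' / r by rewrite divr_gt0.
    have [u u1 /andP[u0 ud]] := unit_near1 d'r.
    have nux : normc (x * u - x) = r * normc (u - 1).
      by rewrite -{2}(mulr1 x) -mulrBr normc_mul xr.
    rewrite ltr_pdivlMr // mulrC -nux lt_min in ud; case/andP: ud => ud1 ud2.
    have hxu : h (x * u) = 0.
      apply: h0; last by rewrite normc_mul u1 mulr1.
      by have := ler_normcD (x * u - x) (x - x0); rewrite addrA subrK; lra.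
    have := H _ ud1; rewrite hx hxu subrr sub0r -(nrm_normc (- _)) nrmN nrm_normc normc_mul.
    have : 0 < normc (x * u - x) by rewrite nux mulr_gt0.
    by nra.
  exists 0 => e e0; rewrite c0 in hc; have [d d0 H] := hc _ e0; exists d => // w /H.
  rewrite hx /k xr lexx !mul0r !subr0; case: ifP => // _ _.
  by rewrite normc_0 mulr_ge0 ?normc_ge0 // ltW.
have -> : h y = k y by rewrite /k leNgt ry.
have -> : y = x0 + 1 *: (y - x0) by rewrite scale1r addrC subrK.
apply: (@disc_unique (fun t => k (x0 + t *: (y - x0)))).
  move=> t t3; apply: (@differentiable_line C C k).
  have [|c hc] := @kd (x0 + t *: (y - x0)); last exact: cdiff_differentiable hc.
  rewrite addrC addKr normc_mul ltr_pM2r // normc_gt0 subr_eq0.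
  by apply: contraTneq ry => ->; rewrite -leNgt ltW.
apply/nearP; have s0 : 0 < (r - normc x0) / (normc (y - x0) + 1).
  by rewrite divr_gt0 ?subr_gt0 // ltr_wpDl // normc_ge0.
exists ((r - normc x0) / (normc (y - x0) + 1)) => // t.
rewrite subr0 nrm_normc ltr_pdivlMr; last by rewrite ltr_wpDl // normc_ge0.
move=> td.
rewrite /k ifT //; apply: (le_trans (ler_normcD _ _)); rewrite normc_mul.
by have := normc_ge0 t; nra.
Qed.

End Continuation.

(** * Hermitian forms and orthogonality *)

Section Forms.
Variable R : realType.
Notation C := R[i].

Definition dotc {k} (u v : 'rV[C]_k) : C := \sum_i u 0 i * (v 0 i)^*.

Definition adjmx {p q} (A : 'M[C]_(p, q)) : 'M[C]_(q, p) := map_mx Num.conj A^T.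

(** Collinearity of [u] and [v] is the vanishing of all of these. Unlike a proportionality factor
    they are polynomial in the entries, so they can be continued holomorphically. *)
Definition minor2 {k} (u v : 'rV[C]_k) i j : C := u 0 i * v 0 j - u 0 j * v 0 i.

Section Dot.
Variable k : nat.
Implicit Types (u v w : 'rV[C]_k) (a : C).

Lemma dotc_mx u v : dotc u v = (u *m adjmx v) 0 0.
Proof. by rewrite mxE; apply: eq_bigr => i _; rewrite !mxE. Qed.

Lemma dotcDl u v w : dotc (u + v) w = dotc u w + dotc v w.
Proof. by rewrite !dotc_mx mulmxDl mxE. Qed.

Lemma dotcZl a u w : dotc (a *: u) w = a * dotc u w.
Proof. by rewrite !dotc_mx -scalemxAl mxE. Qed.

Lemma dotcC u v : (dotc u v)^* = dotc v u.
Proof. by rewrite rmorph_sum; apply: eq_bigr => i _; rewrite rmorphM /= conjCK mulrC. Qed.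

Lemma dotcBl u v w : dotc (u - v) w = dotc u w - dotc v w.
Proof. by rewrite dotcDl -scaleN1r dotcZl mulN1r. Qed.

Lemma dotcZr a u w : dotc w (a *: u) = a^* * dotc w u.
Proof. by rewrite -[LHS]conjCK dotcC dotcZl rmorphM /= dotcC. Qed.

Lemma dotcDr u v w : dotc w (u + v) = dotc w u + dotc w v.
Proof. by rewrite -[LHS]conjCK dotcC dotcDl rmorphD /= !dotcC. Qed.

Lemma dotc0l w : dotc 0 w = 0. Proof. by rewrite -(scale0r w) dotcZl mul0r. Qed.

Lemma dotc_ge0 u : 0 <= dotc u u.
Proof. by apply: sumr_ge0 => i _; exact: mul_conjC_ge0. Qed.

Lemma dotc_eq0 u : (dotc u u == 0) = (u == 0).
Proof.
apply/eqP/eqP => [/eqP|->]; last exact: dotc0l.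
rewrite psumr_eq0 => [/allP u0|i _]; last exact: mul_conjC_ge0.
apply/rowP => i; rewrite mxE; apply/eqP; rewrite -mul_conjC_eq0.
by apply: (u0 i); rewrite mem_index_enum.
Qed.

Lemma minor2_rank1 p (D : 'M[C]_(p, k)) u v i j : (\rank D <= 1)%N ->
  (u <= D)%MS -> (v <= D)%MS -> minor2 u v i j = 0.
Proof.
move=> rD uD vD.
have : (u <= row_base D)%MS by rewrite eq_row_base.
have : (v <= row_base D)%MS by rewrite eq_row_base.
move: (row_base D); move: (\rank D) rD => [|[|//]] _ B /submxP[a ->] /submxP[b ->].
  by rewrite /minor2 !mxE !big_ord0 !mul0r subrr.
rewrite /minor2 !mxE !big_ord1; ring.
Qed.

Lemma minor2_free u v i j : minor2 u v i j != 0 -> row_free (col_mx u v).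
Proof.
move=> m0; rewrite -kermx_eq0; apply/eqP/row_matrixP => l; rewrite row0.
have : row l (kermx (col_mx u v)) *m col_mx u v = 0 by rewrite -row_mul mulmx_ker row0.
move: (row l _) => w; rewrite -[w]hsubmxK mul_row_col.
move: (lsubmx w) (rsubmx w) => a b e.
have := congr1 (fun x : 'rV_k => x 0 i) e; have := congr1 (fun x : 'rV_k => x 0 j) e.
rewrite !mxE !big_ord1 => ej ei.
have a0 : a 0 0 = 0.
  have : a 0 0 * minor2 u v i j = (a 0 0 * u 0 i + b 0 0 * v 0 i) * v 0 j -
     (a 0 0 * u 0 j + b 0 0 * v 0 j) * v 0 i by rewrite /minor2; ring.
  by rewrite ei ej !mul0r subrr => /eqP; rewrite mulf_eq0 (negbTE m0) orbF => /eqP.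
have b0 : b 0 0 = 0.
  have : b 0 0 * minor2 u v i j = (a 0 0 * u 0 j + b 0 0 * v 0 j) * u 0 i -
     (a 0 0 * u 0 i + b 0 0 * v 0 i) * u 0 j by rewrite /minor2; ring.
  by rewrite ei ej !mul0r subrr => /eqP; rewrite mulf_eq0 (negbTE m0) orbF => /eqP.
have -> : a = 0 by apply/rowP => o; rewrite ord1 a0 mxE.
have -> : b = 0 by apply/rowP => o; rewrite ord1 b0 mxE.
by rewrite row_mx0.
Qed.

Lemma adjmxM p q r (A : 'M[C]_(p, q)) (B : 'M[C]_(q, r)) : adjmx (A *m B) = adjmx B *m adjmx A.
Proof. by rewrite /adjmx trmx_mul map_mxM. Qed.

Lemma adjmxK p q (A : 'M[C]_(p, q)) : adjmx (adjmx A) = A.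
Proof. by apply/matrixP => i j; rewrite !mxE conjCK. Qed.

Lemma free_gram p (P : 'M[C]_(p, k)) : row_free P -> row_free (P *m adjmx P).
Proof.
move=> fP; rewrite -kermx_eq0; apply/eqP/row_matrixP => l; rewrite row0.
set w := row l _.
have w0 : w *m (P *m adjmx P) = 0 by rewrite /w -row_mul mulmx_ker row0.
have : dotc (w *m P) (w *m P) == 0.
  by rewrite dotc_mx adjmxM mulmxA -[w *m P *m _]mulmxA w0 mul0mx mxE.
rewrite dotc_eq0 => /eqP wP; apply: (row_free_inj fP); by rewrite wP mul0mx.
Qed.

(** Since [u] and [v] lie in [D] and their Gram matrix is invertible, pairing with them maps [D]
    onto a plane; the kernel has codimension two in [D]. *)
Lemma rank_orthogonal2 p (D : 'M[C]_(p, k)) u v i j : minor2 u v i j != 0 ->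
  (u <= D)%MS -> (v <= D)%MS ->
  (\rank (D :&: kermx (row_mx (adjmx u) (adjmx v))) + 2 <= \rank D)%N.
Proof.
move=> /minor2_free f uD vD.
set M := row_mx _ _.
have ME : M = adjmx (col_mx u v) by rewrite /M /adjmx tr_col_mx map_row_mx.
rewrite -(mxrank_mul_ker D M) addnC leq_add2r.
have : (col_mx u v <= D)%MS by rewrite col_mx_sub uD vD.
move=> /(submxMr M)/mxrankS; apply: leq_trans.
by rewrite ME; move/free_gram: f; rewrite /row_free => /eqP ->.
Qed.

Lemma rank_orthogonal1 p (X : 'M[C]_(p, k)) u :
  (\rank X <= (\rank (X :&: kermx (adjmx u))).+1)%N.
Proof.
rewrite -(mxrank_mul_ker X (adjmx u)) -[leqRHS]add1n leq_add2r.
exact: rank_leq_col.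
Qed.

Lemma sub_orthogonal1 p (X : 'M[C]_(p, k)) u v :
  (v <= X :&: kermx (adjmx u))%MS = (v <= X)%MS && (dotc v u == 0).
Proof.
rewrite sub_capmx; congr (_ && _); rewrite dotc_mx; apply/sub_kermxP/eqP => [->|e]; first by rewrite mxE.
by apply/matrixP => a b; rewrite !ord1 e mxE.
Qed.

Lemma sub_orthogonal2 p (D : 'M[C]_(p, k)) u v w : (w <= D)%MS ->
  dotc w u = 0 -> dotc w v = 0 -> (w <= D :&: kermx (row_mx (adjmx u) (adjmx v)))%MS.
Proof.
move=> wD wu wv; rewrite sub_capmx wD; apply/sub_kermxP.
rewrite mul_mx_row; apply/rowP => i; rewrite !mxE; case: (fintype.split i) => o; rewrite !ord1.
  by rewrite -dotc_mx.
by rewrite -dotc_mx.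
Qed.

End Dot.
End Forms.

(** * Degeneracy of orthogonality-preserving maps between definite spaces *)

Section OrthogonalDegeneracy.
Variable R : realType.
Notation C := R[i].
Local Notation normc := (@ComplexField.Normc.normc R).

Lemma differentiable_entry (V : normedModType C) k (g : V -> 'rV[C]_k) x i :
  differentiable g x -> differentiable (fun x => g x 0 i : C) x.
Proof.
move=> gd; apply: (@differentiable_comp _ _ _ _ g (fun N : 'rV[C]_k => N 0 i : C)) => //.
exact: differentiable_coord.
Qed.

Lemma differentiable_mulmxr (p q : nat) (M : 'M[C]_(p, q)) (z : 'rV[C]_p) :
  differentiable (mulmx^~ M : 'rV[C]_p -> 'rV[C]_q) z.
Proof.
have -> : (mulmx^~ M : 'rV[C]_p -> 'rV[C]_q) = \sum_(j < p) (fun x : 'rV[C]_p => x 0 j *: row j M).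
  by apply/funext => u; rewrite fct_sumE mulmx_sum_row.
apply: differentiable_sum => j; apply: differentiableZl.
by apply: (@differentiable_entry _ p id).
Qed.

Lemma differentiable_minor2 (V : normedModType C) k (g f : V -> 'rV[C]_k) x i j :
  differentiable g x -> differentiable f x -> differentiable (fun x => minor2 (g x) (f x) i j) x.
Proof.
by move=> gd fd; apply: differentiableB; apply: differentiableM; exact: differentiable_entry.
Qed.

Section ComplexLimits.
Context (T : Type) (F : set_system T) {FF : Filter F}.
Implicit Types (f g : T -> C) (a b c : C).

Lemma cvgC_cst c : (c : C) @[x --> F] --> (c : C). Proof. exact: cvg_cst. Qed.

Lemma cvgCD f g a b : f x @[x --> F] --> a -> g x @[x --> F] --> b -> (f x + g x) @[x --> F] --> a + b.
Proof. by move=> fa gb; exact: (cvgD fa gb). Qed.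

Lemma cvgCM f g a b : f x @[x --> F] --> a -> g x @[x --> F] --> b -> (f x * g x) @[x --> F] --> a * b.
Proof. by move=> fa gb; exact: (cvgM fa gb). Qed.

Lemma cvgC_mulr f a c : f x @[x --> F] --> a -> (f x * c) @[x --> F] --> a * c.
Proof. by move=> fa; apply: (cvgCM (g := fun=> c) fa); exact: cvg_cst. Qed.

Lemma cvgCV f a : a != 0 -> f x @[x --> F] --> a -> (f x)^-1 @[x --> F] --> a^-1.
Proof. by move=> a0 fa; exact: (cvgV a0 fa). Qed.

End ComplexLimits.

Lemma conjc_cvg0 : (t^* : C) @[t --> (0 : C)] --> (0 : C).
Proof.
apply/(@cvgrPdist_lt _ _ _ (nbhs (0 : C)) (nbhs_filter _)) => e e0; apply/nearP; have [e1 ->] := posC_Re e0.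
exists (complex.Re e) => // t.
by rewrite sub0r normrN norm_conjC subr0 norm_nrm ltcR.
Qed.

Lemma rank_drop a b c d : (a + 2 <= b -> b + 1 <= 2 * c -> c <= d.+1 -> a + 1 <= 2 * d)%N.
Proof. lia. Qed.

(* If [G v0] and [G (y v0)] are independent, then so are the images of two
   orthogonal vectors near [v1] and [v0], for a small [v1] orthogonal to [v0].
   Passing to the orthogonal complement of the second drops the source
   dimension by one and the target dimension by two. *)
Lemma orthogonal_degenerate s k (G : 'rV[C]_s -> 'rV[C]_k) (rho : R) (y : C) :
  0 < rho -> (forall e, nrm e < rho -> differentiable G e) -> normc y <= 1 ->
  forall d (X : 'M[C]_s) (D : 'M[C]_k), (\rank D <= d)%N ->
  (forall e, (e <= X)%MS -> nrm e < rho -> (G e <= D)%MS) ->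
  (forall e e', (e <= X)%MS -> (e' <= X)%MS -> nrm e < rho -> nrm e' < rho ->
     dotc e e' = 0 -> dotc (G e) (G e') = 0) ->
  (\rank D + 1 <= 2 * (\rank X))%N ->
  forall e i j, (e <= X)%MS -> nrm e < rho / 4 -> minor2 (G e) (G (y *: e)) i j = 0.
Proof.
move=> rho0 Gd y1; have yle (e : 'rV[C]_s) r : nrm e < r -> nrm (y *: e) < r.
  by apply: le_lt_trans; rewrite nrmZ ler_piMl // nrm_ge0.
elim=> [|d IH] X D rD GD Gorth rDX v0 i j v0X v0r.
  apply: (minor2_rank1 i j (leq_trans rD _) (GD _ v0X _) (GD _ (scalemx_sub _ v0X) _)) => //; last apply: yle; lra.
have v0r' : nrm v0 < rho by lra.
have [r1|r2] := leqP (\rank D) 1.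
  by apply: (minor2_rank1 i j r1 (GD _ v0X _) (GD _ (scalemx_sub _ v0X) _)) => //; exact: yle.
apply/eqP/negP => /negP m0.
(* The size [rho / 32] keeps [v' t] inside the ball for [normc t < 3], since
   [1 / 32 + 3 * (1 / 4 + 1 / 32) < 1]. *)
have [v1 [v10 v1X v1v0 v1r]] : exists v1 : 'rV[C]_s,
    [/\ v1 != 0, (v1 <= X)%MS, dotc v0 v1 = 0 & nrm v1 <= rho / 32].
  have : (X :&: kermx (adjmx v0))%MS != 0.
    rewrite -mxrank_eq0 -lt0n -ltnS; apply: leq_trans (rank_orthogonal1 X v0).
    by move: r2 rDX; clear; move: (\rank D) (\rank X) => a b; lia.
  case/rowV0Pn => w; rewrite sub_orthogonal1 => /andP[wX /eqP wv0] w0.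
  have nw : 0 < nrm w by rewrite lt_neqAle nrm_ge0 andbT eq_sym nrm_eq0.
  pose c := rho / 32 / nrm w; have c0 : 0 < c by rewrite !divr_gt0.
  exists (real_complex R c *: w); split.
  - by rewrite scaler_eq0 negb_or w0 andbT eq_complex /= eqxx andbT gt_eqF.
  - exact: scalemx_sub.
  - by rewrite dotcZr -dotcC wv0 conjC0 mulr0.
  - by rewrite nrmZ normc_real gtr0_norm // /c divfK // gt_eqF.
(* The complex line with [v' 0 = v1] and [v' 1 = v0]. *)
pose u := v0 - v1; pose v' (t : C) := v1 + t *: u.
have v'X t : (v' t <= X)%MS by rewrite addmx_sub ?scalemx_sub ?addmx_sub ?eqmx_opp.
have v'r t : nrm (v' t) <= nrm v1 + normc t * (nrm v0 + nrm v1).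
  by apply: (le_trans (nrmD _ _)); rewrite lerD2l nrmZ ler_wpM2l ?normc_ge0 ?nrmB.
pose h t := minor2 (G (v' t)) (G (y *: v' t)) i j.
have hd t : normc t < 3 -> differentiable h t.
  move=> t3; have vr : nrm (v' t) < rho.
    apply: (le_lt_trans (v'r t)); have := nrm_ge0 v0; have := nrm_ge0 v1; have := normc_ge0 t; nra.
  apply: differentiable_minor2; first by apply: differentiable_line; exact: Gd.
  have vE a : y *: v' a = y *: v1 + a *: (y *: u) by rewrite /v' scalerDr !scalerA mulrC.
  have -> : (fun t => G (y *: v' t)) = (fun a => G (y *: v1 + a *: (y *: u))).
    by apply/funext => a; rewrite vE.
  by apply: differentiable_line; apply: Gd; rewrite -vE; exact: yle.
have h1 : h 1 != 0 by rewrite /h /v' scale1r addrC subrK.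
(* [v'' t] is the component of [v0] orthogonal to [v' t]. It depends on [t] through conjugates and
   is not holomorphic; only its convergence to [v0] as [t] tends to 0 is used, which holds because
   [v1] is orthogonal to [v0]. *)
pose c (t : C) := dotc v0 (v' t) / dotc (v' t) (v' t).
pose v'' (t : C) : 'rV[C]_s := v0 - c t *: v' t.
have v'cvg : v' t @[t --> (0 : C)] --> v1.
  have -> : v1 = v' 0 by rewrite /v' scale0r addr0.
  apply: (@differentiable_continuous C C 'rV[C]_s).
  by apply: (@differentiable_line _ _ _ id).
have ccvg : c t @[t --> (0 : C)] --> (0 : C).
  have v11 : dotc v1 v1 != 0 by rewrite dotc_eq0.
  have -> : c = fun t => (t^* * dotc v0 u) /
     (dotc v1 v1 + t * dotc u v1 + t^* * dotc v1 u + t * t^* * dotc u u).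
    apply/funext => t; rewrite /c /v'; congr (_ / _).
      by rewrite dotcDr dotcZr v1v0 add0r.
    move: (u) => b; rewrite dotcDl !dotcDr dotcZl !dotcZr dotcZl.
    by rewrite -!addrA; congr (_ + _); rewrite addrCA; congr (_ + (_ + _)); rewrite mulrA [t^* * t]mulrC.
  pose den t := dotc v1 v1 + t * dotc u v1 + t^* * dotc v1 u + t * t^* * dotc u u.
  have cI : t @[t --> (0 : C)] --> (0 : C) by exact: cvg_id.
  have cc := conjc_cvg0.
  have denc : den t @[t --> (0 : C)] --> dotc v1 v1.
    have -> : dotc v1 v1 = dotc v1 v1 + 0 * dotc u v1 + 0 * dotc v1 u + 0 * 0 * dotc u u.
      by rewrite !mul0r !addr0.
    apply: (cvgCD _ (cvgC_mulr (cvgCM cI cc))); apply: (cvgCD _ (cvgC_mulr cc)).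
    by apply: (cvgCD _ (cvgC_mulr cI)); exact: cvgC_cst.
  rewrite -[X in _ --> X](mul0r (dotc v1 v1)^-1) -[X in X * _](mul0r (dotc v0 u)).
  exact: (cvgCM (cvgC_mulr cc) (cvgCV v11 denc)).
have v''cvg : v'' t @[t --> (0 : C)] --> v0.
  rewrite -[X in _ --> X]subr0 -(scale0r v1).
  apply: (cvgB (f := fun=> v0) _ (cvgZ ccvg v'cvg)); exact: cvg_cst.
have nearlt (v : 'rV[C]_s) r : nrm v < r -> \forall w \near v, nrm w < r.
  move=> vr; apply/nearP; exists (r - nrm v); rewrite ?subr_gt0 // => w wv.
  by have := nrmD (w - v) v; rewrite subrK; lra.
have Q1 : \forall t \near (0 : C), nrm (v' t) < rho / 4 by apply: (v'cvg [set w | nrm w < rho / 4]); apply: nearlt; lra.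
have Q2 : \forall t \near (0 : C), nrm (v'' t) < rho / 4 by apply: (v''cvg [set w | nrm w < rho / 4]); exact: nearlt.
have Q3 : \forall t \near (0 : C), minor2 (G (v'' t)) (G (y *: v'' t)) i j != 0.
  apply: (v''cvg [set w | minor2 (G w) (G (y *: w)) i j != 0]).
  have mc : {for v0, continuous (fun v => minor2 (G v) (G (y *: v)) i j : C)}.
    apply: differentiable_continuous; apply: differentiable_minor2; first exact: Gd.
    apply: (@differentiable_comp _ _ _ _ (fun v => y *: v) G) => //.
    by apply: Gd; exact: yle.
  exact: (cvgr_neq0 _ mc m0).
(* If [h] vanished for all small [t] it would vanish at 1, where it is the nonzero minor at [v0]. *)
have [t [ht t1 t2 t3]] : exists t, [/\ h t != 0, nrm (v' t) < rho / 4, nrm (v'' t) < rho / 4 &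
    minor2 (G (v'' t)) (G (y *: v'' t)) i j != 0].
  apply/not_existsP => H; move/eqP: h1; apply; apply: disc_unique => //.
  near=> t; apply/eqP/negP => /negP ht; apply: (H t); split; first exact: ht; by near: t.
have lt4 (e : 'rV[C]_s) : nrm e < rho / 4 -> nrm e < rho by move=> ?; lra.
have v''X : (v'' t <= X)%MS.
  by rewrite addmx_sub // eqmx_opp scalemx_sub.
have v'v'' : dotc (v' t) (v'' t) = 0.
  have [v0'|v0'] := eqVneq (v' t) 0; first by rewrite v0' dotc0l.
  by rewrite -dotcC /v'' dotcBl dotcZl /c divfK ?dotc_eq0 // subrr conjC0.
have orth0 : dotc (G (v' t)) (G (v'' t)) = 0 by apply: Gorth => //; lra.
move/eqP: ht; apply; apply: (IH (X :&: kermx (adjmx (v'' t)))%MS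
  (D :&: kermx (row_mx (adjmx (G (v'' t))) (adjmx (G (y *: v'' t)))))%MS) => //.
- have := rank_orthogonal2 t3 (GD _ v''X (lt4 _ t2)) (GD _ (scalemx_sub _ v''X) (yle _ _ (lt4 _ t2))).
  by move=> /leq_trans/(_ rD); rewrite addn2 ltnS; exact: ltnW.
- move=> e; rewrite sub_orthogonal1 => /andP[eX /eqP ev] er; apply: sub_orthogonal2.
  + exact: GD.
  + by apply: Gorth => //; exact: lt4.
  + by apply: Gorth => //; [exact: scalemx_sub|apply: yle; exact: lt4|rewrite dotcZr ev mulr0].
- move=> e e'; rewrite !sub_orthogonal1 => /andP[eX _] /andP[e'X _]; exact: Gorth.
- apply: (rank_drop _ rDX (rank_orthogonal1 X (v'' t))).
  exact: rank_orthogonal2 t3 (GD _ v''X (lt4 _ t2)) (GD _ (scalemx_sub _ v''X) (yle _ _ (lt4 _ t2))).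
- by rewrite sub_orthogonal1 v'X v'v'' eqxx.
Unshelve. all: by end_near. Qed.
End OrthogonalDegeneracy.

Section HermitianForm.
Variable R : realType.
Notation C := R[i].
Local Notation normc := (@ComplexField.Normc.normc R).

Section General.
Variables (r s n : nat).
Implicit Types (u v w : 'rV[C]_n) (a : C).

Lemma hformDl u v w : hform r s (u + v) w = hform r s u w + hform r s v w.
Proof. by rewrite -big_split; apply: eq_bigr => i _; rewrite mxE mulrDr mulrDl. Qed.

Lemma hformZl a u w : hform r s (a *: u) w = a * hform r s u w.
Proof. by rewrite big_distrr; apply: eq_bigr => i _; rewrite mxE /= mulrCA !mulrA. Qed.

Lemma hformC u v : (hform r s u v)^* = hform r s v u.
Proof.
rewrite rmorph_sum; apply: eq_bigr => i _; rewrite !rmorphM /= conjCK mulrAC.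
by congr (_ * _ * _); rewrite /hsign; do 2?case: ifP => _; rewrite ?rmorphN ?rmorph1 ?rmorph0.
Qed.

Lemma hformDr u v w : hform r s w (u + v) = hform r s w u + hform r s w v.
Proof. by rewrite -[LHS]hformC hformDl rmorphD /= !hformC. Qed.

Lemma hformZr a u w : hform r s w (a *: u) = a^* * hform r s w u.
Proof. by rewrite -[LHS]hformC hformZl rmorphM /= !hformC. Qed.

Lemma hformBl u v w : hform r s (u - v) w = hform r s u w - hform r s v w.
Proof. by rewrite hformDl -scaleN1r hformZl mulN1r. Qed.

Lemma hformBr u v w : hform r s w (u - v) = hform r s w u - hform r s w v.
Proof. by rewrite -[LHS]hformC hformBl rmorphB /= !hformC. Qed.

Lemma hform0l w : hform r s 0 w = 0.
Proof. by rewrite -(scale0r w) hformZl mul0r. Qed.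

Lemma hform0r w : hform r s w 0 = 0.
Proof. by rewrite -hformC hform0l rmorph0. Qed.

Lemma hform_sym u v : hform r s u v = 0 -> hform r s v u = 0.
Proof. by move=> e; rewrite -hformC e rmorph0. Qed.

Lemma differentiable_hform (V : normedModType C) (g : V -> 'rV[C]_n) w x :
  differentiable g x -> differentiable (fun x => hform r s (g x) w : C) x.
Proof.
move=> gd; rewrite /hform.
have -> : (fun x => \sum_(j < n) hsign R r s j * g x 0 j * (w 0 j)^*) =
  \sum_(j < n) (fun x => hsign R r s j * g x 0 j * (w 0 j)^*).
  by apply/funext => y; rewrite fct_sumE.
apply: differentiable_sum => j; apply: differentiableM; last exact: differentiable_cst.
by apply: differentiableM; [exact: differentiable_cst|exact: differentiable_entry].
Qed.

End General.

Lemma hformE s (z w : 'rV[C]_(1 + s)) :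
  hform 1 s z w = z 0 0 * (w 0 0)^* - dotc (rsubmx z) (rsubmx w).
Proof.
rewrite /hform big_split_ord big_ord1 /hsign /= mul1r.
have -> : lshift s ord0 = 0 :> 'I_(1 + s) by apply/val_inj.
congr (_ + _); rewrite /dotc -sumrN; apply: eq_bigr => i _ /=.
by rewrite add1n ltnS ltn_ord mulN1r mulNr !mxE.
Qed.

Lemma hform_lsubmx s t (u v : 'rV[C]_(1 + s + t)) :
  hform 1 s u v = hform 1 s (lsubmx u) (lsubmx v).
Proof.
rewrite /hform big_split_ord /= [X in _ + X]big1 ?addr0 => [|i _].
  by apply: eq_bigr => i _; rewrite !mxE.
have e1 : (1 + s + i < 1)%N = false by lia.
have e2 : (1 + s + i < 1 + s)%N = false by lia.
by rewrite /hsign e1 e2 !mul0r.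
Qed.

(** The 3x3 minor in the columns [l], [i], [j]. Its vanishing for all columns says that the three
    vectors lie on a projective line. *)
Definition det3 {k} (a b c : 'rV[C]_k) l i j : C :=
  a 0 l * minor2 b c i j - a 0 i * minor2 b c l j + a 0 j * minor2 b c l i.

Lemma differentiable_det3 (V : normedModType C) k (a b c : V -> 'rV[C]_k) x l i j :
  differentiable a x -> differentiable b x -> differentiable c x ->
  differentiable (fun x => det3 (a x) (b x) (c x) l i j) x.
Proof.
move=> ad bd cd; apply: differentiableD; first apply: differentiableB;
by apply: differentiableM; [exact: differentiable_entry|exact: differentiable_minor2].
Qed.

Lemma det3Z k (a b c : 'rV[C]_k) x y z l i j :
  det3 (x *: a) (y *: b) (z *: c) l i j = x * y * z * det3 a b c l i j.
Proof. by rewrite /det3 /minor2 !mxE; ring. Qed.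

Lemma det3_swap k (a b c : 'rV[C]_k) l i j : det3 b a c l i j = - det3 a b c l i j.
Proof. by rewrite /det3 /minor2; ring. Qed.

Lemma det3_shift k (a b c : 'rV[C]_k) x y l i j :
  det3 a (b - x *: a) (c - y *: a) l i j = det3 a b c l i j.
Proof. by rewrite /det3 /minor2 !mxE; ring. Qed.

Lemma norm_entry k (v : 'rV[C]_k) i : normc (v 0 i) <= nrm v.
Proof.
rewrite -lecR -norm_nrm -norm_normc; change (`|v 0 i| <= mx_norm v).
rewrite mx_normE -[leLHS]nngE num_le.
exact: (le_bigmax _ _ (0, i)).
Qed.

Lemma nrm_le k (v : 'rV[C]_k) r : 0 <= r -> (forall i, normc (v 0 i) <= r) -> nrm v <= r.
Proof.
move=> r0 vr; have [v0|v0] := eqVneq (nrm v) 0; first by rewrite v0.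
have : mx_norm v != 0.
  by apply: contra v0 => /eqP/mx_norm_eq0 ->; rewrite nrm0.
case/mx_norm_neq0 => -[a i]; rewrite /= ord1 => vE.
rewrite -lecR -norm_nrm; change (mx_norm v <= real_complex R r).
by rewrite vE norm_normc lecR; exact: vr.
Qed.

Lemma nrm_row0 s (x : 'rV[C]_s) : nrm (row_mx (0 : 'rV[C]_1) x) <= nrm x.
Proof.
apply: nrm_le => [|i]; first exact: nrm_ge0.
rewrite mxE; case: (fintype.split i) => o; last exact: norm_entry.
by rewrite mxE normc_0 nrm_ge0.
Qed.

Lemma nrm_rsubmx s (z : 'rV[C]_(1 + s)) : nrm (rsubmx z) <= nrm z.
Proof.
apply: nrm_le => [|i]; first exact: nrm_ge0.
by rewrite mxE; exact: norm_entry.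
Qed.

End HermitianForm.

(** * Collinearity of images *)

Section NullCollinear.
Variable R : realType.
Notation C := R[i].
Local Notation normc := (@ComplexField.Normc.normc R).

Lemma differentiable_row0 s (x : 'rV[C]_s) :
  differentiable (fun x : 'rV[C]_s => row_mx (0 : 'rV[C]_1) x) x.
Proof.
have -> : (fun x : 'rV[C]_s => row_mx (0 : 'rV[C]_1) x) = mulmx^~ (row_mx 0 1%:M).
  by apply/funext => u; rewrite mul_mx_row mulmx0 mulmx1.
exact: differentiable_mulmxr.
Qed.

Lemma minor2_rsubmx k (u v : 'rV[C]_(1 + k)) : u 0 0 = 0 -> v 0 0 = 0 ->
  (forall i j, minor2 (rsubmx u) (rsubmx v) i j = 0) -> forall i j, minor2 u v i j = 0.
Proof.
move=> u0 v0 h i j.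
have l0 (o : 'I_1) : lshift k o = 0 by apply/val_inj; rewrite /= ord1.
have [a ->|a ->] := split_ordP i; first by rewrite /minor2 l0 u0 v0 mul0r mulr0 subrr.
have [b ->|b ->] := split_ordP j; first by rewrite /minor2 l0 u0 v0 mul0r mulr0 subrr.
by have := h a b; rewrite /minor2 !mxE.
Qed.

Lemma row_mx0_0 s (x : 'rV[C]_s) : row_mx (0 : 'rV[C]_1) x 0 0 = 0.
Proof.
have h : row_mx (0 : 'rV[C]_1) x 0 (lshift s ord0) = 0 by rewrite row_mxEl mxE.
by rewrite -[RHS]h; congr (row_mx _ _ _ _); apply/val_inj.
Qed.

Lemma hform_null_eq0 k (u : 'rV[C]_(1 + k)) : hform 1 k u u = 0 -> u 0 0 = 0 -> u = 0.
Proof.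
move=> uu u0; move: uu; rewrite hformE u0 mul0r sub0r => /eqP.
rewrite oppr_eq0 dotc_eq0 => /eqP ru.
apply/rowP => i; rewrite mxE; have [a ->|a ->] := split_ordP i.
  by rewrite -[RHS]u0; congr (u 0 _); apply/val_inj; rewrite /= ord1.
by have := congr1 (fun x : 'rV_k => x 0 a) ru; rewrite !mxE.
Qed.

Lemma row0_rsubmx s (z : 'rV[C]_(1 + s)) : z 0 0 = 0 -> z = row_mx 0 (rsubmx z).
Proof.
move=> z0; rewrite -[LHS]hsubmxK; congr row_mx; apply/rowP => o; rewrite !mxE ord1.
by rewrite -[RHS]z0; congr (z 0 _); apply/val_inj.
Qed.

Lemma rank_kermx_adj s (u : 'rV[C]_s) : u != 0 -> (\rank (kermx (adjmx u))).+1 = s.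
Proof.
move=> u0; rewrite mxrank_ker.
have r1 : \rank (adjmx u) = 1%N.
  apply/eqP; rewrite eqn_leq rank_leq_col lt0n mxrank_eq0; apply: contra u0 => /eqP e.
  by rewrite -[u]adjmxK e /adjmx trmx0 map_mx0.
by rewrite r1 -subSn ?subn1 // -r1 rank_leq_row.
Qed.

Variables (s k : nat) (g : 'rV[C]_(1 + s) -> 'rV[C]_(1 + k)) (w : 'rV[C]_(1 + s)) (r : R).
Hypothesis ks : (k + 2 <= 2 * s)%N.
Hypothesis r0 : 0 < r.
Hypothesis gd : forall z, nrm (z - w) < r -> differentiable g z.
Hypothesis gorth : forall z z', nrm (z - w) < r -> nrm (z' - w) < r ->
  hform 1 s z z' = 0 -> hform 1 k (g z) (g z') = 0.

(** The vectors orthogonal to a null [w], taken modulo [w], form a definite space, and likewise for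
    [g w]. Fixing the 0-coordinate picks representatives, and [orthogonal_degenerate] applies to the
    induced map; parallel representatives modulo [g w] make the three images dependent. *)
Lemma null_collinear (d : 'rV[C]_(1 + s)) (y : C) l i j : hform 1 s w w = 0 -> w 0 0 != 0 -> d 0 0 = w 0 0 ->
  hform 1 s d w = 0 -> nrm (d - w) < r / 4 -> normc y <= 1 ->
  det3 (g w) (g d) (g (w + y *: (d - w))) l i j = 0.
Proof.
move=> ww w0 dw0 dw dr y1.
have wr : nrm (w - w) < r by rewrite subrr nrm0.
have gw : hform 1 k (g w) (g w) = 0 by exact: gorth.
have [gw0|gw0] := eqVneq (g w 0 0) 0.
  by rewrite (hform_null_eq0 gw gw0) /det3 !mxE !mul0r subrr addr0.
(* The representative of [g z] modulo [g w] with zero 0-coordinate; on such vectors the form is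
   minus [dotc]. *)
pose P z := g z - (g z 0 0 / g w 0 0) *: g w.
pose p (x : 'rV[C]_s) : 'rV[C]_(1 + s) := w + row_mx 0 x.
pose G x := rsubmx (P (p x)).
have P0 z : P z 0 0 = 0 by rewrite !mxE divfK // subrr.
have pw (x : 'rV[C]_s) : nrm (p x - w) <= nrm x by rewrite /p addrAC subrr add0r nrm_row0.
have pr (x : 'rV[C]_s) t : nrm x < t -> nrm (p x - w) < t by apply: le_lt_trans.
have Pd z : nrm (z - w) < r -> differentiable P z.
  move=> zr; apply: differentiableB; first exact: gd.
  apply: differentiableZl; apply: differentiableM => //; apply: differentiable_entry; exact: gd.
have pd (x : 'rV[C]_s) : differentiable p x.
  apply: differentiableD => //.
  exact: differentiable_row0.
have Gd x : nrm x < r -> differentiable G x.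
  move=> xr; apply: (@differentiable_comp _ _ _ _ (P \o p) rsubmx).
    exact: (differentiable_comp (pd x) (Pd _ (pr _ _ xr))).
  exact: differentiable_rsubmx.
have Porth z z' : nrm (z - w) < r -> nrm (z' - w) < r -> hform 1 s z w = 0 -> hform 1 s z' w = 0 ->
    hform 1 s z z' = 0 -> dotc (rsubmx (P z)) (rsubmx (P z')) = 0.
  move=> zr z'r zw z'w zz'.
  have : hform 1 k (P z) (P z') = 0.
    rewrite hformBl !hformBr !hformZl !hformZr (gorth zr z'r zz') gw.
    by rewrite (gorth zr wr zw) (hform_sym (gorth z'r wr z'w)) !(mulr0, subr0).
  by rewrite hformE !P0 mul0r sub0r => /eqP; rewrite oppr_eq0 => /eqP.
have PD z : nrm (z - w) < r -> hform 1 s z w = 0 -> dotc (rsubmx (P z)) (rsubmx (g w)) = 0.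
  move=> zr zw.
  have : hform 1 k (P z) (g w) = 0 by rewrite hformBl hformZl gw (gorth zr wr zw) !(mulr0, subr0).
  by rewrite hformE P0 mul0r sub0r => /eqP; rewrite oppr_eq0 => /eqP.
have pE (x : 'rV[C]_s) (z : 'rV[C]_(1 + s)) : hform 1 s (p x) z = hform 1 s w z - dotc x (rsubmx z).
  rewrite hformDl [X in _ + X]hformE row_mxKr; congr (_ + _).
  rewrite [X in X * _](_ : _ = 0) ?mul0r ?sub0r //.
  exact: row_mx0_0.
have pX (x : 'rV[C]_s) : (x <= kermx (adjmx (rsubmx w)))%MS = (hform 1 s (p x) w == 0).
  by rewrite pE ww sub0r oppr_eq0 dotc_mx; apply/sub_kermxP/eqP => [->|e]; rewrite ?mxE //;
    apply/matrixP => a b; rewrite !ord1 e mxE.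
have pp (x x' : 'rV[C]_s) : hform 1 s (p x) w = 0 -> hform 1 s (p x') w = 0 ->
    hform 1 s (p x) (p x') = - dotc x x'.
  move=> xw /hform_sym x'w; rewrite pE x'w sub0r; congr (- _).
  have := xw; rewrite pE ww sub0r => /eqP; rewrite oppr_eq0 => /eqP xw0.
  have -> : rsubmx (p x') = rsubmx w + x' by rewrite /p linearD /= row_mxKr.
  by rewrite dotcDr xw0 add0r.
have rw : rsubmx w != 0.
  apply: contra w0 => /eqP rw; move: ww; rewrite hformE rw dotc0l subr0 => /eqP.
  by rewrite mulf_eq0 conjC_eq0 orbb.
have rgw : rsubmx (g w) != 0.
  apply: contra gw0 => /eqP rw'; move: gw; rewrite hformE rw' dotc0l subr0 => /eqP.
  by rewrite mulf_eq0 conjC_eq0 orbb.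
pose x := rsubmx (d - w).
have dE : d = p x.
  have h : (d - w) 0 0 = 0 by rewrite 2!mxE dw0 subrr.
  by rewrite /p /x -(row0_rsubmx h) addrC subrK.
have ydE : w + y *: (d - w) = p (y *: x).
  by rewrite {1}dE /p addrAC subrr add0r scale_row_mx scaler0.
have minor0 : forall i j, minor2 (G x) (G (y *: x)) i j = 0.
  move=> a b; apply: (@orthogonal_degenerate R s k G r y r0 Gd y1 _
     (kermx (adjmx (rsubmx w))) (kermx (adjmx (rsubmx (g w)))) (leqnn _)).
  - move=> e; rewrite pX => /eqP ew er; apply/sub_kermxP; apply/matrixP => o o'.
    by rewrite !ord1 -dotc_mx PD ?mxE //; exact: pr.
  - move=> e e'; rewrite !pX => /eqP ew /eqP e'w er e'r ee'.
    by apply: Porth => //; [exact: pr|exact: pr|rewrite pp // ee' oppr0].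
  (* The ranks are [s - 1] and [k - 1], so the required inequality is exactly [k + 2 <= 2 * s]. *)
  - by have := rank_kermx_adj rw; have := rank_kermx_adj rgw; move: (\rank _) (\rank _) ks => a' b'; lia.
  - by rewrite pX -dE dw.
  - by apply: le_lt_trans dr; exact: nrm_rsubmx.
rewrite ydE {1}dE -(det3_shift _ _ _ (g (p x) 0 0 / g w 0 0) (g (p (y *: x)) 0 0 / g w 0 0)).
rewrite /det3 -/(P (p x)) -/(P (p (y *: x))).
by rewrite !(minor2_rsubmx (P0 _) (P0 _) minor0) !mulr0 subrr addr0.
Qed.

End NullCollinear.

(** * Slices meeting the null cone in circles *)

Section NullSlices.
Variable R : realType.
Notation C := R[i].
Local Notation normc := (@ComplexField.Normc.normc R).
Local Notation real_complex := (real_complex R).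

Lemma segment_unique (V : normedModType C) (h : V -> C) (a b : V) :
  (forall x : C, normc x < 3 -> differentiable h (a + x *: (b - a))) ->
  (\forall z \near a, h z = 0) -> h b = 0.
Proof.
move=> hd /nearP[d d0 h0].
have -> : b = a + 1 *: (b - a) by rewrite scale1r addrC subrK.
apply: (@disc_unique R (fun x => h (a + x *: (b - a)))).
  by move=> x x3; apply: differentiable_line; exact: hd.
have e0 : 0 < d / (nrm (b - a) + 1) by rewrite divr_gt0 // ltr_wpDl // nrm_ge0.
apply/nearP; exists (d / (nrm (b - a) + 1)) => // x.
rewrite subr0 nrm_normc ltr_pdivlMr; last by rewrite ltr_wpDl // nrm_ge0.
move=> xd; apply: h0; rewrite addrAC subrr add0r nrmZ.
by have := normc_ge0 x; have := nrm_ge0 (b - a); nra.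
Qed.

(** Continuation along the complex line from [a] to [b] uses parameters of modulus up to 3, hence
    the eighth of the radius: [1 / 8 + 3 * (1 / 4) < 1]. *)
Lemma ball_unique (V : normedModType C) (h : V -> C) (n0 a b : V) (rho : R) :
  (forall z, nrm (z - n0) < rho -> differentiable h z) ->
  nrm (a - n0) < rho / 8 -> nrm (b - n0) < rho / 8 ->
  (\forall z \near a, h z = 0) -> h b = 0.
Proof.
move=> hd ar br; apply: segment_unique => x x3; apply: hd.
have -> : a + x *: (b - a) - n0 = (a - n0) + x *: ((b - n0) - (a - n0)).
  by rewrite opprB addrA subrK addrAC.
apply: (le_lt_trans (nrmD _ _)); rewrite nrmZ.
have := nrmB (b - n0) (a - n0); have := nrm_ge0 (b - n0 - (a - n0)); have := normc_ge0 x.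
by nra.
Qed.

Lemma normc_sum k (F : 'I_k -> C) (c : R) : (forall i, normc (F i) <= c) -> normc (\sum_i F i) <= k%:R * c.
Proof.
move=> Fc; rewrite -lecR -norm_normc; apply: (le_trans (ler_norm_sum _ _ _)).
rewrite (eq_bigr (fun i => real_complex (normc (F i)))) => [|i _]; last exact: norm_normc.
rewrite -rmorph_sum /= lecR; apply: (@le_trans _ _ (\sum_(i < k) c)); first exact: ler_sum.
by rewrite sumr_const card_ord mulr_natl.
Qed.

Lemma normc_hform r s n (z w : 'rV[C]_n) : normc (hform r s z w) <= n%:R * (nrm z * nrm w).
Proof.
apply: normc_sum => i; rewrite !normc_mul.
have h1 : normc (hsign R r s i) <= 1.
  by rewrite /hsign; case: ifP => _; [rewrite (normc_real 1) normr1|case: ifP => _];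
    rewrite ?normc_0 // -(nrm_normc (-1)) nrmN nrm_normc (normc_real 1) normr1.
have hc (c : C) : normc (c^*) = normc c by apply: complexI; rewrite -!norm_normc norm_conjC.
rewrite hc -mulrA; apply: (@le_trans _ _ (1 * (normc (z 0 i) * normc (w 0 i)))).
  by rewrite ler_wpM2r // mulr_ge0 ?normc_ge0.
by rewrite mul1r ler_pM ?normc_ge0 ?norm_entry.
Qed.

Lemma hform_real r s n (z : 'rV[C]_n) : hform r s z z = real_complex (complex.Re (hform r s z z)).
Proof.
have := hformC r s z z; case: (hform r s z z) => a b.
rewrite -[Num.conj _]/(conjc _) /= => /eqP; rewrite eq_complex /= eqxx /= => bb.
have -> : b = 0 by move/eqP: bb => bb; lra.
by [].
Qed.

Lemma hform_quad_lip r s n (n0 z : 'rV[C]_n) (d : R) : nrm (z - n0) <= d -> d <= 1 ->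
  `|complex.Re (hform r s z z - hform r s n0 n0)| <= d * (n%:R * (2 * nrm n0 + 1)).
Proof.
move=> zd d1; apply: (le_trans (normc_Re _)).
have -> : hform r s z z - hform r s n0 n0 = hform r s (z - n0) z + hform r s n0 (z - n0).
  by rewrite hformBl hformBr addrA subrK.
apply: (le_trans (ler_normcD _ _)).
apply: (le_trans (lerD (normc_hform _ _ _ _) (normc_hform _ _ _ _))).
have zn : nrm z <= nrm n0 + 1 by have := nrmD (z - n0) n0; rewrite subrK; lra.
rewrite -mulrDr mulrCA ler_wpM2l //.
by have := nrm_ge0 z; have := nrm_ge0 n0; have := nrm_ge0 (z - n0); nra.
Qed.

Lemma hform_quad_near r s n (n0 z : 'rV[C]_n) (d : R) : nrm (z - n0) <= d -> d <= 1 ->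
  hform r s n0 n0 = 0 ->
  `|complex.Re (hform r s z z)| <= d * (n%:R * (2 * nrm n0 + 1)).
Proof. by move=> zd d1 nn; have := hform_quad_lip r s zd d1; rewrite nn subr0. Qed.

Lemma mul_conj_normc (x : C) : x * x^* = real_complex (normc x ^+ 2).
Proof. by rewrite rmorphXn /= -norm_normc normCK. Qed.

(** On the line through [u] in an orthogonal direction [v] the form depends only on [normc x], so
    the null cone cuts this line in a circle about [u] when the signs of [u] and [v] are
    opposite. *)
Lemma hform_pythagoras r s n (u v : 'rV[C]_n) x : hform r s u v = 0 ->
  hform r s (u + x *: v) (u + x *: v) =
    hform r s u u + real_complex (normc x ^+ 2) * hform r s v v.
Proof.
move=> uv; rewrite hformDl !hformDr !hformZl !hformZr uv (hform_sym uv) !mulr0 addr0 add0r.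
by rewrite mulrA mul_conj_normc.
Qed.

Lemma nrm_triangle (V : normedModType C) (v u w : V) : nrm (u - w) <= nrm (u - v) + nrm (v - w).
Proof. by have := nrmD (u - v) (v - w); rewrite addrA subrK. Qed.

Lemma nrm_sym (V : normedModType C) (u v : V) : nrm (u - v) = nrm (v - u).
Proof. by rewrite -nrmN opprB. Qed.

Lemma slice_bound (x T P Al dl e : R) : 0 <= x -> x < 3 -> 0 <= T -> T <= 2 * dl + Al ->
  P < Al + dl -> 4 * Al + 8 * dl <= e -> P + x * T < e - dl.
Proof. by move=> *; nra. Qed.

Lemma three_bounds (B D E F G Al dl : R) : E <= D + B -> D <= F + G -> F < dl -> G < dl ->
  B <= Al -> E <= 2 * dl + Al.
Proof. by move=> *; lra. Qed.

Lemma small_bounds (dl rho : R) : 0 < dl -> 0 < rho ->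
  [/\ rho / 8 - dl < rho, rho / 8 - dl < rho / 2, rho / 8 - dl + dl < rho / 2 / 4 + rho & rho / 8 = rho / 2 / 4].
Proof. by move=> *; split; lra. Qed.

Section Base.
Variables (s : nat) (n0 : 'rV[C]_(1 + s)) (rho : R).
Hypothesis rho0 : 0 < rho.
Hypothesis nn0 : hform 1 s n0 n0 = 0.
Let nu : C := n0 0 0.
Hypothesis nu0 : nu != 0.
Let e0 : 'rV[C]_(1 + s) := row_mx 1 0.

Let N : R := normc nu ^+ 2.

Let N0 : 0 < N. Proof. by rewrite exprn_gt0 // normc_gt0. Qed.

Let e00 : e0 0 0 = 1.
Proof.
have h : e0 0 (lshift s ord0) = 1 by rewrite /e0 row_mxEl mxE eqxx.
by rewrite -[RHS]h; congr (e0 _ _); apply/val_inj.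
Qed.

Let hform_e0 z : hform 1 s e0 z = (z 0 0)^*.
Proof. by rewrite hformE /e0 row_mxKr dotc0l subr0 e00 mul1r. Qed.

Section Collinear.
Variables (k : nat) (g : 'rV[C]_(1 + s) -> 'rV[C]_(1 + k)).
Hypothesis ks : (k + 2 <= 2 * s)%N.
Hypothesis gd : forall z, nrm (z - n0) < rho -> differentiable g z.
Hypothesis gorth : forall z z', nrm (z - n0) < rho -> nrm (z' - n0) < rho ->
  hform 1 s z z' = 0 -> hform 1 k (g z) (g z') = 0.

(* The slice through [b] centred at [a], the point of [d]-perp with the
   coordinates of [d] scaled by [t], meets the null cone in a full circle. *)
Lemma negative_collinear : exists2 dl : R, 0 < dl & forall (b d : 'rV[C]_(1 + s)) (y : C) l i j,
  b 0 0 = nu -> d 0 0 = nu -> nrm (b - n0) < dl -> nrm (d - n0) < dl ->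
  hform 1 s b d = 0 -> complex.Re (hform 1 s b b) < 0 -> complex.Re (hform 1 s d d) < 0 ->
  normc y <= 1 -> det3 (g d) (g b) (g (b + y *: (d - b))) l i j = 0.
Proof.
pose K := nrm n0; pose M := (1 + s)%:R * (2 * K + 1) : R.
pose A := M / N * (normc nu * nrm e0 + (K + 1)).
have K0 : 0 <= K by exact: nrm_ge0.
have M0 : 0 <= M by rewrite mulr_ge0 // addr_ge0 // mulr_ge0.
have A0 : 0 <= A.
  by rewrite mulr_ge0 ?divr_ge0 ?(ltW N0) // addr_ge0 ?mulr_ge0 ?normc_ge0 ?nrm_ge0 // addr_ge0.
(* [A * dl] will bound the distance from [d] to the centre [a]. For [normc x < 3] the point [p x] is
   then within [(4 * A + 7) * dl] of [n0]; the last [dl] accounts for the distance from [n0] to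
   [d]. *)
pose dl := Num.min 1 (rho / 8 / (4 * A + 8)).
have A8 : 0 < 4 * A + 8 by lra.
have dl0 : 0 < dl by rewrite lt_min ltr01 /= !divr_gt0.
have dl1 : dl <= 1 by rewrite ge_min lexx.
have dlr : 4 * (A * dl) + 8 * dl <= rho / 8.
  have : dl <= rho / 8 / (4 * A + 8) by rewrite ge_min lexx orbT.
  by rewrite ler_pdivlMr //; lra.
exists dl => // b d y l i j b0 d0 bn dn bd bb dd y1.
pose gm := - complex.Re (hform 1 s d d); have gm0 : 0 < gm by rewrite oppr_gt0.
pose bt := - complex.Re (hform 1 s b b); have bt0 : 0 < bt by rewrite oppr_gt0.
have ddE : hform 1 s d d = - real_complex gm by rewrite hform_real /gm rmorphN opprK.
have bbE : hform 1 s b b = - real_complex bt by rewrite hform_real /bt rmorphN opprK.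
have gmN : 0 < gm + N by rewrite addr_gt0.
(* Solves [t * gm = (1 - t) * N], which is the orthogonality of [a] and [d]; the multiple of [e0]
   restores the 0-coordinate [nu]. *)
pose t := N / (gm + N).
have t1 : 1 - t = gm / (gm + N) by rewrite /t; field; rewrite gt_eqF.
have t10 : 0 < 1 - t by rewrite t1 divr_gt0.
have t1d : (1 - t) * (normc nu * nrm e0 + (K + 1)) <= A * dl.
  have gmd : gm <= dl * M.
    by have := hform_quad_near (ltW dn) dl1 nn0; rewrite ler_norml => /andP[]; rewrite /gm /M /K; lra.
  have : 1 - t <= M / N * dl.
    rewrite t1 ler_pdivrMr //; apply: (@le_trans _ _ (M / N * dl * N)).
      have -> : M / N * dl * N = dl * M by field; rewrite gt_eqF.
      exact: gmd.
    apply: ler_wpM2l; last by rewrite lerDr ltW.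
    by apply: mulr_ge0; [apply: divr_ge0 => //; exact: ltW|exact: ltW].
  move=> h; rewrite /A mulrAC ler_wpM2r //.
  by rewrite addr_ge0 ?mulr_ge0 ?normc_ge0 ?nrm_ge0 // addr_ge0.
pose a := real_complex t *: d + (real_complex (1 - t) * nu) *: e0.
have ad : nrm (a - d) <= A * dl.
  have -> : a - d = real_complex (1 - t) *: (nu *: e0 - d).
    by rewrite /a rmorphB /= rmorph1; apply/rowP => c; rewrite !mxE; ring.
  rewrite nrmZ normc_real gtr0_norm //; apply: le_trans t1d; rewrite ler_wpM2l ?(ltW t10) //.
  apply: (le_trans (nrmB _ _)); rewrite nrmZ lerD2l.
  by have := nrmD (d - n0) n0; rewrite subrK /K; lra.
have hnu (z : 'rV[C]_(1 + s)) : z 0 0 = nu -> nu * (z 0 0)^* = real_complex N.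
  by move=> ->; rewrite mul_conj_normc.
have aE z : hform 1 s a z = real_complex t * hform 1 s d z + real_complex (1 - t) * (nu * (z 0 0)^*).
  by rewrite /a hformDl !hformZl hform_e0 mulrA.
have tN : t * gm = (1 - t) * N by rewrite t1 /t; field; rewrite gt_eqF.
have ad0 : hform 1 s a d = 0.
  by rewrite aE ddE hnu // mulrN -!rmorphM /= tN addNr.
have db0 := hform_sym bd; have da0 := hform_sym ad0.
pose al := (1 - t) * N; have al0 : 0 < al by rewrite mulr_gt0.
have a0 : a 0 0 = nu.
  by rewrite /a mxE [X in X + _]mxE [X in _ + X]mxE d0 e00 mulr1 -mulrDl -rmorphD /= addrC subrK mul1r.
have aa : hform 1 s a a = real_complex al by rewrite aE da0 mulr0 add0r hnu // -rmorphM.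
have ab : hform 1 s a b = real_complex al by rewrite aE db0 mulr0 add0r hnu // -rmorphM.
have ba : hform 1 s b a = real_complex al by rewrite -hformC ab; exact: conjc_real.
clearbody a.
(* From [<a, b> = <a, a>] the direction [b - a] is orthogonal to [a], so the form at [p x] is
   [al - normc x ^+ 2 * (al + bt)]: positive at [a], negative at [b = p 1], null for [normc x = r].
   There [p x] is a null vector orthogonal to [d] and [null_collinear] applies. *)
pose p (x : C) := a + x *: (b - a).
have pp x : hform 1 s (p x) (p x) = real_complex (al - normc x ^+ 2 * (al + bt)).
  have v1 : hform 1 s a (b - a) = 0 by rewrite hformBr ab aa subrr.
  have v3 : hform 1 s (b - a) (b - a) = - real_complex (al + bt).
    by rewrite hformBl v1 subr0 hformBr bbE ba -rmorphN -rmorphB -rmorphN /= opprD addrC.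
  by rewrite /p hform_pythagoras // v3 aa mulrN -rmorphM -rmorphB.
have pd x : hform 1 s (p x) d = 0.
  by rewrite /p hformDl hformZl hformBl bd ad0 subrr mulr0 addr0.
have p0 x : p x 0 0 = nu by rewrite /p mxE [X in _ + X]mxE [X in _ * X]mxE [X in _ * (_ + X)]mxE a0 b0 subrr mulr0 addr0.
have pr x : normc x < 3 -> nrm (p x - n0) < rho / 8 - dl.
  move=> x3.
  have -> : p x - n0 = (a - d) + (d - n0) + x *: ((b - n0) - (d - n0) - (a - d)).
    by rewrite /p [a - d + _]addrA subrK [- (d - n0)]opprB [b - n0 + _]addrA subrK [- (a - d)]opprB [b - d + _]addrA subrK addrAC.
  apply: (le_lt_trans (nrmD _ _)); rewrite nrmZ.
  apply: (slice_bound (normc_ge0 _) x3 (nrm_ge0 _) _ _ dlr).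
    exact: (three_bounds (nrmB _ _) (nrmB _ _) bn dn ad).
  by apply: (le_lt_trans (nrmD _ _)); apply: ler_ltD.
have [r8 r2 _ r24] := small_bounds dl0 rho0.
have dp x : normc x < 3 -> nrm (d - p x) < rho / 8.
  move=> /pr h; apply: (le_lt_trans (nrm_triangle n0 _ _)).
  by rewrite -(subrK dl (rho / 8)) addrC [nrm (n0 - _)]nrm_sym ltrD.
pose r := Num.sqrt (al / (al + bt)).
have rE : r ^+ 2 = al / (al + bt) by rewrite sqr_sqrtr // divr_ge0 ?addr_ge0 // ltW.
have r20 : 0 < al / (al + bt) by rewrite divr_gt0 // addr_gt0.
have r21 : al / (al + bt) < 1 by rewrite ltr_pdivrMr ?addr_gt0 // mul1r ltrDl.
have bE : b = p 1 by rewrite /p scale1r addrC subrK.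
rewrite {}bE; apply: (@circle_unique R (fun x => det3 (g d) (g (p x)) (g (p x + y *: (d - p x))) l i j) 0 1 r).
- by rewrite normc_0 sqrtr_gt0.
- rewrite (normc_real 1) normr1 -[X in _ < X]sqrtr1 ltr_sqrt //.
- rewrite subr0 (normc_real 1) normr1 mulr1 => x; rewrite subr0 => x3.
  apply: differentiable_det3; first by [].
    by apply: differentiable_line; apply: gd; exact: lt_trans (pr _ x3) r8.
  have qE z : p z + y *: (d - p z) = (a + y *: (d - a)) + z *: ((1 - y) *: (b - a)).
    by rewrite /p; apply/rowP => c; rewrite !mxE; ring.
  have -> : (fun x => g (p x + y *: (d - p x))) =
      (fun x => g ((a + y *: (d - a)) + x *: ((1 - y) *: (b - a)))).
    by apply/funext => z; rewrite qE.
  apply: differentiable_line; rewrite -qE; apply: gd.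
  apply: (le_lt_trans (nrm_triangle (p x) _ _)); rewrite addrAC subrr add0r nrmZ.
  rewrite (splitr rho); apply: ltrD; last exact: lt_trans (pr _ x3) r2.
  apply: (le_lt_trans (ler_piMl (nrm_ge0 _) y1)); apply: (lt_trans (dp _ x3)).
  by rewrite r24 ltr_pdivrMr // ltr_pMr ?divr_gt0 // ltr1n.
- rewrite subr0 (normc_real 1) normr1 mulr1 => x; rewrite subr0 => x3 xr.
  rewrite det3_swap; apply/eqP; rewrite oppr_eq0; apply/eqP.
  have inb z : nrm (z - p x) < rho / 2 -> nrm (z - n0) < rho.
    move=> zp; apply: (le_lt_trans (nrm_triangle (p x) _ _)).
    by rewrite (splitr rho) ltrD // (lt_trans (pr _ x3) r2).
  have pxx : hform 1 s (p x) (p x) = 0.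
    by rewrite pp xr rE divfK ?subrr // gt_eqF // addr_gt0.
  apply: (@null_collinear R s k g (p x) (rho / 2) ks _ _ _ d y l i j pxx _ _ (hform_sym (pd x)) _ y1).
  + by rewrite divr_gt0.
  + by move=> z zp; apply: gd; exact: inb.
  + by move=> z z' zp z'p; apply: gorth; exact: inb.
  + by rewrite p0.
  + by rewrite p0.
  + by rewrite -r24 dp.
Qed.

End Collinear.
End Base.
End NullSlices.

(** * Holomorphic functions vanishing on the null cone *)

Section NullZero.
Variable R : realType.
Notation C := R[i].
Local Notation normc := (@ComplexField.Normc.normc R).
Local Notation real_complex := (real_complex R).

Lemma row_mx10_0 s : (row_mx 1 0 : 'rV[C]_(1 + s)) 0 0 = 1.
Proof.
have h : (row_mx 1 0 : 'rV[C]_(1 + s)) 0 (lshift s ord0) = 1 by rewrite row_mxEl mxE eqxx.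
by rewrite -[RHS]h; congr (row_mx _ _ _ _); apply/val_inj.
Qed.

Lemma hform_e0 s (z : 'rV[C]_(1 + s)) : hform 1 s (row_mx 1 0) z = (z 0 0)^*.
Proof. by rewrite hformE row_mxKr dotc0l subr0 row_mx10_0 mul1r. Qed.

Lemma near_hform_neg r s n (z1 : 'rV[C]_n) : complex.Re (hform r s z1 z1) < 0 ->
  \forall z \near z1, complex.Re (hform r s z z) < 0.
Proof.
set c := complex.Re _ => c0.
pose B := n%:R * (2 * nrm z1 + 1) : R.
have B0 : 0 <= B by rewrite mulr_ge0 // addr_ge0 // mulr_ge0 // nrm_ge0.
have B1 : 0 < B + 1 by rewrite ltr_wpDl.
pose d := Num.min 1 (- c / (B + 1)).
have d0 : 0 < d by rewrite lt_min ltr01 /= divr_gt0 // oppr_gt0.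
have d1 : d <= 1 by rewrite ge_min lexx.
have dB : d * (B + 1) <= - c by rewrite -ler_pdivlMr // ge_min lexx orbT.
apply/nearP; exists d => // z /ltW zd.
have := hform_quad_lip r s zd d1; rewrite -/B ler_norml => /andP[_].
rewrite raddfB /= -/c; nra.
Qed.

Lemma shrink_bounds (A B rho N : R) : 0 <= A -> 0 <= B -> 0 < rho -> 0 < N ->
  exists2 d, 0 < d & [/\ d <= 1, d <= N, d * A < 1 / 2 & d * B < rho].
Proof.
move=> A0 B0 rp Np; pose d := Num.min 1 (Num.min N (Num.min (1 / 2 / (A + 1)) (rho / (B + 1)))).
have A1 : 0 < A + 1 by lra.
have B1 : 0 < B + 1 by lra.
have d0 : 0 < d by rewrite !lt_min ltr01 Np /= !divr_gt0.
exists d => //; have dA : d * (A + 1) <= 1 / 2.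
  by rewrite -ler_pdivlMr // !ge_min lexx !orbT.
have dB : d * (B + 1) <= rho by rewrite -ler_pdivlMr // !ge_min lexx !orbT.
split; [by rewrite ge_min lexx|by rewrite !ge_min lexx orbT|lra|lra].
Qed.

Lemma sqrt_bounds (r r2 e : R) : r ^+ 2 = r2 -> 0 <= r -> 1 - r2 <= e -> e < 1 / 2 -> 0 < r2 -> r2 < 1 ->
  [/\ `|2 * r - 1| < r, r < 1, 1 - r <= e & 0 < r].
Proof.
move=> rE r0 re e2 r20 r21.
have r1 : r < 1 by rewrite -rE in r21; nra.
have rp : 0 < r by rewrite lt_neqAle r0 andbT; apply: contraTneq r20 => rz; rewrite -rE -rz expr0n ltxx.
have h1 : 1 - r <= e by rewrite -rE in re; nra.
by split => //; rewrite ltr_norml; apply/andP; split; lra.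
Qed.

Section Base.
Variables (s : nat) (n0 : 'rV[C]_(1 + s)) (rho : R) (h : 'rV[C]_(1 + s) -> C).
Hypothesis rho0 : 0 < rho.
Hypothesis nn0 : hform 1 s n0 n0 = 0.
Hypothesis nu0 : n0 0 0 != 0.
Hypothesis hd : forall z, nrm (z - n0) < rho -> differentiable h z.
Hypothesis h0 : forall z, nrm (z - n0) < rho -> hform 1 s z z = 0 -> h z = 0.

Let e0 : 'rV[C]_(1 + s) := row_mx 1 0.

(** Keeping the 0-coordinate of [z] and scaling the rest by [x] gives a line that meets the null
    cone in a circle of radius [r] slightly below 1, with [z] at [x = 1] just outside.
    [circle_unique] crosses that circle. *)
Lemma negative_zero : exists2 d : R, 0 < d & forall z, nrm (z - n0) < d ->
  complex.Re (hform 1 s z z) < 0 -> h z = 0.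
Proof.
pose K := nrm n0; pose M := (1 + s)%:R * (2 * K + 1) : R.
pose N := normc (n0 0 0) ^+ 2; pose E := nrm e0.
have Nn : 0 < normc (n0 0 0) by rewrite normc_gt0.
have N0 : 0 < N by rewrite exprn_gt0.
have K0 : 0 <= K by exact: nrm_ge0.
have E0 : 0 <= E by exact: nrm_ge0.
have M0 : 0 <= M by rewrite mulr_ge0 // addr_ge0 // mulr_ge0.
pose A := 4 * M / N.
have A0 : 0 <= A by apply: divr_ge0; [exact: mulr_ge0|exact: ltW].
have KE : 0 <= (K + 1) * (1 + E) by apply: mulr_ge0; exact: addr_ge0.
(* The second constant bounds [nrm (p x - n0)] relative to [d]: [normc (x - 1) <= 8 * (1 - r) <= 8 *
   (d * A)], times the bound [(K + 1) * (1 + E)] for [nrm v], plus the distance from [z] to [n0]. *)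
have [||d d0 [d1 dN dA dB]] := @shrink_bounds A (8 * A * ((K + 1) * (1 + E)) + 1) rho (normc (n0 0 0) / 2) A0 _ rho0.
- by apply: addr_ge0 => //; apply: mulr_ge0 => //; exact: mulr_ge0.
- exact: divr_gt0.
exists d => // z zd zz.
have zK : nrm z <= K + 1 by have := nrmD (z - n0) n0; rewrite subrK /K; lra.
have z00 : normc (n0 0 0) / 2 <= normc (z 0 0).
  have h1 : normc (z 0 0 - n0 0 0) <= nrm (z - n0) by have := norm_entry (z - n0) 0; rewrite 2!mxE.
  have := ler_normcD (n0 0 0 - z 0 0) (z 0 0); rewrite subrK normcB; lra.
pose gm := - complex.Re (hform 1 s z z); have gm0 : 0 < gm by rewrite oppr_gt0.
have zzE : hform 1 s z z = - real_complex gm by rewrite hform_real /gm rmorphN opprK.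
pose Nz := normc (z 0 0) ^+ 2.
have NzN : N / 4 <= Nz by rewrite /Nz /N; have := normc_ge0 (z 0 0); nra.
have Nz0 : 0 < Nz by apply: lt_le_trans NzN; rewrite divr_gt0.
pose a := z 0 0 *: e0; pose v := z - a.
have aE w : hform 1 s a w = z 0 0 * (w 0 0)^* by rewrite hformZl hform_e0.
have e00 : e0 0 0 = 1 by exact: row_mx10_0.
have v0 : v 0 0 = 0 by rewrite /v /a 3!mxE e00 mulr1 subrr.
have av : hform 1 s a v = 0 by rewrite aE v0 conjC0 mulr0.
have aa : hform 1 s a a = real_complex Nz by rewrite aE /a mxE e00 mulr1 mul_conj_normc.
have vv : hform 1 s v v = - real_complex (gm + Nz).
  have : hform 1 s z z = hform 1 s a a + hform 1 s v v.
    have -> : z = a + 1 *: v by rewrite scale1r addrC subrK.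
    by rewrite hform_pythagoras // (normc_real 1) normr1 expr1n mul1r.
  by rewrite zzE aa => h1; rewrite rmorphD opprD /= h1 addrAC subrr add0r.
pose r2 := Nz / (gm + Nz).
have gN : 0 < gm + Nz by rewrite addr_gt0.
have r20 : 0 < r2 by rewrite divr_gt0.
have r21 : r2 < 1 by rewrite ltr_pdivrMr // mul1r ltrDr.
have gmd : gm <= d * M.
  by have := hform_quad_near (ltW zd) d1 nn0; rewrite ler_norml => /andP[]; rewrite /gm /M /K; lra.
have r2A : 1 - r2 <= d * A.
  have -> : 1 - r2 = gm / (gm + Nz) by rewrite /r2; field; rewrite gt_eqF.
  rewrite ler_pdivrMr //; apply: (le_trans gmd); rewrite -mulrA ler_wpM2l ?(ltW d0) //.
  have h1 : M = A * (N / 4) by rewrite /A; field; rewrite gt_eqF.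
  by rewrite {1}h1 ler_wpM2l //; apply: (le_trans NzN); rewrite lerDr ltW.
pose r := Num.sqrt r2.
have rE : r ^+ 2 = r2 by rewrite sqr_sqrtr // ltW.
have [x0r r1 rA rp] := sqrt_bounds rE (sqrtr_ge0 _) r2A dA r20 r21.
pose p (x : C) := a + x *: v.
have nv : nrm v <= (K + 1) * (1 + E).
  apply: (le_trans (nrmB _ _)); rewrite mulrDr mulr1 lerD //.
  by rewrite nrmZ ler_pM ?normc_ge0 ?nrm_ge0 //; apply: le_trans zK; exact: norm_entry.
have c1 : normc (1 - real_complex (2 * r - 1)) = 2 * (1 - r).
  rewrite -[1 in LHS]/(real_complex 1) -rmorphB normc_real ger0_norm; lra.
have pr x : normc (x - real_complex (2 * r - 1)) < 3 * normc (1 - real_complex (2 * r - 1)) ->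
    nrm (p x - n0) < rho.
  rewrite c1 => xr.
  have -> : p x - n0 = (x - 1) *: v + (z - n0).
    by rewrite scalerBl scale1r /v /p; apply/rowP => i; rewrite !mxE; ring.
  apply: le_lt_trans dB; apply: (le_trans (nrmD _ _)); rewrite nrmZ mulrDr mulr1 lerD ?(ltW zd) //.
  have x1 : normc (x - 1) <= 8 * (d * A).
    have -> : x - 1 = (x - real_complex (2 * r - 1)) - (1 - real_complex (2 * r - 1)).
      by rewrite opprB addrA subrK.
    by apply: (le_trans (ler_normcB _ _)); rewrite c1; lra.
  have -> : d * (8 * A * ((K + 1) * (1 + E))) = (8 * (d * A)) * ((K + 1) * (1 + E)) by ring.
  by rewrite ler_pM ?normc_ge0 ?nrm_ge0.
have -> : z = p 1 by rewrite /p scale1r addrC subrK.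
(* The base point is the reflection of 1 in [r]. The centre 0 would leave the neighbourhood of [n0];
   here the disc needed has radius [6 * (1 - r)], which is small. *)
apply: (@circle_unique R (fun x => h (p x)) (real_complex (2 * r - 1)) 1 r).
- by rewrite normc_real.
- by rewrite (normc_real 1) normr1.
- by move=> x /pr xr; apply: differentiable_line; exact: hd.
- move=> x /pr xr xE; apply: h0 => //.
  rewrite /p hform_pythagoras // aa vv xE rE mulrN -rmorphM /= /r2 divfK ?subrr // gt_eqF //.
Qed.

(** The negative vectors are open and accumulate at [n0], so [h] vanishes near one of them and
    [ball_unique] spreads this to the ball. *)
Lemma null_zero z : nrm (z - n0) < rho / 8 -> h z = 0.
Proof.
have [d d0 hneg] := negative_zero.
have e00 : e0 0 0 = 1 by exact: row_mx10_0.
pose u := n0 - n0 0 0 *: e0.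
pose N := normc (n0 0 0) ^+ 2.
have N0 : 0 < N by rewrite exprn_gt0 // normc_gt0.
have aE w : hform 1 s (n0 0 0 *: e0) w = n0 0 0 * (w 0 0)^* by rewrite hformZl hform_e0.
have u0 : u 0 0 = 0 by rewrite /u 3!mxE e00 mulr1 subrr.
have au : hform 1 s (n0 0 0 *: e0) u = 0 by rewrite aE u0 conjC0 mulr0.
have uu : hform 1 s u u = - real_complex N.
  have : hform 1 s n0 n0 = hform 1 s (n0 0 0 *: e0) (n0 0 0 *: e0) + hform 1 s u u.
    have {1 2}-> : n0 = n0 0 0 *: e0 + 1 *: u by rewrite scale1r addrC subrK.
    by rewrite hform_pythagoras // (normc_real 1) normr1 expr1n mul1r.
  by rewrite nn0 aE mxE e00 mulr1 mul_conj_normc => /eqP; rewrite eq_sym addrC addr_eq0 => /eqP.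
pose ep := Num.min d (rho / 8) / 2 / (nrm u + 1).
have u1 : 0 < nrm u + 1 by rewrite ltr_wpDl // nrm_ge0.
have m0 : 0 < Num.min d (rho / 8) by rewrite lt_min d0 divr_gt0.
have ep0 : 0 < ep by rewrite !divr_gt0.
(* Stretching the negative part [u] of the null vector [n0] by [1 + ep] makes it negative. *)
pose z1 := n0 + real_complex ep *: u.
have z1n : nrm (z1 - n0) < Num.min d (rho / 8).
  rewrite /z1 addrAC subrr add0r nrmZ normc_real gtr0_norm //.
  apply: (@le_lt_trans _ _ (Num.min d (rho / 8) / 2)); last by rewrite ltr_pdivrMr // ltr_pMr // ltr1n.
  by rewrite /ep mulrAC ler_pdivrMr // ler_wpM2l ?divr_ge0 ?(ltW m0) // lerDl.
have z1E : z1 = n0 0 0 *: e0 + real_complex (1 + ep) *: u.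
  by rewrite /z1 rmorphD scalerDl rmorph1 scale1r addrA; congr (_ + _); rewrite /u addrC subrK.
have z1neg : complex.Re (hform 1 s z1 z1) < 0.
  rewrite z1E hform_pythagoras // aE mxE e00 mulr1 mul_conj_normc uu normc_real.
  rewrite gtr0_norm ?addr_gt0 // mulrN -rmorphM -rmorphB /=.
  by rewrite -[X in X - _]mul1r -mulrBl pmulr_llt0 //; nra.
move: (z1n); rewrite lt_min => /andP[z1d z1r] zr.
apply: (@ball_unique R _ h n0 z1 z rho hd z1r zr).
have z1near : \forall w \near z1, nrm (w - n0) < d.
  apply/nearP; exists (d - nrm (z1 - n0)); rewrite ?subr_gt0 // => w wz.
  by apply: (le_lt_trans (nrm_triangle z1 _ _)); rewrite -ltrBrDr.
by apply: filterS2 z1near (near_hform_neg z1neg) => w; exact: hneg.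
Qed.

End Base.
End NullZero.

Section Limits.
Variable R : realType.
Notation C := R[i].
Local Notation normc := (@ComplexField.Normc.normc R).
Local Notation real_complex := (real_complex R).

Lemma cvg_hform (T : Type) (F : set_system T) {FF : Filter F} r s n (f g : T -> 'rV[C]_n) a b :
  f x @[x --> F] --> a -> g x @[x --> F] --> b ->
  (hform r s (f x) (g x) : C) @[x --> F] --> hform r s a b.
Proof.
move=> fa gb; apply/cvgrPdist_lt => e0 /posC_Re[e00 ->]; set e := complex.Re e0 in e00 *.
pose B := n%:R * (nrm a + nrm b + 1) : R.
have B0 : 0 <= B by rewrite mulr_ge0 // !addr_ge0 // nrm_ge0.
pose d := Num.min 1 (e / (B + 1)).
have d0 : 0 < d by rewrite lt_min ltr01 /= divr_gt0 // ltr_wpDl.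
have d1 : d <= 1 by rewrite ge_min lexx.
have dB : d * (B + 1) <= e by rewrite -ler_pdivlMr ?ltr_wpDl // ge_min lexx orbT.
have dC : 0 < real_complex d by rewrite ltcR.
move/cvgrPdist_lt : fa => /(_ _ dC) fa; move/cvgrPdist_lt : gb => /(_ _ dC) gb.
apply: filterS2 fa gb => x; rewrite !norm_nrm !ltcR nrm_normc => fx gx.
have -> : hform r s a b - hform r s (f x) (g x) =
    hform r s (a - f x) b + hform r s (f x) (b - g x).
  by rewrite hformBl hformBr addrA subrK.
apply: (le_lt_trans (ler_normcD _ _)).
apply: (le_lt_trans (lerD (normc_hform _ _ _ _) (normc_hform _ _ _ _))).
have fa1 : nrm (f x) <= nrm a + 1.
  by have := nrmB a (a - f x); rewrite opprB addrC subrK; lra.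
apply: (@le_lt_trans _ _ (n%:R * (d * (nrm a + nrm b + 1)))); last first.
  by rewrite mulrCA -/B; nra.
rewrite -mulrDr ler_wpM2l //.
have := nrm_ge0 (a - f x); have := nrm_ge0 (f x); have := nrm_ge0 b; have := nrm_ge0 (b - g x).
by nra.
Qed.

Lemma near_comp (T U : normedModType C) (f : T -> U) (x : T) (P : U -> Prop) :
  {for x, continuous f} -> (\forall y \near f x, P y) -> \forall z \near x, P (f z).
Proof. by move=> fc; exact: (fc [set y | P y]). Qed.

Lemma near_ball (V : normedModType C) (x : V) (a : V) (d : R) : nrm (x - a) < d ->
  \forall z \near x, nrm (z - a) < d.
Proof.
move=> xd; apply/nearP; exists (d - nrm (x - a)); rewrite ?subr_gt0 // => w wz.
by apply: (le_lt_trans (nrm_triangle x _ _)); rewrite -ltrBrDr.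
Qed.

Lemma near_neq0 (V : normedModType C) (f : V -> C) x : differentiable f x -> f x != 0 ->
  \forall z \near x, f z != 0.
Proof. by move=> /differentiable_continuous fc; exact: (cvgr_neq0 _ fc). Qed.

(** The representative of the projective point with 0-coordinate [nu], the normalization under which
    [negative_collinear] compares points. *)
Definition rescale s (nu : C) (z : 'rV[C]_(1 + s)) : 'rV[C]_(1 + s) := (nu / z 0 0) *: z.

Lemma rescale_0 s nu (z : 'rV[C]_(1 + s)) : z 0 0 != 0 -> rescale nu z 0 0 = nu.
Proof. by move=> z0; rewrite mxE divfK. Qed.

Lemma rescale_id s (z : 'rV[C]_(1 + s)) : z 0 0 != 0 -> rescale (z 0 0) z = z.
Proof. by move=> z0; rewrite /rescale divff // scale1r. Qed.

Lemma continuous_rescale s nu (z : 'rV[C]_(1 + s)) : z 0 0 != 0 ->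
  {for z, continuous (rescale nu)}.
Proof.
move=> z0; rewrite /rescale.
have c1 : {for z, continuous (fun w : 'rV[C]_(1 + s) => nu / w 0 0)}.
  apply: differentiable_continuous; apply: differentiableM => //.
  by apply: differentiableV => //; exact: (@differentiable_entry R _ _ id).
exact: (cvgZ c1 cvg_id).
Qed.

End Limits.

(** * The normalized lift near a null point *)

Section ReferencePoints.
Variable R : realType.
Notation C := R[i].
Local Notation normc := (@ComplexField.Normc.normc R).
Local Notation real_complex := (real_complex R).

Lemma Re_realM (a : R) (z : C) : complex.Re (real_complex a * z) = a * complex.Re z.
Proof. by case: z => x y; rewrite /= mul0r subr0. Qed.

(** A local lift near the null point [n] with the radical coordinates of the target removed, so [g]
    may have zeros. [lm_homo] retains that it comes from a map of projective points. *)
Record local_model s k (g : 'rV[C]_(1 + s) -> 'rV[C]_(1 + k)) (n : 'rV[C]_(1 + s)) (rho : R) : Prop := {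
  lm_rho : 0 < rho;
  lm_dim : (k + 2 <= 2 * s)%N;
  lm_null : hform 1 s n n = 0;
  lm_n0 : n 0 0 != 0;
  lm_diff : forall z, nrm (z - n) < rho -> differentiable g z;
  lm_orth : forall z w, nrm (z - n) < rho -> nrm (w - n) < rho ->
    hform 1 s z w = 0 -> hform 1 k (g z) (g w) = 0;
  lm_homo : forall z (l : C), nrm (z - n) < rho -> nrm (l *: z - n) < rho -> l != 0 ->
    exists2 c, c != 0 & g (l *: z) = c *: g z
}.

Variables (s k : nat) (g : 'rV[C]_(1 + s) -> 'rV[C]_(1 + k)) (n : 'rV[C]_(1 + s)) (rho : R).
Hypothesis lm : local_model g n rho.
Let phi z := hform 1 k (g z) (g n).
Hypothesis phi0 : ~ (\forall z \near n, phi z = 0).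

Lemma lm_center : nrm (n - n) < rho.
Proof. by rewrite subrr nrm0 (lm_rho lm). Qed.

Lemma lm_phi_diff z : nrm (z - n) < rho -> differentiable (phi : _ -> C) z.
Proof. by move=> zr; apply: differentiable_hform; exact: lm_diff lm _ zr. Qed.

Lemma lm_gn_null : hform 1 k (g n) (g n) = 0.
Proof. by apply: (lm_orth lm lm_center lm_center); exact: lm_null lm. Qed.

Lemma lm_phi_near a : nrm (a - n) < rho / 8 -> ~ (\forall z \near a, phi z = 0).
Proof.
move=> ar h; suff: \forall z \near n, phi z = 0 by exact: phi0.
apply/nearP; exists (rho / 8) => [|z zr]; first exact: divr_gt0 (lm_rho lm) _.
exact: (ball_unique lm_phi_diff ar zr h).
Qed.

(** Otherwise the dimension bound forces [k = 0]; the target form is then positive definite, so the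
    null vector [g n] is 0 and [phi] vanishes. *)
Lemma lm_s2 : (1 < s)%N.
Proof.
have ks := lm_dim lm; rewrite ltnNge; apply/negP => s1.
have k0 : k = 0%N by lia.
suff: \forall z \near n, phi z = 0 by exact: phi0.
apply/nearP; exists rho; first exact: lm_rho lm.
move=> z zr; have := lm_gn_null; rewrite /phi.
move: (g z) (g n); rewrite {}k0 => u v; rewrite !hformE /dotc !big_ord0 !subr0 => /eqP.
by rewrite mul_conjC_eq0 => /eqP ->; rewrite conjC0 mulr0.
Qed.

Lemma lm_tangent : exists u : 'rV[C]_(1 + s),
  [/\ u 0 0 = 0, hform 1 s u n = 0 & complex.Re (hform 1 s u u) < 0].
Proof.
have rn : rsubmx n != 0.
  apply: contraNneq (lm_n0 lm) => rn; have := lm_null lm.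
  by rewrite hformE rn dotc0l subr0 => /eqP; rewrite mul_conjC_eq0.
have : kermx (adjmx (rsubmx n)) != 0.
  by rewrite -mxrank_eq0 -lt0n -ltnS (rank_kermx_adj rn) lm_s2.
case/rowV0Pn => x /sub_kermxP xn x0.
have u0 := row_mx0_0 x.
exists (row_mx 0 x); split => //.
  by rewrite hformE u0 mul0r row_mxKr sub0r dotc_mx xn mxE oppr0.
rewrite hformE u0 mul0r row_mxKr sub0r raddfN /= oppr_lt0.
have := dotc_ge0 x; rewrite le_eqVlt eq_sym dotc_eq0 (negbTE x0) /=.
by move=> /posC_Re[].
Qed.

(** [p] is taken near the negative vector [q = n + a u], with [u] tangent to the null cone, where
    [phi] is not identically zero; [d] is sought on the line [n + c u], all of which is orthogonal
    to [n]. From [phi p != 0] one gets [<p, n> != 0], so [d] is not [n] itself and is negative. *)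
Lemma lm_pick (e : R) : 0 < e -> exists p d : 'rV[C]_(1 + s),
  [/\ p 0 0 = n 0 0 /\ d 0 0 = n 0 0, nrm (p - n) < e /\ nrm (d - n) < e,
      complex.Re (hform 1 s p p) < 0 /\ complex.Re (hform 1 s d d) < 0,
      hform 1 s p d = 0 /\ hform 1 s d n = 0 & phi p != 0].
Proof.
wlog er : e / e <= rho / 8.
  move=> H e0; pose e' := Num.min e (rho / 8).
  have e'0 : 0 < e' by rewrite lt_min e0 divr_gt0 // (lm_rho lm).
  have [|//|p [d [h1 [h2 h3] h4 h5 h6]]] := H e'; first by rewrite ge_min lexx orbT.
  exists p, d; split => //; split; [move: h2|move: h3]; by rewrite lt_min => /andP[].
move=> e0; have [u [u0 un uu]] := lm_tangent.
pose a := e / 2 / (nrm u + 1).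
have u1 : 0 < nrm u + 1 by rewrite ltr_wpDl // nrm_ge0.
have a0 : 0 < a by rewrite !divr_gt0.
have aC0 : real_complex a != 0 by rewrite eq_complex /= eqxx andbT gt_eqF.
pose q := n + real_complex a *: u.
have nu := hform_sym un.
have nn := lm_null lm.
have q0 : q 0 0 = n 0 0 by rewrite 2!mxE u0 mulr0 addr0.
have qn : hform 1 s q n = 0 by rewrite hformDl hformZl nn un mulr0 addr0.
have qu : hform 1 s q u != 0.
  rewrite hformDl hformZl nu add0r mulf_neq0 //.
  by apply: contraTneq uu => ->; rewrite ltxx.
have qe : nrm (q - n) < e.
  rewrite /q addrAC subrr add0r nrmZ normc_real gtr0_norm //.
  apply: (@le_lt_trans _ _ (e / 2)); last by rewrite ltr_pdivrMr // ltr_pMr // ltr1n.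
  by rewrite /a mulrAC ler_pdivrMr // ler_wpM2l ?divr_ge0 ?(ltW e0) // lerDl.
have qq : complex.Re (hform 1 s q q) < 0.
  rewrite /q hform_pythagoras // nn add0r Re_realM.
  by rewrite pmulr_rlt0 // exprn_gt0 // normc_real normr_gt0 gt_eqF.
have qn0 : q 0 0 != 0 by rewrite q0 (lm_n0 lm).
have rc : {for q, continuous (rescale (n 0 0))} by exact: continuous_rescale.
have rq : rescale (n 0 0) q = q by rewrite -q0 rescale_id.
(* The coefficient whose conjugate makes [n + c u] orthogonal to [p]. It vanishes at [q], so it is
   small nearby. *)
pose kap (p : 'rV[C]_(1 + s)) : C := - (hform 1 s p n / hform 1 s p u).
have kd : differentiable kap q.
  apply: differentiableN; apply: differentiableM; first by apply: (@differentiable_hform R _ _ _ _ id).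
  by apply: differentiableV => //; apply: (@differentiable_hform R _ _ _ _ id).
have kq : kap q = 0 by rewrite /kap qn mul0r oppr0.
have K1 : \forall p \near q, nrm (rescale (n 0 0) p - n) < e.
  by apply: (@near_comp R _ _ _ q (fun w => nrm (w - n) < e) rc); apply: near_ball; rewrite rq.
have K2 : \forall p \near q, complex.Re (hform 1 s (rescale (n 0 0) p) (rescale (n 0 0) p)) < 0.
  by apply: (@near_comp R _ _ _ q (fun w => complex.Re (hform 1 s w w) < 0) rc); apply: near_hform_neg; rewrite rq.
have K3a : \forall p \near q, (p : 'rV[C]_(1 + s)) 0 0 != 0.
  apply: (@near_neq0 R _ (fun p : 'rV[C]_(1 + s) => p 0 0) q _ qn0).
  exact: (@differentiable_entry R _ _ id).
have K3b : \forall p \near q, hform 1 s p u != 0.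
  apply: (@near_neq0 R _ (fun p : 'rV[C]_(1 + s) => hform 1 s p u) q _ qu).
  exact: (@differentiable_hform R _ _ _ _ id).
have K4 : \forall p \near q, nrm (kap p - 0) < a.
  apply: (@near_comp R _ _ kap q (fun w => nrm (w - 0) < a) (differentiable_continuous kd)); apply: near_ball.
  by rewrite kq subrr nrm0.
have K5 : \forall p \near q, nrm (p - n) < rho.
  by apply: near_ball; have := lm_rho lm; lra.
have [p [ph [k1 k2 [p00 k3] k4 k5]]] : exists p : 'rV[C]_(1 + s), phi p != 0 /\
   [/\ nrm (rescale (n 0 0) p - n) < e,
    complex.Re (hform 1 s (rescale (n 0 0) p) (rescale (n 0 0) p)) < 0,
    p 0 0 != 0 /\ hform 1 s p u != 0, nrm (kap p - 0) < a & nrm (p - n) < rho].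
  apply/not_existsP => H; apply: (@lm_phi_near q); first exact: lt_le_trans er.
  near=> p; apply/eqP/negP => /negP ph; apply: (H p); split; first by [].
  by split; first [by near: p|split; near: p].
pose P := rescale (n 0 0) p; pose D := n + (kap p)^* *: u.
have nuC : n 0 0 / p 0 0 != 0 by rewrite mulf_neq0 ?invr_eq0 // (lm_n0 lm).
have Pr : nrm (P - n) < rho by apply: (lt_trans k1); have := lm_rho lm; lra.
exists P, D; split.
- by split; [exact: rescale_0|rewrite 2!mxE u0 mulr0 addr0].
- split; first exact: k1.
  rewrite /D addrAC subrr add0r nrmZ.
  have -> : normc (kap p)^* = nrm (kap p - 0).
    by rewrite subr0 nrm_normc; apply: complexI; rewrite -!norm_normc norm_conjC.
  apply: (@le_lt_trans _ _ (a * (nrm u + 1))).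
    by rewrite ler_pM ?nrm_ge0 ?(ltW k4) // lerDl.
  by rewrite /a divfK ?gt_eqF // ltr_pdivrMr // ltr_pMr // ltr1n.
- split; first exact: k2.
  rewrite /D hform_pythagoras // nn add0r Re_realM.
  rewrite pmulr_rlt0 // exprn_gt0 // normc_gt0 conjC_eq0 /kap oppr_eq0 mulf_neq0 ?invr_eq0 //.
  by apply: contra ph => /eqP pn; rewrite /phi (lm_orth lm k5 lm_center pn).
- split; last by rewrite hformDl hformZl nn un mulr0 addr0.
  by rewrite hformZl hformDr hformZr conjCK /kap mulNr divfK // subrr mulr0.
- have [c c0 cE] := lm_homo lm k5 Pr nuC.
  by rewrite /phi /P /rescale cE hformZl mulf_neq0.
Unshelve. all: by end_near. Qed.

End ReferencePoints.

Section Normalized.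
Variable R : realType.
Notation C := R[i].
Local Notation normc := (@ComplexField.Normc.normc R).
Local Notation real_complex := (real_complex R).

(** The minors are the coefficients of a linear relation among [a], [b], [c]; pairing that relation
    with [e] removes [a] and leaves the claim. *)
Lemma det3_contract r s k (a b c e : 'rV[C]_k) i j : hform r s a e = 0 ->
  (forall l, det3 a b c l i j = 0) ->
  minor2 (hform r s b e *: c - hform r s c e *: b) a i j = 0.
Proof.
move=> ae dabc.
have v0 : minor2 b c i j *: a + (a 0 j * c 0 i - a 0 i * c 0 j) *: b + minor2 a b i j *: c = 0.
  by apply/rowP => l; rewrite !mxE -(dabc l) /det3 /minor2; ring.
have := hform0l r s e; rewrite -v0 !hformDl !hformZl ae mulr0 add0r => h.
by rewrite -h /minor2 !mxE; ring.
Qed.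

Lemma minor2Zl k (a b : 'rV[C]_k) x i j : minor2 (x *: a) b i j = x * minor2 a b i j.
Proof. by rewrite /minor2 !mxE; ring. Qed.

Lemma minor2Bl k (a b c : 'rV[C]_k) i j : minor2 (a - b) c i j = minor2 a c i j - minor2 b c i j.
Proof. by rewrite /minor2 !mxE; ring. Qed.

Lemma Re_hformZ r s n (x : C) (z : 'rV[C]_n) : x != 0 -> complex.Re (hform r s z z) < 0 ->
  complex.Re (hform r s (x *: z) (x *: z)) < 0.
Proof.
move=> x0 zz; rewrite hformZl hformZr mulrA mul_conj_normc Re_realM.
by rewrite pmulr_rlt0 // exprn_gt0 // normc_gt0.
Qed.

Variables (s k : nat) (g : 'rV[C]_(1 + s) -> 'rV[C]_(1 + k)) (n : 'rV[C]_(1 + s)) (rho : R).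
Hypothesis lm : local_model g n rho.
Let phi z : C := hform 1 k (g z) (g n).
Let nu := n 0 0.

(** The multiple of [g z] with [<ghat z, g n> = <z, n>] where [phi z != 0]. It is independent of the
    lift near [z], and if [g] is an isometry times a scalar function, [ghat] is that isometry up to
    a constant. *)
Definition ghat (z : 'rV[C]_(1 + s)) : 'rV[C]_(1 + k) :=
  (hform 1 s z n / hform 1 k (g z) (g n)) *: g z.

Definition good_base dl (b : 'rV[C]_(1 + s)) := [/\ b 0 0 != 0, nrm (rescale nu b - n) < dl,
  complex.Re (hform 1 s b b) < 0 & nrm (b - n) < rho].

Lemma good_base_near dl (p : 'rV[C]_(1 + s)) : dl <= rho -> p 0 0 = nu -> nrm (p - n) < dl ->
  complex.Re (hform 1 s p p) < 0 -> \forall b \near p, good_base dl b.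
Proof.
move=> dlr p0 pn pp.
have p00 : p 0 0 != 0 by rewrite p0 (lm_n0 lm).
have rc : {for p, continuous (rescale nu)} by exact: continuous_rescale.
have K1 : \forall b \near p, (b : 'rV[C]_(1 + s)) 0 0 != 0.
  apply: (@near_neq0 R _ (fun p : 'rV[C]_(1 + s) => p 0 0) p _ p00).
  exact: (@differentiable_entry R _ _ id).
have K2 : \forall b \near p, nrm (rescale nu b - n) < dl.
  by apply: (@near_comp R _ _ _ p (fun w => nrm (w - n) < dl) rc); apply: near_ball; rewrite -p0 rescale_id.
have K3 := near_hform_neg pp.
have K4 : \forall b \near p, nrm (b - n) < rho by apply: near_ball; exact: lt_le_trans dlr.
by apply: filterS2 (filterI K1 K2) (filterI K3 K4) => b [b1 b2] [b3 b4]; split.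
Qed.

(** The images of [d], [b], [b + c d] are dependent by [negative_collinear]. Since [d] is orthogonal
    to [n], [<g d, g n> = 0] and [<b + c d, n> = <b, n>], so contracting with [g n] turns the
    dependence into a statement on the difference of [ghat]. *)
Lemma ghat_line : exists2 dl : R, 0 < dl <= rho & forall (b d : 'rV[C]_(1 + s)) (c : C) i j,
  good_base dl b -> good_base dl d -> hform 1 s b d = 0 -> hform 1 s d n = 0 ->
  nrm (b + c *: d - n) < rho -> normc (c * d 0 0) <= normc (b 0 0) / 2 ->
  phi b != 0 -> phi (b + c *: d) != 0 -> minor2 (ghat (b + c *: d) - ghat b) (g d) i j = 0.
Proof.
have [dl0 dl00 H] := negative_collinear (lm_rho lm) (lm_null lm) (lm_n0 lm) (lm_dim lm) (lm_diff lm) (lm_orth lm).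
have r0 := lm_rho lm; pose dl := Num.min dl0 (rho / 4).
have dlr4 : dl <= rho / 4 by rewrite ge_min lexx orbT.
have dlr : dl <= rho by lra.
have dldl : dl <= dl0 by rewrite ge_min lexx.
exists dl; first by rewrite dlr andbT lt_min dl00 divr_gt0.
move=> b d c i j [b0 bn bb br] [d0 dn dd dr] bd dn0 bcr cd pb pbc.
(* [y] is the parameter of the rescaled [b + c d] on the line from the rescaled [b] to the rescaled
   [d]; the bound on [c] makes [normc y <= 1]. *)
pose sg := b 0 0 + c * d 0 0; pose y := c * d 0 0 / sg.
have bsg : normc (b 0 0) <= normc sg + normc (c * d 0 0).
  by have := ler_normcB sg (c * d 0 0); rewrite /sg addrK.
have b00 : 0 < normc (b 0 0) by rewrite normc_gt0.
have sg0 : sg != 0 by rewrite -normc_gt0; lra.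
have y1 : normc y <= 1.
  have yE : y * sg = c * d 0 0 by rewrite /y divfK.
  have : normc y * normc sg <= normc sg by rewrite -normc_mul yE; lra.
  by rewrite ger_pMl // normc_gt0.
have nu0 : nu != 0 := lm_n0 lm.
have be0 : nu / b 0 0 != 0 by rewrite mulf_neq0 ?invr_eq0.
have de0 : nu / d 0 0 != 0 by rewrite mulf_neq0 ?invr_eq0.
have se0 : nu / sg != 0 by rewrite mulf_neq0 ?invr_eq0.
have E : rescale nu b + y *: (rescale nu d - rescale nu b) = (nu / sg) *: (b + c *: d).
  rewrite /rescale /y /sg; apply/rowP => l; rewrite !mxE; field.
  by rewrite d0 b0 -/sg sg0.
have det0 l i' j' : det3 (g d) (g b) (g (b + c *: d)) l i' j' = 0.
  have := H (rescale nu b) (rescale nu d) y l i' j' (rescale_0 _ b0) (rescale_0 _ d0)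
    (lt_le_trans bn dldl) (lt_le_trans dn dldl) _ (Re_hformZ be0 bb) (Re_hformZ de0 dd) y1.
  rewrite E /rescale hformZl hformZr bd !mulr0 => /(_ erefl).
  have [c1 c10 ->] := lm_homo lm br (lt_le_trans bn dlr) be0.
  have [c2 c20 ->] := lm_homo lm dr (lt_le_trans dn dlr) de0.
  have Er : nrm ((nu / sg) *: (b + c *: d) - n) < rho.
    rewrite -E; have -> : rescale nu b + y *: (rescale nu d - rescale nu b) - n =
        (rescale nu b - n) + y *: ((rescale nu d - n) - (rescale nu b - n)).
      by rewrite addrAC; congr (_ + _ *: _); rewrite opprB addrA subrK.
    apply: (le_lt_trans (nrmD _ _)); rewrite nrmZ.
    apply: (le_lt_trans (lerD (lexx _) (ler_piMl (nrm_ge0 _) y1))).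
    apply: (le_lt_trans (lerD (lexx _) (nrmB _ _))).
    by move: bn dn dlr4 r0; move: (nrm _) (nrm _) => B' D'; lra.
  have [c3 c30 ->] := lm_homo lm bcr Er se0.
  by rewrite det3Z => /eqP; rewrite !mulf_eq0 (negbTE c10) (negbTE c20) (negbTE c30) /= => /eqP.
have gdn : hform 1 k (g d) (g n) = 0 by exact: (lm_orth lm dr (lm_center lm)).
have := det3_contract gdn (fun l => det0 l i j); rewrite -/(phi b) -/(phi (b + c *: d)) => h.
have -> : ghat (b + c *: d) - ghat b = (hform 1 s b n / (phi b * phi (b + c *: d))) *:
    (phi b *: g (b + c *: d) - phi (b + c *: d) *: g b).
  rewrite /ghat -/(phi b) -/(phi (b + c *: d)) hformDl hformZl dn0 mulr0 addr0.
  by apply/rowP => l; rewrite !mxE; field; rewrite pb pbc.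
by rewrite minor2Zl h mulr0.
Qed.
End Normalized.

Section Parallel.
Variable R : realType.
Notation C := R[i].
Local Notation normc := (@ComplexField.Normc.normc R).
Local Notation real_complex := (real_complex R).

Variables (s k : nat) (g : 'rV[C]_(1 + s) -> 'rV[C]_(1 + k)) (n : 'rV[C]_(1 + s)) (rho : R).
Hypothesis lm : local_model g n rho.
Let phi z : C := hform 1 k (g z) (g n).
Hypothesis phi0 : ~ (\forall z \near n, phi z = 0).

Lemma lm_g_neq0 : exists2 r, 0 < r & forall z, nrm (z - n) < r -> g z != 0.
Proof.
have gn0 : g n != 0.
  apply/eqP => gn; apply: phi0; apply/nearP; exists rho; first exact: lm_rho lm.
  by move=> z _; rewrite /phi gn hform0r.
have [i gi] : exists i, g n 0 i != 0.
  apply/not_existsP => H; case/eqP: gn0; apply/rowP => i; rewrite mxE; apply/eqP/negP => /negP.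
  exact: H.
have gd : differentiable (fun z => g z 0 i : C) n.
  by apply: differentiable_entry; exact: (lm_diff lm (lm_center lm)).
have /nearP[r r0 H] := @near_neq0 R _ (fun z => g z 0 i : C) n gd gi.
by exists r => // z /H; apply: contra => /eqP ->; rewrite mxE.
Qed.

Definition parallel_near (p d : 'rV[C]_(1 + s)) (eta : R) := forall z d' (t : C),
  nrm (z - p) < eta -> nrm (d' - d) < eta -> normc t < eta -> hform 1 s d' n = 0 ->
  forall i j, minor2 (ghat g n (z + t *: d') - ghat g n z) (g d') i j = 0.

(** This frees [ghat_line] from the orthogonality of base point and direction: [z] and [z + t d']
    both lie on the line through the projection of [z] orthogonal to [d'], and the two differences
    from that projection are subtracted. *)
Lemma ghat_parallel : exists (p d : 'rV[C]_(1 + s)) (eta : R),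
  [/\ 0 < eta /\ parallel_near p d eta, nrm (p - n) < rho / 8 /\ nrm (d - n) < rho / 8,
      hform 1 s p d = 0 /\ hform 1 s d n = 0,
      complex.Re (hform 1 s d d) < 0 & phi p != 0 /\ g d != 0].
Proof.
have [dl /andP[dl0 dlr] line] := ghat_line lm.
have r0 := lm_rho lm.
have [r1 r10 gn0] := lm_g_neq0.
pose e := Num.min dl (Num.min (rho / 8) r1).
have e0 : 0 < e by rewrite !lt_min dl0 r10 divr_gt0.
have [p [d [[p0 d0] [pe de] [pp dd] [pd dn] pphi]]] := lm_pick lm phi0 e0.
move: pe de; rewrite !lt_min => /and3P[pdl pr _] /and3P[ddl dr dr1].
have pr' : nrm (p - n) < rho by lra.
have p00 : p 0 0 != 0 by rewrite p0 (lm_n0 lm).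
pose PBp (b : 'rV[C]_(1 + s)) := [/\ good_base n rho dl b, phi b != 0 & normc (p 0 0) / 2 < normc (b 0 0)].
have PB : \forall b \near p, PBp b.
  have K1 := good_base_near lm dlr p0 pdl pp.
  have K2 : \forall b \near p, phi b != 0 by exact: (@near_neq0 R _ phi p (lm_phi_diff lm pr') pphi).
  have K3 : \forall b \near p, normc (p 0 0) / 2 < normc ((b : 'rV[C]_(1 + s)) 0 0).
    apply/nearP; exists (normc (p 0 0) / 2); first by rewrite divr_gt0 // normc_gt0.
    move=> b bp; have := norm_entry (p - b) 0; rewrite 2!mxE nrm_sym => h.
    by have := ler_normcD (p 0 0 - b 0 0) (b 0 0); rewrite subrK; lra.
  by apply: filterS2 (filterI K1 K2) K3 => b [? ?] ?; split.
pose PDp (b : 'rV[C]_(1 + s)) := good_base n rho dl b /\ normc (b 0 0) < normc (d 0 0) + 1.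
have PD : \forall b \near d, PDp b.
  have K1 := good_base_near lm dlr d0 ddl dd.
  have K3 : \forall b \near d, normc ((b : 'rV[C]_(1 + s)) 0 0) < normc (d 0 0) + 1.
    apply/nearP; exists 1 => // b bd; have := norm_entry (b - d) 0; rewrite 2!mxE => h.
    by have := ler_normcD (b 0 0 - d 0 0) (d 0 0); rewrite subrK; lra.
  by apply: filterS2 K1 K3 => b ? ?; split.
pose m := normc (p 0 0) / 4 / (normc (d 0 0) + 1).
have m0 : 0 < m by rewrite !divr_gt0 ?normc_gt0 // ltr_wpDl // normc_ge0.
have PC : \forall c \near (0 : C), normc c < m.
  by apply/nearP; exists m => // c; rewrite subr0 nrm_normc.
pose T := ('rV[C]_(1 + s) * 'rV[C]_(1 + s) * C)%type.
pose x0 : T := (p, d, 0).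
pose kap (x : T) : C := hform 1 s x.1.1 x.1.2 / hform 1 s x.1.2 x.1.2.
pose bf (x : T) := x.1.1 - kap x *: x.1.2.
have cz : x.1.1 @[x --> x0] --> p by apply: (@cvg_comp _ _ _ fst fst _ (nbhs (p, d))); exact: cvg_fst.
have cd : x.1.2 @[x --> x0] --> d.
  by apply: (@cvg_comp _ _ _ fst snd _ (nbhs (p, d))); [exact: cvg_fst|exact: cvg_snd].
have ct : x.2 @[x --> x0] --> (0 : C) by exact: cvg_snd.
have dd0 : hform 1 s d d != 0 by apply: contraTneq dd => ->; rewrite ltxx.
have ck : kap x @[x --> x0] --> (0 : C).
  rewrite -[X in _ --> X](mul0r (hform 1 s d d)^-1) -pd.
  exact: (cvgCM (cvg_hform cz cd) (cvgCV dd0 (cvg_hform cd cd))).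
have cb : bf x @[x --> x0] --> p.
  rewrite -[X in _ --> X]subr0 -(scale0r d); exact: (cvgB cz (cvgZ ck cd)).
have ckt : (kap x + x.2) @[x --> x0] --> (0 : C).
  by rewrite -[X in _ --> X](addr0 0); exact: (cvgCD ck ct).
have czt : (x.1.1 + x.2 *: x.1.2) @[x --> x0] --> p.
  rewrite -[X in _ --> X]addr0 -(scale0r d); exact: (cvgD cz (cvgZ ct cd)).
have F1 : \forall x \near x0, PBp (bf x) by exact: (cb PBp PB).
have F2 : \forall x \near x0, PBp x.1.1 by exact: (cz PBp PB).
have F3 : \forall x \near x0, PBp (x.1.1 + x.2 *: x.1.2) by exact: (czt PBp PB).
have F4 : \forall x \near x0, PDp x.1.2 by exact: (cd PDp PD).
have F5 : \forall x \near x0, normc (kap x) < m by exact: (ck (fun c => normc c < m) PC).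
have F6 : \forall x \near x0, normc (kap x + x.2) < m by exact: (ckt (fun c => normc c < m) PC).
have H : \forall x \near x0, hform 1 s x.1.2 n = 0 ->
    forall i j, minor2 (ghat g n (x.1.1 + x.2 *: x.1.2) - ghat g n x.1.1) (g x.1.2) i j = 0.
  apply: filterS2 (filterI (filterI F1 F2) (filterI F3 F4)) (filterI F5 F6) => -[[z d'] t].
  rewrite /= => -[[Bb Bz] [Bzt Bd]] [Ck Ckt] dn' i j.
  have [gb phb bp] := Bb; have [gz phz _] := Bz; have [gzt phzt _] := Bzt; have [gd dm] := Bd.
  pose b := bf (z, d', t); pose ka := kap (z, d', t).
  have ddn : hform 1 s d' d' != 0 by have [_ _ h _] := gd; apply: contraTneq h => ->; rewrite ltxx.
  have zE : z = b + ka *: d' by rewrite /b /bf /= subrK.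
  have bd' : hform 1 s b d' = 0 by rewrite /b /bf /ka /kap /= hformBl hformZl divfK // subrr.
  have small c : normc c < m -> normc (c * d' 0 0) <= normc (b 0 0) / 2.
    move=> cm; rewrite normc_mul; apply: (@le_trans _ _ (normc (p 0 0) / 4)); last by rewrite -/b in bp; lra.
    apply: (@le_trans _ _ (m * (normc (d 0 0) + 1))); last by rewrite /m divfK // gt_eqF // ltr_wpDl // normc_ge0.
    by rewrite ler_pM ?normc_ge0 ?(ltW cm) ?(ltW dm).
  have E1 : minor2 (ghat g n z - ghat g n b) (g d') i j = 0.
    rewrite {1}zE; apply: line => //; rewrite -?zE //; last exact: small.
    by have [_ _ _] := gz.
  have ztE : z + t *: d' = b + (ka + t) *: d' by rewrite zE scalerDl addrA.
  have E2 : minor2 (ghat g n (z + t *: d') - ghat g n b) (g d') i j = 0.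
    rewrite {1}ztE; apply: line => //; rewrite -?ztE //; last exact: small.
    by have [_ _ _] := gzt.
  have -> : ghat g n (z + t *: d') - ghat g n z =
    (ghat g n (z + t *: d') - ghat g n b) - (ghat g n z - ghat g n b) by rewrite opprB addrA subrK.
  by rewrite minor2Bl E1 E2 subrr.
exists p, d.
case: H => -[PQ P3] /= [[[P1 P2] /= [P1n P2n] sub12] P3n] sub.
move: P1n P2n P3n => /nearP[e1 e10 H1] /nearP[e2 e20 H2] /nearP[e3 e30 H3].
exists (Num.min e1 (Num.min e2 e3)); split => //; last by split => //; exact: gn0.
split; first by rewrite !lt_min e10 e20.
move=> z d' t; rewrite !lt_min => /andP[z1 _] /and3P[_ d2 _] /and3P[_ _ t3] dn' i j.
apply: (sub (z, d', t)) => //; split; last by apply: H3; rewrite subr0 nrm_normc.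
by apply: (sub12 (z, d')); split; [exact: H1|exact: H2].
Qed.

End Parallel.

(** * Affinity and linearity of the normalized lift *)

Section Affine.
Variable R : realType.
Notation C := R[i].
Local Notation normc := (@ComplexField.Normc.normc R).
Local Notation real_complex := (real_complex R).

Lemma differentiable_scaler (V : normedModType C) m (f : V -> C) (v : V -> 'rV[C]_m) x :
  differentiable f x -> differentiable v x -> differentiable (fun x => f x *: v x) x.
Proof.
move=> fd vd.
have -> : (fun x => f x *: v x) =
    \sum_(j < m) (fun x => (f x * v x 0 j) *: (delta_mx 0 j : 'rV[C]_m)).
  apply/funext => y; rewrite fct_sumE {1}(row_sum_delta (v y)) scaler_sumr.
  by apply: eq_bigr => j _; rewrite scalerA.
apply: differentiable_sum => j; apply: differentiableZl; apply: differentiableM => //.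
exact: differentiable_entry.
Qed.

Lemma sub_swap (V : zmodType) (a b c d : V) : (a - b) - (c - d) = (a - c) - (b - d).
Proof. by rewrite !opprD !opprK addrACA. Qed.

Lemma parallel_two m (v a b : 'rV[C]_m) i j : (forall i j, minor2 v a i j = 0) ->
  (forall i j, minor2 v b i j = 0) -> minor2 a b i j != 0 -> v = 0.
Proof.
move=> va vb ab; apply/rowP => l; rewrite mxE; apply/eqP.
rewrite -[_ == _]orbF -(negbTE ab) -mulf_eq0; apply/eqP.
have e1 : v 0 l * a 0 i = v 0 i * a 0 l by apply/eqP; rewrite -subr_eq0; apply/eqP; exact: va.
have e2 : v 0 l * a 0 j = v 0 j * a 0 l by apply/eqP; rewrite -subr_eq0; apply/eqP; exact: va.
have e3 := vb i j.
by rewrite /minor2 mulrBr !mulrA e1 e2 -[RHS](mul0r (a 0 l)) -e3 /minor2; ring.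
Qed.

(** Iterating gives [psi t = 2 ^+ k * psi (t / 2 ^+ k)], and the right side tends to 0 because the
    derivative at 0 vanishes. *)
Lemma doubling_zero (psi : C -> C) (e : R) : cdiff psi 0 0 -> psi 0 = 0 ->
  (forall t, normc t < e -> psi (2 * t) = 2 * psi t) -> forall t, normc t < e -> psi t = 0.
Proof.
move=> pd p0 dbl t te; apply/eqP; rewrite -[_ == _]negbK -normc_gt0; apply/negP => pt.
have n2 : normc 2 = 2 :> R.
  have -> : (2 : C) = real_complex 2 by rewrite rmorph_nat.
  by rewrite normc_real ger0_norm.
have nk k : normc (2 ^+ k) = 2 ^+ k :> R.
  by elim: k => [|k IH]; rewrite ?expr0 ?(normc_real 1) ?normr1 // !exprS normc_mul n2 IH.
have nV (x : C) : normc x^-1 = (normc x)^-1.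
  by apply: complexI; rewrite -norm_normc normfV norm_normc fmorphV.
have tk k : normc (t / 2 ^+ k) = normc t / 2 ^+ k by rewrite normc_mul nV nk.
have pk k : 0 < (2 : R) ^+ k by rewrite exprn_gt0.
have t0 : 0 < normc t by rewrite normc_gt0; apply: contraTneq pt => ->; rewrite p0 normc_0 ltxx.
have psiE k : psi t = 2 ^+ k * psi (t / 2 ^+ k).
  elim: k => [|k IH]; first by rewrite expr0 mul1r divr1.
  have -> : 2 ^+ k.+1 * psi (t / 2 ^+ k.+1) = 2 ^+ k * (2 * psi (t / 2 ^+ k.+1)).
    by rewrite exprSr mulrA.
  rewrite -dbl.
    rewrite {1}IH; congr (_ * psi _); rewrite exprS; field.
    by rewrite expf_neq0 // pnatr_eq0.
  apply: le_lt_trans te; rewrite tk ler_pdivrMr // ler_peMr ?normc_ge0 //.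
  by rewrite exprn_ege1 // ler1n.
have ee : 0 < normc (psi t) / normc t / 2 by rewrite !divr_gt0.
have [d d0 H] := pd _ ee.
have [k Hk] : exists k, normc t / d < 2 ^+ k.
  exists (Num.bound (normc t / d)).
  apply: lt_le_trans (archi_boundP _) _; first by rewrite divr_ge0 // ltW.
  by rewrite -natrX ler_nat ltnW // ltn_expl.
have := H (t / 2 ^+ k); rewrite !subr0 p0 subr0 mul0r subr0 tk.
rewrite ltr_pdivrMr // mulrC -ltr_pdivrMr // => /(_ Hk).
rewrite -(ler_pM2l (pk k)) -{1}nk -normc_mul -psiE.
have -> : 2 ^+ k * (normc (psi t) / normc t / 2 * (normc t / 2 ^+ k)) = normc (psi t) / 2.
  by field; rewrite gt_eqF // gt_eqF.
lra.
Qed.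

Variables (s k : nat) (g : 'rV[C]_(1 + s) -> 'rV[C]_(1 + k)) (n : 'rV[C]_(1 + s)) (rho : R).
Hypothesis lm : local_model g n rho.
Let phi z : C := hform 1 k (g z) (g n).
Let gh := ghat g n.

Lemma differentiable_ghat z : nrm (z - n) < rho -> phi z != 0 -> differentiable gh z.
Proof.
move=> zr pz; apply: differentiable_scaler; last exact: (lm_diff lm zr).
apply: differentiableM; first by apply: (@differentiable_hform R _ _ _ _ id).
by apply: differentiableV => //; exact: (lm_phi_diff lm zr).
Qed.

Variables (p d : 'rV[C]_(1 + s)) (eta : R).
Hypothesis eta0 : 0 < eta.
Hypothesis par : parallel_near g n p d eta.
Hypothesis pn : nrm (p - n) < rho / 8.
Hypothesis dn8 : nrm (d - n) < rho / 8.
Hypothesis pd : hform 1 s p d = 0.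
Hypothesis dn : hform 1 s d n = 0.
Hypothesis pphi : phi p != 0.
Hypothesis gd0 : g d != 0.

(** Since [p] is orthogonal to [d], [g p] is orthogonal to [g d]; if [g d] were a multiple of [g n],
    this would contradict [phi p != 0]. *)
Lemma not_parallel : exists i j, minor2 (g d) (g n) i j != 0.
Proof.
have r0 := lm_rho lm.
have pr : nrm (p - n) < rho by have := pn; lra.
have dr : nrm (d - n) < rho by have := dn8; lra.
apply/not_existsP => H.
have m0 i j : minor2 (g d) (g n) i j = 0.
  by apply/eqP/negP => /negP mij; apply: (H i); exists j.
have [i gi] : exists i, g n 0 i != 0.
  apply/not_existsP => H'; case/eqP: pphi.
  have gn0 : g n = 0 by apply/rowP => i; rewrite mxE; apply/eqP/negP => /negP; exact: H'.
  by rewrite /phi gn0 hform0r.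
have gdE : g d = (g d 0 i / g n 0 i) *: g n.
  apply/rowP => j; rewrite mxE; have /eqP := m0 i j; rewrite /minor2 subr_eq0 => /eqP e.
  by rewrite mulrAC e mulfK.
have c0 : g d 0 i / g n 0 i != 0 by apply: contraNneq gd0 => c0; rewrite gdE c0 scale0r.
have := lm_orth lm pr dr pd; rewrite gdE hformZr => /eqP.
by rewrite mulf_eq0 conjC_eq0 (negbTE c0) (negbTE pphi).
Qed.

(** A mixed second difference of [ghat] along two directions orthogonal to [n] is parallel to the
    images of both directions, hence 0 when these are independent. Letting the second direction tend
    to the first yields the pure second difference. *)
Lemma second_difference : exists2 e : R, 0 < e & forall d' (t : C),
  nrm (d' - d) < e -> normc t < e -> hform 1 s d' n = 0 ->
  gh (p + (2 * t) *: d') + gh p = gh (p + t *: d') *+ 2.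
Proof.
have [i0 [j0 m0]] := not_parallel.
have r0 := lm_rho lm; have et := eta0.
have pr : nrm (p - n) < rho by have := pn; lra.
have dr : nrm (d - n) < rho by have := dn8; lra.
have /nearP[e1 e10 He1] : \forall z \near p, phi z != 0.
  exact: (@near_neq0 R _ phi p (lm_phi_diff lm pr) pphi).
have /nearP[e2 e20 He2] : \forall z \near d, minor2 (g z) (g n) i0 j0 != 0.
  apply: (@near_neq0 R _ (fun z => minor2 (g z) (g n) i0 j0) d _ m0).
  by apply: differentiable_minor2 => //; exact: (lm_diff lm dr).
have /nearP[e3 e30 He3] : \forall z \near p, nrm (z - n) < rho by exact: near_ball.
have /nearP[e4 e40 He4] : \forall z \near d, nrm (z - n) < rho / 8 by exact: near_ball.
pose e' := Num.min (Num.min e1 e2) (Num.min (Num.min e3 e4) eta).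
have e'0 : 0 < e' by rewrite !lt_min e10 e20 e30 e40.
pose K := nrm d + e' + 1.
have K0 : 1 <= K by rewrite lerDr addr_ge0 ?nrm_ge0 // ltW.
pose e := Num.min e' (e' / 2 / K).
have e0 : 0 < e by rewrite lt_min e'0 !divr_gt0 //; lra.
exists e => [|d' t d'd]; first exact: e0.
rewrite lt_min => /andP[te tK] d'n.
have d'e : nrm (d' - d) < e' by apply: lt_le_trans d'd _; rewrite ge_min lexx.
have d'K : nrm d' < K by have := nrmD (d' - d) d; rewrite subrK /K; lra.
have tiny (c : 'rV[C]_(1 + s)) : nrm c < K -> nrm (t *: c) < e' / 2.
  move=> cK; rewrite nrmZ; rewrite ltr_pdivlMr in tK; last by lra.
  by apply: le_lt_trans tK; rewrite ler_wpM2l ?normc_ge0 // ltW.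
have e'all x : x < e' -> [/\ x < e1, x < e2, x < e3, x < e4 & x < eta].
  by rewrite !lt_min => /andP[/andP[? ?] /andP[/andP[? ?] ?]]; split.
(* Directions from [d'] to [n], all orthogonal to [n] because [n] is null. *)
pose dt (tau : C) := d' + tau *: (n - d').
pose Dl tau := (gh (p + t *: d' + t *: dt tau) - gh (p + t *: d')) - (gh (p + t *: dt tau) - gh p).
have dtn tau : hform 1 s (dt tau) n = 0.
  by rewrite hformDl hformZl hformBl (lm_null lm) d'n subrr mulr0 addr0.
have dt0 : dt 0 = d' by rewrite /dt scale0r addr0.
have dtd tau : differentiable dt tau by apply: (@differentiable_line R _ _ id).
have dtc : {for 0, continuous dt} by exact: differentiable_continuous.
have near1 : \forall tau \near (0 : C), nrm (dt tau - d) < e'.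
  by apply: (@near_comp R _ _ dt 0 (fun w => nrm (w - d) < e') dtc); apply: near_ball; rewrite dt0.
have near2 : \forall tau \near (0 : C), nrm (dt tau - 0) < K.
  by apply: (@near_comp R _ _ dt 0 (fun w => nrm (w - 0) < K) dtc); apply: near_ball; rewrite dt0 subr0.
have half (x : 'rV[C]_(1 + s)) : nrm x < e' / 2 -> nrm (p + x - p) < e'.
  by rewrite addrAC subrr add0r; lra.
have sum2 (x y : 'rV[C]_(1 + s)) : nrm x < e' / 2 -> nrm y < e' / 2 -> nrm (p + x + y - p) < e'.
  by move=> ? ?; rewrite addrAC [p + x]addrC addrK; have := nrmD x y; lra.
have Dlm : \forall tau \near (0 : C), (forall i j, minor2 (Dl tau) (g d') i j = 0) /\
    (forall i j, minor2 (Dl tau) (g (dt tau)) i j = 0).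
  apply: filterS2 near1 near2 => tau n1; rewrite subr0 => n2.
  have [_ _ _ _ n1e] := e'all _ n1; have [_ _ _ _ d'eta] := e'all _ d'e; have [_ _ _ _ teta] := e'all _ te.
  have [_ _ _ _ h1] := e'all _ (half _ (tiny _ d'K)); have [_ _ _ _ h2] := e'all _ (half _ (tiny _ n2)).
  have pp : nrm (p - p) < eta by rewrite subrr nrm0.
  split=> i j.
    have -> : Dl tau = (gh (p + t *: dt tau + t *: d') - gh (p + t *: dt tau)) - (gh (p + t *: d') - gh p).
      have pA : p + t *: d' + t *: dt tau = p + t *: dt tau + t *: d' by exact: addrAC.
      rewrite /Dl pA; exact: sub_swap.
    by rewrite minor2Bl (par h2 d'eta teta d'n) (par pp d'eta teta d'n) subrr.
  by rewrite /Dl minor2Bl (par h1 n1e teta (dtn tau)) (par pp n1e teta (dtn tau)) subrr.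
(* Otherwise [Dl tau] is nonzero near 0, so [g (dt tau)] is parallel to [g d'] in the columns [i0],
   [j0] for small [tau]. By continuation this holds at [tau = 1], where [dt 1 = n], against the
   choice of [i0] and [j0]. *)
have Dl0 : Dl 0 = 0.
  apply/rowP => l; rewrite [RHS]mxE; apply/eqP/negP => /negP Dl0.
  have dDl : differentiable (fun tau => Dl tau 0 l : C) 0.
    have at0 (c : 'rV[C]_(1 + s)) : nrm (p + c - p) < e' -> nrm (p + c - n) < rho /\ phi (p + c) != 0.
      by move=> /e'all[h1 _ h3 _ _]; split; [exact: He3|exact: He1].
    have sd : differentiable (fun tau => t *: dt tau) 0 by exact: differentiableZ.
    apply: differentiable_entry; apply: differentiableB; apply: differentiableB; try exact: differentiable_cst.
      apply: (@differentiable_comp _ _ _ _ (fun tau => p + t *: d' + t *: dt tau) gh).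
        by apply: differentiableD.
      rewrite dt0 -addrA; have [|h1 h2] := at0 (t *: d' + t *: d'); last exact: differentiable_ghat.
      by rewrite addrA; apply: sum2; exact: tiny.
    apply: (@differentiable_comp _ _ _ _ (fun tau => p + t *: dt tau) gh).
      by apply: differentiableD.
    rewrite dt0; have [|h1 h2] := at0 (t *: d'); last exact: differentiable_ghat.
    by apply: half; exact: tiny.
  have nDl : \forall tau \near (0 : C), Dl tau 0 l != 0 by exact: (@near_neq0 R _ (fun tau => Dl tau 0 l : C) 0 dDl Dl0).
  have mz : \forall tau \near (0 : C), minor2 (g d') (g (dt tau)) i0 j0 = 0.
    apply: filterS2 Dlm nDl => tau [h1 h2] h3; apply/eqP/negP => /negP m.
    by have := parallel_two h1 h2 m => h; move: h3; rewrite h mxE eqxx.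
  have : minor2 (g d') (g (dt 1)) i0 j0 = 0.
    apply: (@disc_unique R (fun tau => minor2 (g d') (g (dt tau)) i0 j0)) => [tau t3|]; last exact: mz.
    apply: differentiable_minor2; first exact: (differentiable_cst (g d') tau).
    apply: (@differentiable_comp _ _ _ _ dt g); first exact: dtd.
    apply: (lm_diff lm).
    have -> : dt tau - n = (1 - tau) *: (d' - n) by apply/rowP => c; rewrite !mxE; ring.
    have d'8 : nrm (d' - n) < rho / 8 by apply: He4; have [] := e'all _ d'e.
    rewrite nrmZ; have := ler_normcB 1 tau; rewrite (normc_real 1) normr1 => h1.
    by have := nrm_ge0 (d' - n); nra.
  rewrite /dt scale1r addrC subrK => h; have [_ d'2 _ _ _] := e'all _ d'e.
  by have := He2 _ d'2; rewrite h eqxx.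
have tE : p + t *: d' + t *: d' = p + (2 * t) *: d' by rewrite -addrA -scalerDl mulr_natl mulr2n.
move: Dl0; rewrite /Dl dt0 tE => /eqP; rewrite subr_eq0 => /eqP h.
have -> : gh (p + (2 * t) *: d') = gh (p + t *: d') - gh p + gh (p + t *: d') by rewrite -h subrK.
by rewrite addrAC subrK mulr2n.
Qed.

End Affine.

Section Linear.
Variable R : realType.
Notation C := R[i].
Local Notation normc := (@ComplexField.Normc.normc R).
Local Notation real_complex := (real_complex R).

Lemma cdiff_line_entry a b (f : 'rV[C]_a -> 'rV[C]_b) p v l : differentiable f p ->
  cdiff (fun t => f (p + t *: v) 0 l) 0 ((v *m jacobian f p) 0 l).
Proof.
move=> fd; apply/cdiff_is_derive.
have lim : t^-1 *: ((f \o shift p) (t *: v) - f p) @[t --> 0^'] --> 'D_v f p.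
  exact: (@diff_derivable _ _ _ f p v fd).
rewrite deriveEjacobian // in lim.
have liml : (t^-1 *: ((f \o shift p) (t *: v) - f p)) 0 l @[t --> 0^'] --> (v *m jacobian f p) 0 l.
  have cc : {for v *m jacobian f p, continuous (fun N : 'rV[C]_b => N 0 l : C)}.
    exact: coord_continuous.
  by move=> A /cc nA; exact: (lim _ nA).
have E : (fun t : C => t^-1 *: (((fun t => f (p + t *: v) 0 l : C) \o shift 0) (t *: (1 : C)) - f (p + 0 *: v) 0 l)) =
    (fun t => (t^-1 *: ((f \o shift p) (t *: v) - f p)) 0 l).
  apply/funext => t /=; rewrite scale0r addr0 addr0 !mxE /GRing.scale /= mulr1.
  by rewrite [p + _]addrC.
by rewrite -E in liml; apply: DeriveDef; [apply/cvg_ex; eexists; exact: liml|exact: cvg_lim liml].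
Qed.

Lemma entry_line m (u v : 'rV[C]_m) t l : (u + t *: v) 0 l = u 0 l + t * v 0 l.
Proof. by rewrite !mxE. Qed.

Lemma scale_comb m (a b c : 'rV[C]_m) x : x != 0 ->
  x *: (a + (x^-1 *: b - c)) = x *: (a - c) + b.
Proof. by move=> x0; apply/rowP => l; rewrite !mxE; field. Qed.

Lemma entry_double m (u v w : 'rV[C]_m) l : u + v = w *+ 2 -> u 0 l = 2 * w 0 l - v 0 l.
Proof.
move=> /(congr1 (fun M : 'rV_m => M 0 l)); rewrite mulr2n !mxE => h.
by rewrite mulr_natl mulr2n -h addrK.
Qed.

Variables (s k : nat) (g : 'rV[C]_(1 + s) -> 'rV[C]_(1 + k)) (n : 'rV[C]_(1 + s)) (rho : R).
Hypothesis lm : local_model g n rho.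
Let phi z : C := hform 1 k (g z) (g n).
Let gh := ghat g n.

(** After subtracting the first-order part of [gh] at [p], the vanishing second difference becomes
    the doubling relation of [doubling_zero]. *)
Lemma ghat_affine (p d : 'rV[C]_(1 + s)) (e : R) : differentiable gh p ->
  (forall d' (t : C), nrm (d' - d) < e -> normc t < e -> hform 1 s d' n = 0 ->
    gh (p + (2 * t) *: d') + gh p = gh (p + t *: d') *+ 2) ->
  forall d' (t : C), nrm (d' - d) < e -> normc t < e -> hform 1 s d' n = 0 ->
    gh (p + t *: d') = gh p + t *: (d' *m jacobian gh p).
Proof.
move=> ghd sd d' t d'd te d'n; apply/rowP => l.
pose psi t := gh (p + t *: d') 0 l - gh p 0 l - t * (d' *m jacobian gh p) 0 l.
have psi0 : psi 0 = 0 by rewrite /psi scale0r addr0 subrr mul0r subrr.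
have : psi t = 0.
  apply: (doubling_zero _ psi0 _ te) => [|u ue].
    rewrite -[0 in X in cdiff _ _ X](subrr ((d' *m jacobian gh p) 0 l)); apply: cdiffB.
      rewrite -[X in cdiff _ _ X]subr0; apply: cdiffB; first exact: cdiff_line_entry.
      by apply/cdiff_is_derive; exact: is_derive_cst.
    move=> e0 e00; exists 1 => // w _; rewrite subr0 mul0r subr0 mulrC subrr normc_0.
    by rewrite mulr_ge0 ?normc_ge0 // ltW.
  by rewrite /psi (entry_double l (sd d' u d'd ue d'n)); ring.
rewrite /psi => /eqP; rewrite subr_eq0 subr_eq => /eqP ->.
by rewrite entry_line addrC.
Qed.

Lemma ghat_homo z (l : C) : l != 0 -> nrm (z - n) < rho -> nrm (l *: z - n) < rho ->
  phi z != 0 -> gh (l *: z) = l *: gh z.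
Proof.
move=> l0 zr lzr pz; have [c c0 cE] := lm_homo lm zr lzr l0.
rewrite /gh /ghat cE !hformZl !scalerA; congr (_ *: _).
by field; rewrite c0 pz.
Qed.

(** The points [p + t d'] with [d'] orthogonal to [n] lie in the affine hyperplane
    [<z, n> = <p, n>], which misses 0; there [gh] is affine near [z0]. Homogeneity extends it to a
    linear map on an open set. *)
Lemma ghat_local_linear (p d : 'rV[C]_(1 + s)) (e : R) : 0 < e -> nrm (p - n) < rho / 8 ->
  hform 1 s d n = 0 -> phi p != 0 ->
  (forall d' (t : C), nrm (d' - d) < e -> normc t < e -> hform 1 s d' n = 0 ->
    gh (p + t *: d') = gh p + t *: (d' *m jacobian gh p)) ->
  exists (z0 : 'rV[C]_(1 + s)) (L : 'M[C]_(1 + s, 1 + k)), nrm (z0 - n) < rho / 8 /\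
    \forall z \near z0, phi z != 0 /\ gh z = z *m L.
Proof.
move=> e0 pn dn pp aff; have r0 := lm_rho lm.
have pr : nrm (p - n) < rho by lra.
have pn0 : hform 1 s p n != 0.
  by apply: contra pp => /eqP h; rewrite /phi (lm_orth lm pr (lm_center lm) h).
have /nearP[e1 e10 He1] : \forall z \near p, phi z != 0.
  exact: (@near_neq0 R _ phi p (lm_phi_diff lm pr) pp).
have /nearP[e2 e20 He2] : \forall z \near p, nrm (z - n) < rho / 8 by exact: near_ball.
pose e3 := Num.min e (Num.min e1 e2).
have e30 : 0 < e3 by rewrite !lt_min e0 e10.
have d1 : 0 < nrm d + 1 by rewrite ltr_wpDl // nrm_ge0.
pose t := Num.min (e / 2) (e3 / 2 / (nrm d + 1)).
have t0 : 0 < t by rewrite lt_min !divr_gt0.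
have te : t < e.
  have h : t <= e / 2 by rewrite ge_min lexx.
  by lra.
have td : t * nrm d < e3.
  have h : t * (nrm d + 1) <= e3 / 2 by rewrite -ler_pdivlMr // ge_min lexx orbT.
  by nra.
pose tC := real_complex t.
have tC0 : tC != 0 by rewrite eq_complex /= eqxx andbT gt_eqF.
have tCn : normc tC = t by rewrite normc_real gtr0_norm.
pose z0 := p + tC *: d.
have z0p : nrm (z0 - p) < e3 by rewrite /z0 addrAC subrr add0r nrmZ tCn.
have [z0e z01 z02] : [/\ nrm (z0 - p) < e, nrm (z0 - p) < e1 & nrm (z0 - p) < e2].
  by move: z0p; rewrite !lt_min => /and3P[].
(* Dividing by [lam z] brings [z] into that hyperplane, and [dir z] is the direction with
   [z / lam z = p + tC dir z]. *)
pose lam z := hform 1 s z n / hform 1 s p n.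
pose dir z := tC^-1 *: ((lam z)^-1 *: z - p).
have z0n : hform 1 s z0 n = hform 1 s p n by rewrite hformDl hformZl dn mulr0 addr0.
have lam0 : lam z0 = 1 by rewrite /lam z0n divff.
have dir0 : dir z0 = d.
  by rewrite /dir lam0 invr1 scale1r /z0 addrAC subrr add0r scalerA mulVf // scale1r.
have lamd z : differentiable lam z.
  by apply: differentiableM => //; apply: (@differentiable_hform R _ _ _ _ id).
have invlam : differentiable (fun z => (lam z)^-1) z0.
  by apply: differentiableV => //; rewrite lam0 oner_neq0.
have scd : differentiable (fun z => (lam z)^-1 *: z) z0 by apply: differentiable_scaler.
have dird : differentiable dir z0.
  by apply: differentiableZ; apply: differentiableB.
have N1 : \forall z \near z0, nrm (dir z - d) < e.
  apply: (@near_comp R _ _ dir z0 (fun w => nrm (w - d) < e) (differentiable_continuous dird)).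
  by apply: near_ball; rewrite dir0 subrr nrm0.
have N2 : \forall z \near z0, lam z != 0.
  by apply: (@near_neq0 R _ lam z0 (lamd z0)); rewrite lam0 oner_neq0.
have N3 : \forall z \near z0, nrm ((lam z)^-1 *: z - p) < e3.
  apply: (@near_comp R _ _ (fun z => (lam z)^-1 *: z) z0 (fun w => nrm (w - p) < e3) (differentiable_continuous scd)).
  by apply: near_ball; rewrite lam0 invr1 scale1r.
have N4 : \forall z \near z0, nrm (z - n) < rho.
  by apply: near_ball; have := He2 _ z02; lra.
have N5 : \forall z \near z0, nrm (z - p) < e1 by exact: near_ball.
pose J := jacobian gh p.
pose col : 'cV[C]_(1 + s) := \col_j lam (delta_mx 0 j).
have colE z : z *m col = (lam z)%:M.
  apply/matrixP => a b; rewrite !ord1 !mxE eqxx mulr1n.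
  have -> : lam z = \sum_j z 0 j * lam (delta_mx 0 j).
    rewrite {1}(row_sum_delta z) /lam.
    elim/big_ind2 : _ => [|x1 x2 y1 y2 E1 E2|j _]; first by rewrite hform0l mul0r.
      by rewrite hformDl mulrDl E1 E2.
    by rewrite hformZl mulrA.
  by apply: eq_bigr => j _; rewrite mxE.
(* The affine formula at [z / lam z], multiplied by [lam z]; the matrix [col] represents the linear
   form [lam]. *)
exists z0, (col *m (gh p - p *m J) + J); split; first exact: He2.
apply: filterS2 (filterI N1 N2) (filterI N3 (filterI N4 N5)) => z [k1 k2] [k3 [k4 k5]].
split; first exact: He1.
have [k3e k31 k32] : [/\ nrm ((lam z)^-1 *: z - p) < e, nrm ((lam z)^-1 *: z - p) < e1 & nrm ((lam z)^-1 *: z - p) < e2].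
  by move: k3; rewrite !lt_min => /and3P[].
have dirn : hform 1 s (dir z) n = 0.
  have zn0 : hform 1 s z n != 0 by move: k2; rewrite /lam mulf_eq0 negb_or => /andP[].
  rewrite /dir hformZl hformBl hformZl /lam.
  have -> : (hform 1 s z n / hform 1 s p n)^-1 * hform 1 s z n = hform 1 s p n by field; rewrite zn0 pn0.
  by rewrite subrr mulr0.
have zE : p + tC *: dir z = (lam z)^-1 *: z.
  by rewrite /dir scalerA divff // scale1r addrC subrK.
have := aff (dir z) tC k1 _ dirn; rewrite tCn => /(_ te); rewrite zE => h.
have zE' : z = lam z *: ((lam z)^-1 *: z) by rewrite scalerA divff // scale1r.
have z'r : nrm ((lam z)^-1 *: z - n) < rho.
  by apply: (lt_trans (He2 _ k32)); rewrite ltr_pdivrMr ?(lm_rho lm) // ltr_pMr ?(lm_rho lm) // ltr1n.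
rewrite {1}zE' ghat_homo //; last 2 first.
- by rewrite -zE'.
- exact: He1.
rewrite h mulmxDr mulmxA colE mul_scalar_mx -/J.
have -> : tC *: (dir z *m J) = ((lam z)^-1 *: z - p) *m J.
  rewrite scalemxAl; congr (_ *m J).
  by rewrite /dir scalerA divff // scale1r.
by rewrite mulmxBl -scalemxAl; exact: scale_comb.
Qed.

End Linear.

(** * The linear map is a multiple of an isometry *)

Section LocalIsometry.
Variable R : realType.
Notation C := R[i].
Local Notation normc := (@ComplexField.Normc.normc R).
Local Notation real_complex := (real_complex R).

Variables (s k : nat).

Lemma half_step_bound (a b t e : R) : 0 < t -> b < e -> t * (a + 1) = (e - b) / 2 -> 0 <= a ->
  b + t * a < e.
Proof. by move=> *; nra. Qed.

Lemma differentiable_hforml (m : nat) (w z : 'rV[C]_(1 + m)) :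
  differentiable (fun z : 'rV[C]_(1 + m) => hform 1 m z w : C) z.
Proof. exact: (@differentiable_hform R _ _ _ _ id). Qed.

(* With [kp] chosen so that the difference [D] of the two forms vanishes at
   [(w1, w1)], one gets [D _ w1 = 0] first, then [D _ w = 0] for [w] near [w1]. *)
Lemma hform_proportional (L : 'M[C]_(1 + s, 1 + k)) (w1 : 'rV[C]_(1 + s)) :
  (\forall w \near w1, complex.Re (hform 1 s w w) < 0 /\
     forall v, hform 1 s v w = 0 -> hform 1 k (v *m L) (w *m L) = 0) ->
  exists kp : R, forall v w, hform 1 k (v *m L) (w *m L) = real_complex kp * hform 1 s v w.
Proof.
move=> /nearP[r r0 H].
pose B v w := hform 1 k (v *m L) (w *m L).
have BC v w : (B v w)^* = B w v by exact: hformC.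
have [n1 o1] : complex.Re (hform 1 s w1 w1) < 0 /\ forall v, hform 1 s v w1 = 0 -> B v w1 = 0.
  by apply: H; rewrite subrr nrm0.
pose kp := complex.Re (B w1 w1) / complex.Re (hform 1 s w1 w1).
have ne (w : 'rV[C]_(1 + s)) : complex.Re (hform 1 s w w) < 0 -> hform 1 s w w != 0.
  by apply: contraTneq => ->; rewrite ltxx.
pose D v w := B v w - real_complex kp * hform 1 s v w.
have Dadd u v w : D u (v + w) = D u v + D u w.
  by rewrite /D /B mulmxDl !hformDr mulrDr opprD addrACA.
have DZr u v x : D u (x *: v) = x^* * D u v.
  by rewrite /D /B -scalemxAl !hformZr mulrBr mulrCA.
have DZl u v x : D (x *: u) v = x * D u v.
  by rewrite /D /B -scalemxAl !hformZl mulrBr mulrCA.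
have DBl u v w : D (u - v) w = D u w - D v w.
  by rewrite /D /B mulmxBl !hformBl mulrBr !opprB addrACA [- _ + _]addrC; ring.
have DC v w : (D v w)^* = D w v.
  by rewrite /D rmorphB rmorphM /= BC hformC [Num.conj (real_complex _)]conjc_real.
have Dperp w v : complex.Re (hform 1 s w w) < 0 ->
    (forall v, hform 1 s v w = 0 -> B v w = 0) -> D v w = (hform 1 s v w / hform 1 s w w) * D w w.
  move=> nw ow; rewrite -DZl; apply/eqP; rewrite -subr_eq0 -DBl /D.
  have h : hform 1 s (v - hform 1 s v w / hform 1 s w w *: w) w = 0.
    by rewrite hformBl hformZl divfK ?ne // subrr.
  by rewrite ow // h mulr0 subr0.
have D11 : D w1 w1 = 0.
  rewrite /D hform_real /B hform_real -/(B w1 w1) -rmorphM -rmorphB /kp divfK ?subrr //.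
  by rewrite lt_eqF.
have Dv1 v : D v w1 = 0 by rewrite Dperp // D11 mulr0.
have D0 v u : D v u = 0.
  have nz : \forall w \near w1, hform 1 s w w1 != 0.
    apply: (@near_neq0 R _ (fun w => hform 1 s w w1) w1 _ (ne _ n1)).
    exact: differentiable_hforml.
  move: nz => /nearP[r' r'0 H'].
  pose m := Num.min r r'; have m0 : 0 < m by rewrite lt_min r0.
  have u1 : 0 < nrm u + 1 by rewrite ltr_wpDl // nrm_ge0.
  pose t := m / (nrm u + 1) / 2; have t0 : 0 < t by rewrite !divr_gt0.
  have tu : nrm (w1 + real_complex t *: u - w1) < m.
    rewrite addrAC subrr add0r nrmZ normc_real gtr0_norm //.
    have h : t * (nrm u + 1) = m / 2 by rewrite /t; field; rewrite gt_eqF.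
    by have := nrm_ge0 u; nra.
  move: tu; rewrite lt_min => /andP[/H[nw ow] /H' w1w].
  set w := w1 + _ in nw ow w1w.
  have Dw1 : D w1 w = 0 by rewrite -DC Dv1 conjC0.
  have Dww : D w w = 0.
    have := Dperp _ w1 nw ow; rewrite Dw1 => /esym/eqP; rewrite mulf_eq0 => /orP[|/eqP //].
    rewrite mulf_eq0 invr_eq0 (negbTE (ne _ nw)) orbF -hformC conjC_eq0 => h.
    by move: w1w; rewrite h.
  have : D v w = 0 by rewrite Dperp // Dww mulr0.
  rewrite /w Dadd Dv1 add0r DZr => /eqP; rewrite mulf_eq0 conjC_eq0.
  by rewrite eq_complex /= eqxx andbT gt_eqF //= => /eqP.
by exists kp => v w; apply/eqP; rewrite -subr_eq0; apply/eqP; exact: D0.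
Qed.

(** The source has dimension at least 3, so some [w != 0] satisfies the two linear conditions that
    [w] and [w *m L] have zero 0-coordinate. Then [<w, w>] is negative while the form at [w *m L] is
    at most 0. *)
Lemma proportional_pos (L : 'M[C]_(1 + s, 1 + k)) (kp : R) : (1 < s)%N ->
  (forall v w, hform 1 k (v *m L) (w *m L) = real_complex kp * hform 1 s v w) -> 0 <= kp.
Proof.
move=> s1 LE.
pose M : 'M[C]_(1 + s, 1 + 1) := row_mx (delta_mx 0 0) (col 0 L).
have : kermx M != 0.
  rewrite -mxrank_eq0 -lt0n mxrank_ker subn_gt0; apply: leq_ltn_trans (rank_leq_col M) _.
  by rewrite add1n ltnS.
case/rowV0Pn => w /sub_kermxP; rewrite /M mul_mx_row => /eqP.
rewrite row_mx_eq0 => /andP[/eqP w0 /eqP wL] wn.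
have w00 : w 0 0 = 0.
  have := congr1 (fun x : 'M[C]_1 => x 0 0) w0; rewrite mxE [RHS]mxE.
  rewrite (bigD1 0) //= mxE !eqxx mulr1 big1 ?addr0 // => i i0.
  by rewrite mxE (negbTE i0) mulr0.
have wL00 : (w *m L) 0 0 = 0.
  have := congr1 (fun x : 'M[C]_1 => x 0 0) wL; rewrite mxE [RHS]mxE => h.
  by rewrite mxE -[RHS]h; apply: eq_bigr => j _; rewrite mxE.
have neg (m : nat) (x : 'rV[C]_(1 + m)) : x 0 0 = 0 -> complex.Re (hform 1 m x x) <= 0.
  move=> x0; rewrite hformE x0 mul0r sub0r raddfN /= oppr_le0.
  by have := dotc_ge0 (rsubmx x); rewrite lecE => /andP[].
rewrite leNgt; apply/negP => kp0.
have h1 := neg _ _ wL00; rewrite LE Re_realM nmulr_rle0 // in h1.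
have h2 := neg _ _ w00.
have : hform 1 s w w = 0 by rewrite hform_real; congr real_complex; apply/eqP; rewrite eq_le h2.
by move=> /hform_null_eq0 /(_ w00) => w0'; rewrite w0' eqxx in wn.
Qed.

Variables (g : 'rV[C]_(1 + s) -> 'rV[C]_(1 + k)) (n : 'rV[C]_(1 + s)) (rho : R).
Hypothesis lm : local_model g n rho.
Let phi z : C := hform 1 k (g z) (g n).
Hypothesis phi0 : ~ (\forall z \near n, phi z = 0).

Lemma local_isometry : exists L : 'M[C]_(1 + s, 1 + k), lin_isometry 1 s 1 k L /\
  forall z, nrm (z - n) < rho / 8 -> forall i j, minor2 (g z) (z *m L) i j = 0.
Proof.
have r0 := lm_rho lm.
have [p [d [eta [[eta0 par] [pn dn8] [pd dn] dd [pphi gd0]]]]] := ghat_parallel lm phi0.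
have pr : nrm (p - n) < rho by lra.
have dr : nrm (d - n) < rho by lra.
have [e e0 sd] := second_difference lm eta0 par pn dn8 pd pphi gd0.
have ghd := differentiable_ghat lm pr pphi.
have aff := ghat_affine ghd sd.
have [z0 [L [z0r zL]]] := ghat_local_linear lm e0 pn dn pphi aff.
have r8 z : nrm (z - n) < rho / 8 -> nrm (z - n) < rho by move=> ?; lra.
have G1 z : nrm (z - n) < rho / 8 -> phi z *: (z *m L) = hform 1 s z n *: g z.
  move=> zr; apply/rowP => l; apply/eqP; rewrite [X in X == _]mxE [X in _ == X]mxE -subr_eq0; apply/eqP.
  apply: (@ball_unique R _ (fun z => phi z * (z *m L) 0 l - hform 1 s z n * g z 0 l) n z0 z rho _ z0r zr).
    move=> y yr; apply: differentiableB; apply: differentiableM.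
    + by apply: (@differentiable_hform R _ _ _ _ g); exact: (lm_diff lm).
    + by apply: differentiable_entry; exact: differentiable_mulmxr.
    + exact: differentiable_hforml.
    + by apply: differentiable_entry; exact: (lm_diff lm).
  apply: filterS zL => y [py yE]; rewrite -yE /ghat mxE -/(phi y).
  by rewrite mulrA mulrCA divff // mulr1 subrr.
pose B v w := hform 1 k (v *m L) (w *m L).
have B0 z w : nrm (z - n) < rho / 8 -> nrm (w - n) < rho / 8 -> phi z != 0 -> phi w != 0 ->
    hform 1 s z w = 0 -> B z w = 0.
  move=> zr wr pz pw zw.
  have : phi z * (phi w)^* * B z w = 0.
    rewrite -mulrA mulrC -mulrA /B.
    have -> : (phi w)^* * (hform 1 k (z *m L) (w *m L) * phi z) = hform 1 k (phi z *: (z *m L)) (phi w *: (w *m L)).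
      by rewrite hformZl hformZr; ring.
    by rewrite !G1 // hformZl hformZr (lm_orth lm (r8 _ zr) (r8 _ wr) zw) !mulr0.
  by move/eqP; rewrite !mulf_eq0 conjC_eq0 (negbTE pz) (negbTE pw) => /eqP.
have /nearP[e1 e10 He1] : \forall z \near p, phi z != 0.
  exact: (@near_neq0 R _ phi p (lm_phi_diff lm pr) pphi).
have /nearP[e2 e20 He2] : \forall z \near p, nrm (z - n) < rho / 8 by exact: near_ball.
pose e3 := Num.min e1 e2; have e30 : 0 < e3 by rewrite lt_min e10.
have He3 z : nrm (z - p) < e3 -> phi z != 0 /\ nrm (z - n) < rho / 8.
  by rewrite lt_min => /andP[/He1 ? /He2 ?].
have dd0 : hform 1 s d d != 0 by apply: contraTneq dd => ->; rewrite ltxx.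
(* Orthogonality is known only for points near [n], but every [v] orthogonal to [w] is needed. Such
   a [v] is, up to a factor, the difference of [pj w + t v] and [pj w], both near [p] and orthogonal
   to [w]. *)
pose pj (w : 'rV[C]_(1 + s)) := p - (hform 1 s p w / hform 1 s w w) *: w.
have pjc : pj w @[w --> d] --> p.
  rewrite -[X in _ --> X]subr0 -(scale0r d) -(mul0r (hform 1 s d d)^-1) -pd.
  have cp : (fun _ : 'rV[C]_(1 + s) => p) @ nbhs d --> p by apply: (@cvg_cst _ _ _ _ (nbhs_filter d)).
  have cd : w @[w --> d] --> d by move=> ?.
  exact: (cvgB cp (cvgZ (cvgCM (cvg_hform cp cd) (cvgCV dd0 (cvg_hform cd cd))) cd)).
have N1 : \forall w \near d, nrm (pj w - p) < e3.
  have np : \forall z \near p, nrm (z - p) < e3 by apply: near_ball; rewrite subrr nrm0.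
  exact: (pjc _ np).
have N2 := near_hform_neg dd.
have N3 : \forall w \near d, nrm (w - n) < rho / 8 by exact: near_ball.
have /nearP[e4 e40 He4] : \forall w \near d, [/\ nrm (pj w - p) < e3, complex.Re (hform 1 s w w) < 0 & nrm (w - n) < rho / 8].
  by apply: filterS3 N1 N2 N3 => w ? ? ?; split.
(* [d] itself does not qualify: it is orthogonal to [n], so [phi d = 0]. *)
have [w1 w1d pw1] : exists2 w1, nrm (w1 - d) < e4 & phi w1 != 0.
  apply/not_exists2P => H; apply: (lm_phi_near lm phi0 dn8); apply/nearP; exists e4 => // w wd.
  by have [] := H w; [|move/negP; rewrite negbK => /eqP].
have w1r : nrm (w1 - n) < rho by have [_ _] := He4 _ w1d; exact: r8.
have N4 : \forall w \near w1, phi w != 0.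
  exact: (@near_neq0 R _ phi w1 (lm_phi_diff lm w1r) pw1).
have [kp BE] : exists kp : R, forall v w, B v w = real_complex kp * hform 1 s v w.
  apply: (@hform_proportional L w1); apply: filterS2 (near_ball w1d) N4 => w /He4[w_pj ww wn] pw.
  split=> // v vw.
  have ww0 : hform 1 s w w != 0 by apply: contraTneq ww => ->; rewrite ltxx.
  have pjw : hform 1 s (pj w) w = 0 by rewrite hformBl hformZl divfK // subrr.
  have v1 : 0 < nrm v + 1 by rewrite ltr_wpDl // nrm_ge0.
  pose t := (e3 - nrm (pj w - p)) / 2 / (nrm v + 1).
  have t0 : 0 < t by rewrite !divr_gt0 // subr_gt0.
  have tv : nrm (pj w + real_complex t *: v - p) < e3.
    rewrite addrAC; apply: (le_lt_trans (nrmD _ _)); rewrite nrmZ normc_real gtr0_norm //.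
    have h : t * (nrm v + 1) = (e3 - nrm (pj w - p)) / 2 by rewrite /t divfK // gt_eqF.
    exact: half_step_bound t0 w_pj h (nrm_ge0 v).
  have [ph1 r1] := He3 _ w_pj; have [ph2 r2] := He3 _ tv.
  have b1 := B0 _ _ r1 wn ph1 pw pjw.
  have b2 : B (pj w + real_complex t *: v) w = 0.
    by apply: B0 => //; rewrite hformDl hformZl pjw vw mulr0 addr0.
  move: b2; rewrite /B mulmxDl hformDl -scalemxAl hformZl -/(B (pj w) w) b1 add0r => /eqP.
  by rewrite mulf_eq0 eq_complex /= eqxx andbT gt_eqF //= => /eqP.
have kp_ge0 : 0 <= kp by apply: (proportional_pos (lm_s2 lm phi0) BE).
(* With [kp = 0] the images of points near [p] are orthogonal to [g p]; by continuation so is [g n],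
   against [phi p != 0]. *)
have kp_neq0 : kp != 0.
  apply/eqP => kp0.
  have gg z : nrm (z - p) < e3 -> hform 1 k (g z) (g p) = 0.
    move=> zp; have [pz zr] := He3 _ zp.
    have nz w : nrm (w - n) < rho / 8 -> phi w != 0 -> hform 1 s w n != 0.
      by move=> wr; apply: contra => /eqP h; rewrite /phi (lm_orth lm (r8 _ wr) (lm_center lm) h).
    have : hform 1 k (hform 1 s z n *: g z) (hform 1 s p n *: g p) = 0.
      by rewrite -!G1 // hformZl hformZr -/(B z p) BE kp0 mul0r !mulr0.
    rewrite hformZl hformZr => /eqP; rewrite !mulf_eq0 conjC_eq0 (negbTE (nz _ zr pz)).
    by rewrite (negbTE (nz _ pn pphi)) => /eqP.
  have : hform 1 k (g n) (g p) = 0.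
    apply: (@ball_unique R _ (fun z => hform 1 k (g z) (g p)) n p n rho _ pn).
    + by move=> z zr; apply: differentiable_hform; exact: (lm_diff lm).
    + by rewrite subrr nrm0 divr_gt0.
    + by apply/nearP; exists e3.
  by move/hform_sym => h; move: pphi; rewrite /phi h eqxx.
have kp0 : 0 < kp by rewrite lt_neqAle eq_sym kp_neq0.
pose c := real_complex (Num.sqrt kp)^-1.
have cc : c * c^* * real_complex kp = 1.
  rewrite mul_conj_normc normc_real -rmorphM /= real_normK ?num_real // exprVn sqr_sqrtr //.
  by rewrite mulVf.
exists (c *: L); split.
  move=> v w; rewrite -!scalemxAr hformZl hformZr -/(B v w) BE !mulrA cc mul1r //.
move=> z zr i j; apply: (@ball_unique R _ (fun z => minor2 (g z) (z *m (c *: L)) i j) n p z rho _ pn zr).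
  move=> y yr; apply: differentiableB; apply: differentiableM;
    apply: differentiable_entry; solve [exact: (lm_diff lm) | exact: differentiable_mulmxr].
apply/nearP; exists e3 => // y yp; have [py yr] := He3 _ yp.
have h := G1 _ yr.
have -> : y *m (c *: L) = (c * (hform 1 s y n / phi y)) *: g y.
  rewrite -scalemxAr -!scalerA; congr (_ *: _).
  by rewrite scalerA mulrC -scalerA -h scalerA mulVf // scale1r.
by rewrite /minor2 !mxE; ring.
Qed.

End LocalIsometry.

(** * From local to global *)

Section LocalDichotomy.
Variable R : realType.
Notation C := R[i].

(** The combination of [u] and [v] that kills the 0-coordinate is null and lies where the form is
    definite, so it is 0. *)
Lemma null_parallel k (u v : 'rV[C]_(1 + k)) : hform 1 k u u = 0 -> hform 1 k v v = 0 ->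
  hform 1 k u v = 0 -> forall i j, minor2 u v i j = 0.
Proof.
move=> uu vv uv i j; have vu := hform_sym uv.
have [v0|v0] := eqVneq (v 0 0) 0.
  by rewrite (hform_null_eq0 vv v0) /minor2 !mxE !mulr0 subrr.
have w0 : v 0 0 *: u - u 0 0 *: v = 0.
  apply: hform_null_eq0; last by rewrite !mxE mulrC subrr.
  by rewrite !hformBl !hformBr !hformZl !hformZr uu vv uv vu !mulr0 !subrr.
have h l : v 0 0 * u 0 l = u 0 0 * v 0 l.
  by apply/eqP; rewrite -subr_eq0; have := congr1 (fun x : 'rV[C]_(1 + k) => x 0 l) w0; rewrite !mxE => ->.
apply: (mulfI v0); rewrite mulr0 /minor2 mulrBr !mulrA !h.
by rewrite mulrAC subrr.
Qed.

Variables (s k : nat).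

Lemma local_model_sub (g : 'rV[C]_(1 + s) -> 'rV[C]_(1 + k)) n rho n' rho' :
  local_model g n rho -> hform 1 s n' n' = 0 -> n' 0 0 != 0 -> 0 < rho' ->
  nrm (n' - n) + rho' <= rho -> local_model g n' rho'.
Proof.
move=> lm n'n n'0 r0 rr.
have sub (z : 'rV[C]_(1 + s)) : nrm (z - n') < rho' -> nrm (z - n) < rho.
  move=> zr; apply: (@le_lt_trans _ _ (nrm (z - n') + nrm (n' - n))); first exact: nrm_triangle.
  apply: lt_le_trans rr.
  by rewrite addrC ltrD2l.
split=> //; first exact: lm_dim lm.
- by move=> z /sub; exact: (lm_diff lm).
- by move=> z w /sub zr /sub wr; exact: (lm_orth lm).
- by move=> z l /sub zr /sub wr; exact: (lm_homo lm).
Qed.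

Lemma local_dichotomy (g : 'rV[C]_(1 + s) -> 'rV[C]_(1 + k)) n rho : local_model g n rho ->
  (exists2 e, 0 < e & forall z w : 'rV[C]_(1 + s), nrm (z - n) < e -> nrm (w - n) < e -> hform 1 k (g z) (g w) = 0) \/
  exists (L : 'M[C]_(1 + s, 1 + k)) (a : 'rV[C]_(1 + s)), [/\ lin_isometry 1 s 1 k L,
    nrm (a - n) < rho & \forall z \near a, forall i j, minor2 (g z) (z *m L) i j = 0].
Proof.
move=> lm; have r0 := lm_rho lm.
have n0 : 0 < nrm n.
  rewrite lt_neqAle eq_sym nrm_ge0 andbT nrm_eq0.
  by apply: contraNneq (lm_n0 lm) => ->; rewrite mxE.
(* Closeness relative to [nrm n] excludes 0, so null vectors within [e] of [n] have a nonzero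
   0-coordinate. *)
pose e := Num.min rho (nrm n) / 8.
have e0 : 0 < e by rewrite divr_gt0 // lt_min r0.
have er : e * 8 <= rho by rewrite divfK // ge_min lexx.
have en : e * 8 <= nrm n by rewrite divfK // ge_min lexx orbT.
clearbody e.
have null0 (w : 'rV[C]_(1 + s)) : nrm (w - n) < e -> hform 1 s w w = 0 -> w 0 0 != 0.
  move=> we ww; apply/eqP => /(hform_null_eq0 ww) w0.
  by move: we; rewrite w0 sub0r nrmN; lra.
have [H|] := pselect (forall w : 'rV[C]_(1 + s), nrm (w - n) < e -> hform 1 s w w = 0 ->
    \forall z \near w, hform 1 k (g z) (g w) = 0); last first.
  move=> /existsNP[w] /not_implyP[we] /not_implyP[ww wg]; right.
  have h : nrm (w - n) + e <= rho by lra.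
  have [L [Li LE]] := local_isometry (local_model_sub lm ww (null0 _ we ww) e0 h) wg.
  exists L, w; split=> //; first by lra.
  apply/nearP; exists (e / 8) => //; exact: divr_gt0.
left; exists (e / 8) => [|z w zr wr]; first exact: divr_gt0.
have gd y : nrm (y - n) < e * 8 -> differentiable g y by move=> ye; apply: (lm_diff lm); lra.
(* The form is antilinear in its second argument, so the roles are exchanged to make the varying
   point holomorphic; it then runs over the null cone first. *)
apply: hform_sym.
apply: (@null_zero R s n e (fun y => hform 1 k (g y) (g z)) e0 (lm_null lm) (lm_n0 lm) _ _ w wr).
  by move=> y ye; apply: (@differentiable_hform R _ _ _ _ g); apply: gd; lra.
move=> y ye yy; apply: hform_sym.
apply: (@ball_unique R _ (fun x => hform 1 k (g x) (g y)) n y z (e * 8)).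
- by move=> x xe; apply: (@differentiable_hform R _ _ _ _ g); exact: gd.
- by rewrite mulfK.
- by rewrite mulfK //; lra.
- exact: H.
Qed.

End LocalDichotomy.

(** * Propagation over the connected domain *)

Section IdentityPrinciple.
Variable R : realType.
Notation C := R[i].

Lemma differentiable_lsubmx (V : normedModType C) (p q : nat) (g : V -> 'rV[C]_(p + q)) x :
  differentiable g x -> differentiable (fun x => lsubmx (g x)) x.
Proof.
have -> : (fun x => lsubmx (g x)) = mulmx^~ (col_mx 1%:M 0) \o g.
  by apply/funext => y; rewrite /= -[in RHS](hsubmxK (g y)) mul_row_col mulmx1 mulmx0 addr0.
by move=> gd; apply: differentiable_comp gd _; exact: differentiable_mulmxr.
Qed.

Variables (n m : nat) (U : set 'rV[C]_n) (f : 'rV[C]_n -> 'rV[C]_m).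
Hypothesis hf : proj_holo_map U f.

Lemma local_lift z : U z -> exists (r : R) (g : 'rV[C]_n -> 'rV[C]_m), 0 < r /\
  forall w : 'rV[C]_n, nrm (w - z) < r ->
    [/\ U w, differentiable g w & exists2 c, c != 0 & f w = c *: g w].
Proof.
move=> Uz; have [_ [_ /(_ z Uz)[V [oV Vz VU [g H]]]]] := hf.
have /nearP[r r0 rV] : \forall w \near z, V w by exact: open_nbhs_nbhs.
exists r, g; split=> // w /rV Vw; have [gd _ [_ [c [c0 fw]]]] := H w Vw.
by split; [exact: VU|exact: gd|exists c].
Qed.

(** [f] need not be differentiable, only its local lifts are. Homogeneity of [Q] makes its vanishing
    independent of the lift, so the set where it vanishes nearby is open and closed in [U]. *)
Lemma identity_principle (Q : 'rV[C]_n -> 'rV[C]_m -> C) a : connected U ->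
  (forall z c y, Q z (c *: y) = c * Q z y) ->
  (forall g z, differentiable g z -> differentiable (fun w => Q w (g w)) z) ->
  U a -> (\forall z \near a, Q z (f z) = 0) -> forall z, U z -> Q z (f z) = 0.
Proof.
move=> cU Qs Qd Ua Qa.
pose D : set 'rV[C]_n := [set z : 'rV[C]_n | \forall w \near z, Q w (f w) = 0].
suff UD : U `&` D = U by move=> z; rewrite -{1}UD => -[_]; exact: nbhs_singleton.
apply: cU.
- by exists a.
- exists D => //; rewrite openE => z; exact: near_join.
exists (closure (U `&` D)); first exact: closed_closure.
apply/seteqP; split=> [z zD|z [Uz zc]]; first by split; [case: zD|exact: subset_closure].
split; [exact: Uz|]; have [r [g [r0 H]]] := local_lift Uz.
have r8 : 0 < r / 8 by exact: divr_gt0.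
have zb : \forall w \near z, nrm (w - z) < r / 8 by apply: near_ball; rewrite subrr nrm0.
have [b [[_ bD] br]] : (U `&` D) `&` [set w : 'rV[C]_n | nrm (w - z) < r / 8] !=set0.
  exact: (zc _ zb).
apply/nearP; exists (r / 8); [exact: r8|move=> w wr].
have wr1 : nrm (w - z) < r by apply: (lt_trans wr); rewrite ltr_pdivrMr // ltr_pMr // ltr1n.
have br1 : nrm (b - z) < r by apply: (lt_trans br); rewrite ltr_pdivrMr // ltr_pMr // ltr1n.
have [_ _ [c c0 ->]] := H w wr1; rewrite Qs.
rewrite (@ball_unique R _ (fun w => Q w (g w)) z b w r _ br wr) ?mulr0 //.
  by move=> y /H[_ gd _]; exact: Qd.
apply: filterS2 bD (near_ball br1) => y Qy /H[_ _ [c' c'0 fy]].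
by move: Qy; rewrite fy Qs => /eqP; rewrite mulf_eq0 (negbTE c'0) => /eqP.
Qed.

End IdentityPrinciple.

Section GlobalDichotomy.
Variable R : realType.
Notation C := R[i].

Lemma minor2_collinear k (u v : 'rV[C]_k) : v != 0 -> (forall i j, minor2 u v i j = 0) ->
  exists c, u = c *: v.
Proof.
case/rV0Pn => j vj h; exists (u 0 j / v 0 j); apply/rowP => i; rewrite mxE.
have /eqP := h i j; rewrite /minor2 subr_eq0 => /eqP e.
by apply: (mulIf vj); rewrite e mulrAC divfK.
Qed.

Lemma hform_nondegenerate s (z : 'rV[C]_(1 + s)) : (forall w, hform 1 s z w = 0) -> z = 0.
Proof.
move=> h; apply/rowP => j; rewrite mxE; have := h (delta_mx 0 j).
rewrite /hform (bigD1 j) //= big1 => [|i ij]; last first.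
  by rewrite mxE (negbTE ij) andbF conjC0 mulr0.
rewrite addr0 mxE !eqxx conjC1 mulr1 => /eqP; rewrite mulf_eq0 => /orP[|/eqP //].
rewrite /hsign ltn_ord; case: ifP => _; by rewrite ?oppr_eq0 oner_eq0.
Qed.

(** The source form is nondegenerate, so nothing can be killed by an isometry. *)
Lemma isometry_neq0 s k m (L : 'M[C]_(1 + s, m)) (z : 'rV[C]_(1 + s)) :
  lin_isometry 1 s 1 k L -> z != 0 -> z *m L != 0.
Proof.
move=> Li; apply: contraNneq => zL; apply/eqP/hform_nondegenerate => w.
rewrite -Li zL /hform big1 // => j _; by rewrite mxE mulr0 mul0r.
Qed.

Variables (s s' t' : nat) (U : set 'rV[C]_(1 + s)) (f : 'rV[C]_(1 + s) -> 'rV[C]_(1 + s' + t')).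
Hypothesis cone : is_cone U.
Hypothesis cU : connected U.
Hypothesis hf : proj_holo_map U f.
Hypothesis orth : local_orthogonal 1 s 1 s' U f.
Hypothesis dim : (s' + 2 <= 2 * s)%N.

Lemma cone_neq0 z : U z -> z != 0.
Proof. by have [U0 _] := cone; move=> Uz; apply: contra_notN U0 => /eqP <-. Qed.

Lemma lift_local_model z (r : R) (g : 'rV[C]_(1 + s) -> 'rV[C]_(1 + s' + t')) :
  U z -> hform 1 s z z = 0 -> 0 < r ->
  (forall w : 'rV[C]_(1 + s), nrm (w - z) < r ->
    [/\ U w, differentiable g w & exists2 c, c != 0 & f w = c *: g w]) ->
  local_model (fun w => lsubmx (g w) : 'rV[C]_(1 + s')) z r.
Proof.
move=> Uz zz r0 H; split=> //.
- by apply: contraNneq (cone_neq0 Uz) => /(hform_null_eq0 zz) ->.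
- by move=> w /H[_ gd _]; exact: differentiable_lsubmx.
- move=> p q /H[Up _ [c c0 fp]] /H[Uq _ [d d0 fq]] /(orth Up Uq).
  rewrite fp fq hformZl hformZr hform_lsubmx => /eqP.
  by rewrite !mulf_eq0 conjC_eq0 (negbTE c0) (negbTE d0) => /eqP.
- move=> p l /H[Up _ [c c0 fp]] /H[_ _ [d d0 flp]] l0.
  have [_ [/(_ p l Up l0)[_ [b [b0 fE]]] _]] := hf.
  exists (d^-1 * (b * c)); first by rewrite !mulf_neq0 ?invr_eq0.
  rewrite -linearZ -scalerA -scalerA -fp -fE flp scalerA mulVf // scale1r //.
Qed.

Lemma global_dichotomy : (exists z, U z /\ hform 1 s z z = 0) ->
  (exists v : 'rV[C]_(1 + s'), hform 1 s' v v = 0 /\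
     forall z, U z -> exists c, lsubmx (f z) = c *: v) \/
  (exists L : 'M[C]_(1 + s, 1 + s'), [/\ lin_isometry 1 s 1 s' L,
     (exists2 z, U z & lsubmx (f z) != 0) &
     forall z, U z -> exists c, lsubmx (f z) = c *: (z *m L)]).
Proof.
case=> z0 [Uz0 zz]; have [r [g [r0 H]]] := local_lift hf Uz0.
have lm := lift_local_model Uz0 zz r0 H.
have [f0|/existsNP[z1 /not_implyP[Uz1 /eqP f1]]] := pselect (forall z, U z -> lsubmx (f z) = 0).
  left; exists 0; split; first by rewrite -(scale0r 0) hformZl mul0r.
  by move=> z Uz; exists 0; rewrite scale0r f0.
have [[e e0 He]|[L [a [Li ar La]]]] := local_dichotomy lm; last first.
  right; exists L; split; [by []|by exists z1|move=> z Uz].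
  apply: minor2_collinear; first exact: isometry_neq0 Li (cone_neq0 Uz).
  move=> i j; have [Ua _ _] := H a ar.
  apply: (@identity_principle R _ _ U f hf (fun z y => minor2 (lsubmx y) (z *m L) i j) a cU _ _ Ua _ z Uz).
  - by move=> w c y; rewrite linearZ minor2Zl.
  - move=> h w hd; apply: differentiable_minor2; last exact: differentiable_mulmxr.
    exact: differentiable_lsubmx.
  - apply: filterS2 La (near_ball ar) => w /(_ i j) Lw /H[_ _ [c _ ->]].
    by rewrite linearZ minor2Zl Lw mulr0.
left; pose d := Num.min e r; have d0 : 0 < d by rewrite lt_min e0.
have Hd (w : 'rV[C]_(1 + s)) : nrm (w - z0) < d -> nrm (w - z0) < e /\ nrm (w - z0) < r.
  by rewrite lt_min => /andP[].
(* The point [z1] with nonzero image modulo the radical may be far from [z0]; if all images near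
   [z0] vanished, so would the one at [z1]. The image of [w] then spans the null line containing all
   images. *)
have [w [wd gw]] : exists w : 'rV[C]_(1 + s), nrm (w - z0) < d /\ lsubmx (g w) != 0.
  apply/not_existsP => N; case/negP: f1; apply/eqP/rowP => i; rewrite [RHS]mxE.
  apply: (@identity_principle R _ _ U f hf (fun z y => lsubmx y 0 i) z0 cU _ _ Uz0 _ z1 Uz1).
  - by move=> z c y; rewrite linearZ mxE.
  - by move=> h z hd; apply: differentiable_entry; exact: differentiable_lsubmx.
  - apply/nearP; exists d => // w wd; have [_ /H[_ _ [c _ ->]]] := Hd w wd.
    have g0 : lsubmx (g w) = 0 by apply: contra_notP (N w) => /eqP.
    by rewrite linearZ /= g0 scaler0 mxE.
have [we wr] := Hd w wd.
exists (lsubmx (g w)); split; first exact: He.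
move=> z Uz; apply: minor2_collinear => // i j.
apply: (@identity_principle R _ _ U f hf (fun z y => minor2 (lsubmx y) (lsubmx (g w)) i j) z0 cU _ _ Uz0 _ z Uz).
- by move=> y c x; rewrite linearZ minor2Zl.
- move=> h y hd; apply: differentiable_minor2; first exact: differentiable_lsubmx.
  exact: differentiable_cst.
- apply/nearP; exists d => // y yd; have [ye /H[_ _ [c _ ->]]] := Hd y yd.
  by rewrite linearZ minor2Zl null_parallel ?mulr0 // He.
Qed.

End GlobalDichotomy.

(** * Splitting off the radical *)

Section Assembly.
Variable R : realType.
Notation C := R[i].

Lemma lsubmx_span (p q : nat) (v : 'rV[C]_p) (u : 'rV[C]_(p + q)) :
  (u <= row_mx v (0 : 'rV[C]_q) + row_mx (0 : 'M[C]_(q, p)) 1%:M)%MS <-> exists c, lsubmx u = c *: v.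
Proof.
split=> [/sub_addsmxP[[a b] /= ->]|[c uc]].
  exists (a 0 0); rewrite linearD /= !mul_mx_row !row_mxKl mulmx0 addr0.
  by rewrite [a in LHS]mx11_scalar mul_scalar_mx.
apply/sub_addsmxP; exists (c%:M, rsubmx u); rewrite /= !mul_mx_row !mulmx0 mulmx1 add_row_mx.
by rewrite addr0 add0r mul_scalar_mx -uc hsubmxK.
Qed.

Section Blocks.
Variables p q : nat.
Let A : 'M[C]_(p + q) := block_mx 1%:M 0 0 0.
Let B : 'M[C]_(p + q) := block_mx 0 0 0 1%:M.

Lemma row_mx_mulA (u : 'rV[C]_(p + q)) : u *m A = row_mx (lsubmx u) 0.
Proof. by rewrite -{1}(hsubmxK u) mul_row_block !mulmx0 mulmx1 !addr0. Qed.

Lemma row_mx_mulB (u : 'rV[C]_(p + q)) : u *m B = row_mx 0 (rsubmx u).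
Proof. by rewrite -{1}(hsubmxK u) mul_row_block !mulmx0 mulmx1 !add0r. Qed.

Lemma sub_blockA (u : 'rV[C]_(p + q)) : (u <= A)%MS -> rsubmx u = 0.
Proof. by case/submxP=> x ->; rewrite row_mx_mulA row_mxKr. Qed.

Lemma sub_blockB (u : 'rV[C]_(p + q)) : (u <= B)%MS -> lsubmx u = 0.
Proof. by case/submxP=> x ->; rewrite row_mx_mulB row_mxKl. Qed.

Lemma block_capmx : (A :&: B = 0)%MS.
Proof.
apply/eqP; rewrite -submx0; apply/rV_subP => u; rewrite sub_capmx => /andP[uA uB].
by rewrite -(hsubmxK u) (sub_blockA uA) (sub_blockB uB) row_mx0 sub0mx.
Qed.

Lemma block_addsmx : row_full (A + B)%MS.
Proof.
rewrite -sub1mx; apply: submx_trans (addmx_sub_adds (submx_refl A) (submx_refl B)).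
by rewrite add_block_mx !addr0 !add0r -scalar_mx_block.
Qed.

Lemma proj_blockA (u : 'rV[C]_(p + q)) : u *m proj_mx A B = row_mx (lsubmx u) 0.
Proof.
have uE : u = u *m A + u *m B by rewrite row_mx_mulA row_mx_mulB add_row_mx addr0 add0r hsubmxK.
rewrite [in LHS]uE mulmxDl proj_mx_id ?submxMl ?block_capmx // proj_mx_0 ?submxMl ?block_capmx //.
by rewrite addr0 row_mx_mulA.
Qed.

End Blocks.

Variables (s s' t' : nat) (U : set 'rV[C]_(1 + s)) (f : 'rV[C]_(1 + s) -> 'rV[C]_(1 + s' + t')).

Lemma null_case (v : 'rV[C]_(1 + s')) : hform 1 s' v v = 0 ->
  (* The null space is spanned by the null vector [v] and the radical. *)
  (forall z, U z -> exists c, lsubmx (f z) = c *: v) -> null_map 1 s' U f.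
Proof.
move=> vv H; exists (row_mx v (0 : 'rV[C]_t') + row_mx (0 : 'M[C]_(t', 1 + s')) 1%:M)%MS; split.
  move=> u w /lsubmx_span[a ua] /lsubmx_span[b wb].
  by rewrite hform_lsubmx ua wb hformZl hformZr vv !mulr0.
by move=> z /H h; apply/lsubmx_span.
Qed.

Lemma lsubmx_thin (u : 'rV[C]_(1 + s' + t')) : t' = 0%N -> u = row_mx (lsubmx u) 0.
Proof.
move: u; case: t' => // u _; rewrite -[LHS]hsubmxK; congr row_mx; exact: thinmx0.
Qed.

Lemma constant_case (v : 'rV[C]_(1 + s')) : t' = 0%N -> (forall z, U z -> f z != 0) ->
  (forall z, U z -> exists c, lsubmx (f z) = c *: v) -> constant_map U f.
Proof.
move=> t0 fn H.
have fE z : U z -> exists2 c, c != 0 & f z = c *: row_mx v 0.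
  move=> Uz; have [c fc] := H z Uz; have fE := lsubmx_thin (f z) t0.
  have fz : f z = c *: row_mx v 0 by rewrite fE fc scale_row_mx scaler0.
  by exists c => //; apply: contraNneq (fn z Uz) => c0; rewrite fz c0 scale0r.
move=> x y Ux Uy; split; first exact: fn.
have [c c0 ->] := fE x Ux; have [d d0 ->] := fE y Uy.
exists (d / c); rewrite mulf_neq0 ?invr_eq0 //; split => //.
by rewrite scalerA divfK.
Qed.

Variable L : 'M[C]_(1 + s, 1 + s').
Hypothesis Li : lin_isometry 1 s 1 s' L.
Hypothesis U0 : forall z, U z -> z != 0.
Hypothesis fL : forall z, U z -> exists c, lsubmx (f z) = c *: (z *m L).
Let L' : 'M[C]_(1 + s, 1 + s' + t') := row_mx L 0.

Lemma isometry_row_mx : lin_isometry 1 s 1 s' L'.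
Proof. by move=> u v; rewrite hform_lsubmx !mul_mx_row !row_mxKl Li. Qed.

Lemma proj_eq_row_mx z : U z -> row_mx (lsubmx (f z)) (0 : 'rV[C]_t') != 0 ->
  proj_eq (z *m L') (row_mx (lsubmx (f z)) 0).
Proof.
move=> Uz; have [c ->] := fL Uz => n0.
split; first exact: isometry_neq0 isometry_row_mx (U0 Uz).
exists c; rewrite mul_mx_row scale_row_mx mulmx0 scaler0; split => //.
by apply: contraNneq n0 => ->; rewrite scale0r row_mx0.
Qed.

Lemma standard_case : t' = 0%N -> (forall z, U z -> f z != 0) -> standard_map 1 s 1 s' U f.
Proof.
move=> t0 fn; exists L'; split; first exact: isometry_row_mx.
by move=> z Uz; rewrite (lsubmx_thin (f z) t0); apply: proj_eq_row_mx; rewrite // -lsubmx_thin // fn.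
Qed.

(* [A] is the span of the first [1 + s'] coordinates and [B] the radical. *)
Lemma quasi_standard_case : (0 < t')%N -> (exists2 z, U z & lsubmx (f z) != 0) ->
  quasi_standard 1 s 1 s' U f.
Proof.
move=> t0 [z Uz fz]; right.
pose A : 'M[C]_(1 + s' + t') := block_mx 1%:M 0 0 0.
pose B : 'M[C]_(1 + s' + t') := block_mx 0 0 0 1%:M.
exists A, B; split.
- split; [by rewrite block_capmx; apply/andP; split; exact: submx_refl|exact: block_addsmx| |].
  + apply: contraNneq fz => A0; have := row_mx_mulA (f z); rewrite -/A A0 mulmx0 => h.
    by rewrite -[lsubmx _](row_mxKl _ (0 : 'rV[C]_t')) -h linear0.
  + apply/eqP => B0; have := congr1 drsubmx B0; rewrite block_mxKdr => /matrixP.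
    move/(_ (Ordinal t0) (Ordinal t0)) => /eqP; by rewrite !mxE eqxx oner_eq0.
- by move=> a b _ bB; rewrite hform_lsubmx (sub_blockB bB) hform0r.
- exists L'; split; [|exact: isometry_row_mx| |].
  + by have -> : L' = L' *m A; [rewrite /L' mul_row_block !mulmx0 mulmx1 !addr0|exact: submxMl].
  + exists z; split => //; rewrite proj_blockA; apply: contraNneq fz => h.
    by rewrite -[lsubmx _](row_mxKl _ (0 : 'rV[C]_t')) h linear0.
  + by move=> w Uw; rewrite proj_blockA; exact: proj_eq_row_mx.
- exists B; split; [exact: submx_refl| |by move=> w _; exact: proj_mx_sub].
  by move=> u v uB _; rewrite hform_lsubmx (sub_blockB uB) hform0l.
Qed.

End Assembly.

Theorem mainTheorem13 (R : realType) (s s' t' : nat)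
  (U : set 'rV[R[i]]_(1 + s)) (f : 'rV[R[i]]_(1 + s) -> 'rV[R[i]]_(1 + s' + t')) :
  is_cone U -> open U -> connected U ->
  (exists z, U z /\ hform 1 s z z = 0) ->
  proj_holo_map U f ->
  local_orthogonal 1 s 1 s' U f ->
  (s' + 2 <= 2 * s)%N ->
  (null_map 1 s' U f \/ quasi_standard 1 s 1 s' U f) /\
  (t' = 0%N -> constant_map U f \/ standard_map 1 s 1 s' U f).
Proof.
move=> cone _ cU hnull hf orth dim.
have U0 := cone_neq0 cone; have [fn _] := hf.
have [[v [vv H]]|[L [Li fz fL]]] := global_dichotomy cone cU hf orth dim hnull.
  by split; [left; exact: null_case vv H|move=> t0; left; exact: constant_case t0 fn H].
have st t0 := standard_case Li U0 fL t0 fn.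
split; [right|by move=> /st; right].
(* The radical can serve as the nonzero summand [B] only for [0 < t']; without radical the map is
   itself standard. *)
by have [/st|t0] := posnP t'; [left|exact: quasi_standard_case Li U0 fL t0 fz].
Qed.
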